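(* Let $\eta$ be a holomorphic $1$-form on a neighborhood of the origin in $\mathbb{C}^3$ such that $(\eta\wedge d\eta)(0)\ne0$. Then the distribution $\eta=0$ supports a Legendrian holomorphic vector field $Z$ on a neighborhood of the origin in $\mathbb{C}^3$, having an invariant hypersurface $\mathcal{S}$ through the origin, such that the following property holds: given any neighborhood $\Delta$ of the origin in $\mathbb{C}^3$, there exists a neighborhood $\Delta^*\subset\Delta$ of the origin in $\mathbb{C}^3$ such that any leaf of $Z$ through a point in $\Delta^*\setminus\mathcal{S}$ is dense in $\Delta^*$.
   Context: A holomorphic vector field $Z$ (not identically zero) generates a one-dimensional singular holomorphic foliation, whose leaves are those of the regular foliation defined by $Z$ off its zero set. $Z$ is Legendrian for a distribution $\mathcal{D}$ if its leaves are tangent to $\mathcal{D}$; here this means $\eta(Z)=0$. A leaf $L$ is dense in $\Delta^*$ if $\Delta^*\subset\overline{L\cap\Delta^*}$. *)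

(* Defs.v *)
(* Throughout, neighborhoods are represented by their open
   representatives or by [nbhs], and holomorphy on an open subset of C^n is
   Frechet differentiability over the field C at each of its points. *)
From Stdlib Require Export Relation_Operators.
From mathcomp Require Export all_boot all_order all_algebra.
From mathcomp Require Export complex.
From mathcomp Require Export all_classical all_reals all_analysis.
Export numFieldNormedType.Exports.

Set Implicit Arguments.
Unset Strict Implicit.
Unset Printing Implicit Defensive.

Import Order.TTheory GRing.Theory Num.Theory.
Local Open Scope classical_set_scope.
Local Open Scope ring_scope.

(* R[i], packed so that it is seen as a [numClosedFieldType]: the topology, the
   normed structure and the derivative of MathComp-Analysis then apply to it,
   with C itself as the field of scalars. *)
Definition Cplx (R : realType) : numClosedFieldType := (R[i])%C.

Notation C3 R := 'rV[Cplx R]_3.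

Notation C3dual R := 'cV[Cplx R]_3.

Section Defs.
Context {R : realType}.
Implicit Types (U S D L : set (C3 R)) (Z : C3 R -> C3 R) (eta : C3 R -> C3dual R).

Definition holomorphic_on (W : normedModType (Cplx R)) U (f : C3 R -> W) :=
  forall x, U x -> differentiable f x.

(* A covector is the column of its coefficients on dx_1, dx_2, dx_3. *)
Definition pairing (a : C3dual R) (v : C3 R) : Cplx R := (v *m a) 0 0.

Definition ext_deriv eta (x u v : C3 R) : Cplx R :=
  pairing ('D_u eta x) v - pairing ('D_v eta x) u.

Definition wedge12 (a : C3 R -> Cplx R) (b : C3 R -> C3 R -> Cplx R)
    (u v w : C3 R) : Cplx R :=
  a u * b v w + a v * b w u + a w * b u v.

Definition contact_at eta (x : C3 R) :=
  exists u v w, wedge12 (pairing (eta x)) (ext_deriv eta x) u v w != 0.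

Definition legendrian eta U Z := forall x, U x -> pairing (eta x) (Z x) = 0.

Definition regular U Z : set (C3 R) := [set x | U x /\ Z x != 0].

Definition integral_curve U Z (T : set (Cplx R)) (phi : Cplx R -> C3 R) :=
  [/\ open T, connected T &
      forall t, T t -> regular U Z (phi t) /\ is_derive t 1 phi (Z (phi t))].

Definition on_integral_curve U Z (p q : C3 R) :=
  exists T phi, integral_curve U Z T phi /\
    exists s t, [/\ T s, T t, phi s = p & phi t = q].

(* The leaf through a regular point p consists of the points that can be joined
   to p by a finite chain of integral curves with complex time; chains are used
   because a solution may be multivalued in time along a leaf. *)
Definition leaf U Z (L : set (C3 R)) :=
  exists p, regular U Z p /\
    L = [set q | clos_refl_trans (C3 R) (on_integral_curve U Z) p q].

(* Closed analytic subset of U of pure codimension one, possibly singular: the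
   connectedness of W excludes local equations vanishing identically near a
   point.  At p outside S the equation has no zero near p, so S is closed in U. *)
Definition analytic_hypersurface U S :=
  S `<=` U /\
  forall p, U p -> exists (W : set (C3 R)) (f : C3 R -> Cplx R),
    [/\ open_nbhs p W /\ W `<=` U,
        connected W,
        holomorphic_on W f,
        exists x, W x /\ f x != 0
      & S `&` W = [set x | W x /\ f x = 0]].

Definition invariant U Z S :=
  forall L, leaf U Z L -> L `&` S !=set0 -> L `<=` S.

Definition dense_leaf_in L D := D `<=` closure (L `&` D).

End Defs.

(* Main.v *)
(* Proof idea.  In contact coordinates (x, y, z) the form eta is proportional to
   dz - y dx (Darboux), and
     Z = d/dx + y k(x) d/dy + y d/dz
   is Legendrian and leaves S = {y = 0} invariant.  Take for k a sum of four
   simple poles a_j / (x - x_j) placed around 0.  Lifting to a leaf a loop of the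
   x-plane around x_j gives a return map of the fibre x = 0 of the form
   (y, z) -> (exp(2 i pi a_j) y, z + s_j y), defined near (0, 0).  The exponents
   i, i sqrt 2, sqrt 2 and -1 give two contractions exp(-2 pi), exp(-2 pi sqrt 2)
   and a rotation exp(2 i pi sqrt 2), which together generate a dense subgroup of
   the multiplicative group of C, and a pure translation z -> z + s y with s <> 0.
   To join two points, shrink y by a large power of the first contraction, adjust
   its modulus and argument, move z on the fine lattice spanned by s y and its
   rotated copy, and expand y again.

   The Darboux chart is obtained by solving v_y + B v_z = 0 with a Nagumo-type
   iteration, from Goursat's theorem and Cauchy's estimate. *)
From HB Require Import structures.
Require Import Defs.
From mathcomp Require Import ring lra.

Set Implicit Arguments.
Unset Strict Implicit.
Unset Printing Implicit Defensive.

Import Order.TTheory GRing.Theory Num.Theory.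
Local Open Scope classical_set_scope.
Local Open Scope ring_scope.

(** The neighbourhood carrying the field is chosen before Delta, and this is what makes the
    statement possible: a leaf may run around the poles, far outside Delta, as long as it stays in
    that neighbourhood. So the contact chart must cover a fixed bounded region holding all four
    loops, while the return maps are needed only on a tiny bidisc of the fibre. The poles are the
    fourth roots of unity: the disc of radius 5/4 about each one contains 0 and no other pole, so
    each loop is a unit circle about its pole, based at 0. The obstacle is that return maps are
    partial: a word in them must keep |y| and |z| small at every letter. A contraction word shifts z
    by at most a geometric sum in |y|, whatever its length; rotations shift it in proportion to
    their number, which is harmless because this number is fixed before y is contracted. The value
    of y is matched exactly, after replacing the target by a nearby one, and z only approximately;
    this is possible because the action on y does not depend on z. *)

Definition toC (R : realType) (a : R) : Cplx R := (a%:C)%C.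
Definition Ci (R : realType) : Cplx R := ('i)%C.
Definition rRe (R : realType) (z : Cplx R) : R := complex.Re z.
Definition rIm (R : realType) (z : Cplx R) : R := complex.Im z.
(* In Cplx R the norm is a complex number; [rn] is its value as a real. *)
Definition rn (R : realType) (V : normedModType (Cplx R)) (v : V) : R :=
  rRe `|v|.

(** * Real and imaginary parts, real-valued norms, Frechet derivatives in epsilon form *)

Section Basics.
Context {R : realType}.
Local Notation C := (Cplx R).

Lemma C_ext (z w : C) : rRe z = rRe w -> rIm z = rIm w -> z = w.
Proof. by case: z w => a b [c d] /= -> ->. Qed.
Lemma rRe0 : rRe (0 : C) = 0. Proof. by []. Qed.
Lemma rIm0 : rIm (0 : C) = 0. Proof. by []. Qed.
Lemma rRe1 : rRe (1 : C) = 1. Proof. by []. Qed.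
Lemma rIm1 : rIm (1 : C) = 0. Proof. by []. Qed.
Lemma rReD (z w : C) : rRe (z + w) = rRe z + rRe w.
Proof. by case: z w => a b [c d]. Qed.
Lemma rImD (z w : C) : rIm (z + w) = rIm z + rIm w.
Proof. by case: z w => a b [c d]. Qed.
Lemma rReN (z : C) : rRe (- z) = - rRe z. Proof. by case: z. Qed.
Lemma rImN (z : C) : rIm (- z) = - rIm z. Proof. by case: z. Qed.
Lemma rReM (z w : C) : rRe (z * w) = rRe z * rRe w - rIm z * rIm w.
Proof. by case: z w => a b [c d]. Qed.
Lemma rImM (z w : C) : rIm (z * w) = rRe z * rIm w + rIm z * rRe w.
Proof. by case: z w => a b [c d]. Qed.
Lemma rRe_toC (a : R) : rRe (toC a) = a. Proof. by []. Qed.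
Lemma rIm_toC (a : R) : rIm (toC a) = 0. Proof. by []. Qed.
Lemma rRe_i : rRe (Ci R) = 0. Proof. by []. Qed.
Lemma rIm_i : rIm (Ci R) = 1. Proof. by []. Qed.
Definition cE := (rRe0, rIm0, rRe1, rIm1, rReD, rImD, rReN, rImN, rReM, rImM,
  rRe_toC, rIm_toC, rRe_i, rIm_i).

Lemma toCD (a b : R) : toC (a + b) = toC a + toC b.
Proof. by apply: C_ext; rewrite !cE ?addr0. Qed.
Lemma toCN (a : R) : toC (- a) = - toC a.
Proof. by apply: C_ext; rewrite !cE ?oppr0. Qed.
Lemma toCB (a b : R) : toC (a - b) = toC a - toC b.
Proof. by rewrite toCD toCN. Qed.
Lemma toCM (a b : R) : toC (a * b) = toC a * toC b.
Proof. by apply: C_ext; rewrite !cE; ring. Qed.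
Lemma toC0 : toC (0 : R) = 0. Proof. by []. Qed.
Lemma toC1 : toC (1 : R) = 1. Proof. by []. Qed.
Lemma toC_inj : injective (@toC R).
Proof. by move=> a b /(congr1 (@rRe R)). Qed.
Lemma toC_eq0 (a : R) : (toC a == 0) = (a == 0).
Proof. by apply/eqP/eqP => [/toC_inj|->]. Qed.
Lemma toCV (a : R) : toC (a^-1) = (toC a)^-1.
Proof.
have [->|a0] := eqVneq a 0; first by rewrite invr0 toC0 invr0.
apply: (mulfI (x := toC a)); first by rewrite toC_eq0.
by rewrite -toCM !divff // toC_eq0.
Qed.
Lemma toC_nat n : toC (n%:R : R) = n%:R.
Proof. by elim: n => [//|n IH]; rewrite -!natr1 toCD IH. Qed.
Lemma ReImE (z : C) : z = toC (rRe z) + Ci R * toC (rIm z).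
Proof. by apply: C_ext; rewrite !cE; ring. Qed.
Lemma ltC0 (e : C) : 0 < e -> e = toC (rRe e) /\ 0 < rRe e.
Proof.
case: e => a b; rewrite ltcE /= => /andP[/eqP -> a0]; split => //.
Qed.
Lemma toC_lt (a b : R) : (toC a < toC b) = (a < b).
Proof. by rewrite /toC ltcR. Qed.
Lemma toC_le (a b : R) : (toC a <= toC b) = (a <= b).
Proof. by rewrite /toC lecR. Qed.

Section Norm.
Context {V : normedModType C}.
Implicit Types v w : V.
Lemma normE v : `|v| = toC (rn v).
Proof.
have : 0 <= `|v| by exact: normr_ge0.
rewrite /rn; case: `|v| => a b; rewrite lecE /= => /andP[/eqP -> _] //.
Qed.
Lemma rn_ge0 v : 0 <= rn v.
Proof. by rewrite -toC_le -normE; exact: normr_ge0. Qed.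
Lemma rn0 : rn (0 : V) = 0. Proof. by rewrite /rn normr0. Qed.
Lemma rn_eq0 v : (rn v == 0) = (v == 0).
Proof. by rewrite -toC_eq0 -normE normr_eq0. Qed.
Lemma rn_eq0P v : rn v = 0 -> v = 0.
Proof. by move/eqP; rewrite rn_eq0 => /eqP. Qed.
Lemma rn_gt0 v : (0 < rn v) = (v != 0).
Proof. by rewrite lt_neqAle rn_ge0 andbT eq_sym rn_eq0. Qed.
Lemma rnD v w : rn (v + w) <= rn v + rn w.
Proof. by rewrite -toC_le toCD -!normE ler_normD. Qed.
Lemma rnN v : rn (- v) = rn v. Proof. by rewrite /rn normrN. Qed.
Lemma rnB v w : rn (v - w) <= rn v + rn w.
Proof. by rewrite -(rnN w) rnD. Qed.
Lemma rnC v w : rn (v - w) = rn (w - v).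
Proof. by rewrite -rnN opprB. Qed.
Lemma rn_tri w v u : rn (v - u) <= rn (v - w) + rn (w - u).
Proof. by apply: le_trans (rnD _ _); rewrite addrA subrK. Qed.
Lemma rnBB v w : rn v - rn w <= rn (v - w).
Proof. by rewrite lerBlDr; apply: le_trans (rnD _ _); rewrite subrK. Qed.
Lemma rn_nbhs v (A : set V) :
  nbhs v A <-> exists e : R, 0 < e /\ forall w, rn (w - v) < e -> A w.
Proof.
rewrite -nbhs_nbhs_norm; split=> [[e /= e0 sA]|[e [e0 sA]]].
  have [Ee e0'] := ltC0 e0.
  exists (rRe e); split=> // w vw; apply: sA; rewrite /= normE Ee toC_lt.
  by rewrite rnC.
exists (toC e); first by rewrite /= -toC0 toC_lt.
by move=> w /=; rewrite normE toC_lt rnC; apply: sA.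
Qed.
Lemma rn_open (A : set V) :
  open A <-> forall v, A v -> exists e : R, 0 < e /\ forall w, rn (w - v) < e -> A w.
Proof.
rewrite openE; split=> H v Av; first by apply/rn_nbhs; apply: H.
by apply/rn_nbhs; apply: H.
Qed.
End Norm.

Lemma rnZ (V : normedModType C) (a : C) (v : V) : rn (a *: v) = rn a * rn v.
Proof. by apply: toC_inj; rewrite toCM -!normE normrZ. Qed.
Lemma rnM (a b : C) : rn (a * b) = rn a * rn b.
Proof. by apply: toC_inj; rewrite toCM -!normE normrM. Qed.
Lemma rn1 : rn (1 : C) = 1. Proof. by rewrite /rn normr1. Qed.
Lemma rnV (a : C) : rn a^-1 = (rn a)^-1.
Proof. by apply: toC_inj; rewrite toCV -!normE normfV. Qed.
Lemma rnX (a : C) n : rn (a ^+ n) = (rn a) ^+ n.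
Proof. by elim: n => [|n IH]; rewrite ?rn1 // !exprS rnM IH. Qed.
Lemma rnS (a : C) : rn a ^+ 2 = rRe a ^+ 2 + rIm a ^+ 2.
Proof.
have := add_Re2_Im2 a; have := @normE C^o a => -> /(congr1 (@rRe R)).
rewrite expr2 !cE => E; apply/esym. rewrite [LHS]E; ring.
Qed.
Lemma rn_toC (a : R) : rn (toC a) = `|a|.
Proof.
apply/eqP; rewrite -(eqrXn2 (n := 2)) ?rn_ge0 //.
by rewrite rnS !cE real_normK ?num_real // expr0n addr0.
Qed.
Lemma rn_i : rn (Ci R) = 1.
Proof.
apply/eqP; rewrite -(eqrXn2 (n := 2)) ?rn_ge0 //.
by rewrite rnS !cE expr0n expr1n add0r.
Qed.
Lemma rn_nat n : rn (n%:R : C) = n%:R.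
Proof. by rewrite -toC_nat rn_toC ger0_norm. Qed.
Lemma Re_le (z : C) : `|rRe z| <= rn z.
Proof.
rewrite -(ler_pXn2r (n := 2)) ?nnegrE ?rn_ge0 //.
by rewrite rnS real_normK ?num_real // lerDl sqr_ge0.
Qed.
Lemma Im_le (z : C) : `|rIm z| <= rn z.
Proof.
rewrite -(ler_pXn2r (n := 2)) ?nnegrE ?rn_ge0 //.
by rewrite rnS real_normK ?num_real // lerDr sqr_ge0.
Qed.
Lemma rn_le (z : C) : rn z <= `|rRe z| + `|rIm z|.
Proof.
rewrite {1}(ReImE z); apply: le_trans (rnD _ _) _.
by rewrite rnM rn_i mul1r !rn_toC.
Qed.
Section Diff.
Context {V W : normedModType C}.
(** Frechet derivative with real constants and an explicit candidate [L]; the bound [M] stands for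
    the continuity of [L]. The next two lemmas translate from and to [differentiable]. *)
Definition hasD (f : V -> W) (x : V) (L : V -> W) :=
  [/\ forall a u v, L (a *: u + v) = a *: L u + L v,
      exists M : R, forall v, rn (L v) <= M * rn v
    & forall e : R, 0 < e -> exists2 d : R, 0 < d & forall h, rn h < d ->
        rn (f (x + h) - f x - L h) <= e * rn h].

Lemma differentiable_hasD (f : V -> W) x :
  differentiable f x -> hasD f x ('d f x).
Proof.
move=> df; split.
- by move=> a u v; rewrite linearP.
- have /linear_lipschitz [M M0 H] : continuous ('d f x).
    by apply: diff_continuous.
  have [EM M0'] := ltC0 M0.
  exists (rRe M) => v; rewrite -toC_le toCM -!normE -EM; exact: H.
- move=> e e0; have /diff_locallyP [_ H0] := df.
  have e0' : 0 < toC e by rewrite -toC0 toC_lt.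
  have /rn_nbhs := (eqaddoP _ _ _ _).1 H0 _ e0'.
  move=> [d [d0 H]].
  exists d => // h hd; have := H h; rewrite subr0 => /(_ hd).
  have -> : (f \o shift x - (cst (f x) + 'd f x)) h = f (x + h) - f x - 'd f x h.
    by rewrite [x + h]addrC -addrA -opprD.
  by rewrite !normE -toCM toC_le.
Qed.

Lemma hasD_differentiable (f : V -> W) x L :
  hasD f x L -> differentiable f x /\ 'd f x = L :> (V -> W).
Proof.
move=> [Llin [M LM] H].
have HL : linear L by move=> a u v; apply: Llin.
pose Lm := GRing.isLinear.Build _ _ _ _ L HL.
pose L' : {linear V -> W} := HB.pack L Lm.
have cL : continuous L'.
  move=> v; apply/cvgrPdist_le => _/posnumP[e].
  have [Ee e0] := ltC0 (gt0 e).
  near=> w.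
  rewrite -linearB Ee normE toC_le; apply: le_trans (LM _) _.
  have : rn (v - w) <= rRe e%:num / (`|M| + 1).
    near: w; apply/rn_nbhs; exists (rRe e%:num / (`|M| + 1)); split.
      by rewrite divr_gt0 // ltr_wpDl.
    by move=> w; rewrite rnC => /ltW.
  rewrite ler_pdivlMr ?ltr_wpDl // => h.
  apply: le_trans h; rewrite mulrC; apply: ler_wpM2l; first exact: rn_ge0.
  by apply: le_trans (ler_norm _) _; rewrite lerDl.
have E : f \o shift x = cst (f x) + L' +o_ (0 : V) id.
  apply/eqaddoP => e e0; have [Ee e0'] := ltC0 e0.
  have [d d0 Hd] := H _ e0'.
  apply/rn_nbhs; exists d; split => // h; rewrite subr0 => /Hd.
  have -> : (f \o shift x - (cst (f x) + L')) h = f (x + h) - f x - L h.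
    by rewrite [x + h]addrC -addrA -opprD.
  by rewrite Ee !normE -toCM toC_le.
have dE := diff_unique cL E.
split; last by rewrite dE.
apply/diff_locallyP; split; first by rewrite dE.
by rewrite dE; exact: E.
Unshelve. all: by end_near. Qed.

End Diff.
End Basics.

(** * One complex variable *)

Section RealDer.
Context {R : realType}.
Local Notation C := (Cplx R).

Lemma is_derive_eps (f : R -> R) (s l : R) :
  is_derive s 1 f l <->
  forall e, 0 < e -> exists2 d, 0 < d &
    forall h, `|h| < d -> `|f (s + h) - f s - l * h| <= e * `|h|.
Proof.
split.
  move=> [df <-] e e0; move: df => /cvgrPdist_le /(_ e e0).
  rewrite near_withinE => /nbhs_ballP[d /= d0 H].
  exists d => // h hd.
  have [->|h0] := eqVneq h 0; first by rewrite addr0 subrr mulr0 subr0 normr0 mulr0.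
  have /= := H h; rewrite -ball_normE /= sub0r normrN => /(_ hd h0).
  rewrite -/(derive f s 1) /GRing.scale /= mulr1 [h + s]addrC => {}H.
  rewrite -(@ler_pM2l _ (`|h|^-1)) ?invr_gt0 ?normr_gt0 //.
  rewrite mulrCA mulVf ?normr_eq0 // mulr1 -normfV -normrM mulrBr.
  rewrite [h^-1 * (_ * h)]mulrCA mulVf // mulr1 distrC.
  exact: H.
move=> H.
have cv : h^-1 *: (f (h *: 1 + s) - f s) @[h --> 0^'] --> l.
  apply/cvgrPdist_le => e e0; have [d d0 {}H] := H _ e0.
  rewrite near_withinE; apply/nbhs_ballP; exists d => //= h.
  rewrite -ball_normE /= sub0r normrN => hd h0.
  have := H h hd.
  rewrite -(@ler_pM2l _ (`|h|^-1)) ?invr_gt0 ?normr_gt0 //.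
  rewrite mulrCA mulVf ?normr_eq0 // mulr1 -normfV -normrM mulrBr.
  rewrite [h^-1 * (_ * h)]mulrCA mulVf // mulr1 distrC.
  by rewrite /GRing.scale /= mulr1 [h + s]addrC.
apply: DeriveDef; first by apply/cvg_ex; exists l.
by apply/cvg_lim.
Qed.

(** The source is a real line and the target a complex one, with different fields of scalars, so the
    derivative is spelled out. *)
Definition rder (H : R -> C) (s : R) (l : C) :=
  forall e, 0 < e -> exists2 d, 0 < d &
    forall h, `|h| < d -> rn (H (s + h) - H s - toC h * l) <= e * `|h|.

Lemma rder_parts H s l :
  rder H s l <-> is_derive s 1 (fun t => rRe (H t)) (rRe l) /\
                 is_derive s 1 (fun t => rIm (H t)) (rIm l).
Proof.
split=> [D|[/is_derive_eps D1 /is_derive_eps D2]].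
  split; apply/is_derive_eps => e e0; have [d d0 {}D] := D e e0;
    exists d => // h /D; apply: le_trans.
    by apply: le_trans (Re_le _); rewrite !cE mul0r subr0 [h * _]mulrC.
  by apply: le_trans (Im_le _); rewrite !cE mul0r addr0 [h * _]mulrC.
move=> e e0; have e2 : 0 < e / 2 by rewrite divr_gt0.
have [d1 d10 {}D1] := D1 _ e2; have [d2 d20 {}D2] := D2 _ e2.
exists (Num.min d1 d2); first by rewrite lt_min d10.
move=> h; rewrite lt_min => /andP[/D1 h1 /D2 h2].
apply: le_trans (rn_le _) _; rewrite !cE !mul0r subr0 addr0 ![h * _]mulrC.
lra.
Qed.

Lemma rderD H1 H2 s l1 l2 :
  rder H1 s l1 -> rder H2 s l2 -> rder (fun t => H1 t + H2 t) s (l1 + l2).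
Proof.
move=> /rder_parts[A B] /rder_parts[A' B']; apply/rder_parts; split.
  have := is_deriveD A A'; rewrite -rReD; apply: near_eq_is_derive => //.
  by near=> t; rewrite rReD.
have := is_deriveD B B'; rewrite -rImD; apply: near_eq_is_derive => //.
by near=> t; rewrite rImD.
Unshelve. all: by end_near. Qed.

Lemma rderZ c H s l : rder H s l -> rder (fun t => c * H t) s (c * l).
Proof.
move=> D e e0; have c0 : 0 < rn c + 1 by rewrite ltr_wpDl // rn_ge0.
have [d d0 {}D] := D (e / (rn c + 1)) (divr_gt0 e0 c0).
exists d => // h /D {}D.
have -> : c * H (s + h) - c * H s - toC h * (c * l) =
          c * (H (s + h) - H s - toC h * l) by ring.
rewrite rnM; apply: le_trans (ler_wpM2l (rn_ge0 _) D) _.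
rewrite mulrA; apply: ler_wpM2r => //.
by rewrite mulrCA ler_piMr ?ltW // ltr_pdivrMr // mul1r ltrDl.
Qed.

Lemma rder_aff H s l (a b : R) :
  rder H (a + s * b) l -> rder (fun t => H (a + t * b)) s (toC b * l).
Proof.
move=> D e e0; have c0 : 0 < `|b| + 1 by rewrite ltr_wpDl.
have [d d0 {}D] := D (e / (`|b| + 1)) (divr_gt0 e0 c0).
exists (d / (`|b| + 1)); first exact: divr_gt0.
move=> h hd.
have hb : `|h * b| < d.
  rewrite normrM; move: hd; rewrite ltr_pdivlMr // => hd.
  by apply: le_lt_trans hd; apply: ler_wpM2l => //; rewrite lerDl.
have := D _ hb; rewrite mulrDl addrA toCM -mulrA => {}D.
apply: le_trans D _; rewrite normrM mulrA mulrAC.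
apply: ler_wpM2r => //.
by rewrite mulrAC ler_pdivrMr // ler_wpM2l ?ltW // ltrDl.
Qed.

Lemma rder_cont H s l : rder H s l ->
  forall e, 0 < e -> exists2 d, 0 < d &
    forall h, `|h| < d -> rn (H (s + h) - H s) < e.
Proof.
move=> D e e0; have [d d0 {}D] := D 1 ltr01.
have c0 : 0 < 2 + rn l by rewrite ltr_wpDr ?rn_ge0.
exists (Num.min d (e / (2 + rn l))); first by rewrite lt_min d0 divr_gt0.
move=> h; rewrite lt_min => /andP[/D {}D]; rewrite ltr_pdivlMr // => he.
have -> : H (s + h) - H s = H (s + h) - H s - toC h * l + toC h * l by ring.
apply: le_lt_trans (rnD _ _) _; rewrite rnM rn_toC.
have := normr_ge0 h; nra.
Qed.

Lemma rder_unique_cst H : (forall s : R, 0 <= s <= 1 -> rder H s 0) -> H 1 = H 0.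
Proof.
move=> D.
have aux (u : R -> R) : (forall s : R, 0 <= s <= 1 -> is_derive s 1 u 0) -> u 1 = u 0.
  move=> Du; have [||c _] := @MVT_segment R u (fun=> 0) 0 1 ler01.
  - by move=> x; rewrite in_itv /= => /andP[? ?]; apply: Du; rewrite !ltW.
  - apply: derivable_within_continuous => x; rewrite in_itv /= => x01.
    by have [] := Du _ x01.
  - by rewrite mul0r => /eqP; rewrite subr_eq0 => /eqP.
apply: C_ext; apply: (aux (fun t => _ (H t))) => s /D /rder_parts[] //.
Qed.

(** Complex-valued functions have no mean value equality: the real and imaginary parts are compared
    separately with b s^(k+1) / (k+1), and their sum costs the factor 2 found in later constants.
    The weight s^k yields the denominator k + 1 on which the Nagumo iteration relies. *)
Lemma rder_bound H (h : R -> C) (b : R) k :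
  (forall s : R, 0 <= s <= 1 -> rder H s (h s)) ->
  (forall s : R, 0 <= s <= 1 -> rn (h s) <= b * s ^+ k) ->
  rn (H 1 - H 0) <= 2 * (b / k.+1%:R).
Proof.
move=> D B.
have aux (u du : R -> R) : (forall s : R, 0 <= s <= 1 -> is_derive s 1 u (du s)) ->
   (forall s : R, 0 <= s <= 1 -> `|du s| <= b * s ^+ k) ->
   u 1 - u 0 <= b / k.+1%:R.
  move=> Du Bu.
  pose w := fun t : R => u t - (b / k.+1%:R) * t ^+ k.+1.
  have Dw (s : R) : 0 <= s <= 1 -> is_derive s 1 w (du s - b * s ^+ k).
    move=> s01; have Ds := Du s s01.
    have DX : is_derive s 1 (fun t : R => t ^+ k.+1) (k.+1%:R * s ^+ k).
      apply: DeriveDef; first exact: exprn_derivable.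
      by rewrite exp_derive /GRing.scale /= mulr1.
    have := is_deriveB Ds (is_deriveZ (b / k.+1%:R) DX).
    suff -> : b / k.+1%:R *: (k.+1%:R * s ^+ k) = b * s ^+ k by [].
    by rewrite /GRing.scale /= mulrA divfK // pnatr_eq0.
  have [||c] := @MVT_segment R w (fun s => du s - b * s ^+ k) 0 1 ler01.
  - by move=> x; rewrite in_itv /= => /andP[? ?]; apply: Dw; rewrite !ltW.
  - apply: derivable_within_continuous => x; rewrite in_itv /= => x01.
    by have [] := Dw _ x01.
  - rewrite in_itv /= => c01; rewrite subr0 mulr1 => E.
    have : w 1 - w 0 <= 0.
      rewrite E subr_le0; apply: le_trans (Bu _ c01); exact: ler_norm.
    rewrite /w expr1n mulr1 expr0n /= mulr0 subr0; set q := b / _; lra.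
have R1 := aux (fun t => rRe (H t)) (fun t => rRe (h t)).
have R2 := aux (fun t => - rRe (H t)) (fun t => - rRe (h t)).
have R3 := aux (fun t => rIm (H t)) (fun t => rIm (h t)).
have R4 := aux (fun t => - rIm (H t)) (fun t => - rIm (h t)).
have Br s : 0 <= s <= 1 -> `|rRe (h s)| <= b * s ^+ k.
  by move=> /B; apply: le_trans; exact: Re_le.
have Bi s : 0 <= s <= 1 -> `|rIm (h s)| <= b * s ^+ k.
  by move=> /B; apply: le_trans; exact: Im_le.
have {}R1 : rRe (H 1) - rRe (H 0) <= b / k.+1%:R.
  by apply: R1 => // s /D /rder_parts[].
have {}R3 : rIm (H 1) - rIm (H 0) <= b / k.+1%:R.
  by apply: R3 => // s /D /rder_parts[].
have {}R2 : - rRe (H 1) - - rRe (H 0) <= b / k.+1%:R.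
  apply: R2 => [s /D /rder_parts[? _]|s /Br]; last by rewrite normrN.
  exact: is_deriveN.
have {}R4 : - rIm (H 1) - - rIm (H 0) <= b / k.+1%:R.
  apply: R4 => [s /D /rder_parts[_ ?]|s /Bi]; last by rewrite normrN.
  exact: is_deriveN.
apply: le_trans (rn_le _) _; rewrite !cE mulr_natl mulr2n.
set q := b / _ in R1 R2 R3 R4 *; by apply: lerD; rewrite ler_norml; lra.
Qed.

Definition cont01 (h : R -> C) := forall s : R, 0 <= s <= 1 -> forall e, 0 < e ->
  exists2 d, 0 < d & forall t : R, 0 <= t <= 1 -> `|t - s| < d -> rn (h t - h s) < e.

Lemma cont_antider (g : R -> R) : continuous g ->
  exists G : R -> R, forall s : R, 0 <= s <= 1 -> is_derive s 1 G (g s).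
Proof.
move=> cg.
(* Starting at -1, inside the interval [-1, 2], makes the derivative two-sided at 0 and 1 as
   well. *)
exists (fun x => \int[lebesgue_measure]_(t in [set` `[-1, x]]) (g t))%R.
move=> s /andP[s0 s1].
have [||||d1 d2] := @continuous_FTC1_closed R g (-1) s 2.
- lra.
- apply: continuous_compact_integrable; first exact: segment_compact.
  by apply: continuous_subspaceT.
- lra.
- exact: cg.
apply: DeriveDef; first exact: d1.
by rewrite -derive1E.
Qed.

Lemma cont01_antider (h : R -> C) : cont01 h ->
  exists H, forall s : R, 0 <= s <= 1 -> rder H s (h s).
Proof.
move=> ch.
(* Clamping to [0, 1] extends [h] to a function continuous on the whole line. *)
pose cl (s : R) := Num.max 0 (Num.min 1 s).
have cl01 s : 0 <= cl s <= 1.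
  by rewrite /cl /Num.max /Num.min; repeat case: ifP; lra.
have clE s : 0 <= s <= 1 -> cl s = s.
  by rewrite /cl /Num.max /Num.min; repeat case: ifP; lra.
have clL s t : `|cl s - cl t| <= `|s - t|.
  have := ler_norm (t - s); rewrite distrC; have := ler_norm (s - t).
  by rewrite ler_norml /cl /Num.max /Num.min; repeat case: ifP; lra.
have aux (p : C -> R) : (forall z, `|p z| <= rn z) -> (forall z w, p (z - w) = p z - p w) ->
   continuous (fun s => p (h (cl s))).
  move=> pn pB s; apply/cvgrPdist_lt => e e0.
  have [d d0 {}ch] := ch _ (cl01 s) _ e0.
  exists d => // t /= std.
  rewrite -pB; apply: le_lt_trans (pn _) _; rewrite rnC; apply: ch => //.
  by apply: le_lt_trans (clL _ _) _; rewrite distrC.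
have [||G1 D1] := cont_antider (aux (@rRe R) _ _).
- exact: Re_le.
- by move=> z w; rewrite !cE.
have [||G2 D2] := cont_antider (aux (@rIm R) _ _).
- exact: Im_le.
- by move=> z w; rewrite !cE.
exists (fun s => toC (G1 s) + Ci R * toC (G2 s)) => s s01; apply/rder_parts.
have := D1 s s01; have := D2 s s01; rewrite clE // => E2 E1.
have -> : (fun t => rRe (toC (G1 t) + Ci R * toC (G2 t))) = G1.
  by apply/funext => t; rewrite !cE; ring.
have -> : (fun t => rIm (toC (G1 t) + Ci R * toC (G2 t))) = G2.
  by apply/funext => t; rewrite !cE; ring.
by [].
Qed.

(* The integral over [0, 1] is the increment of a primitive, and the junk value 0
   if h has none. *)
Definition prim01 (h : R -> C) : R -> C :=
  xget (fun=> 0) [set H | forall s : R, 0 <= s <= 1 -> rder H s (h s)].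
Definition Int (h : R -> C) : C := prim01 h 1 - prim01 h 0.

Lemma Int_FTC H h : (forall s : R, 0 <= s <= 1 -> rder H s (h s)) ->
  Int h = H 1 - H 0.
Proof.
move=> DH; rewrite /Int /prim01; case: xgetP => [P _ /= DP|/(_ H)]; last first.
  by move=> /(_ DH).
have E : P 1 + -1 * H 1 = P 0 + -1 * H 0.
  apply: (@rder_unique_cst (fun t => P t + -1 * H t)) => s s01.
  rewrite -(subrr (h s)) -[- h s]mulN1r.
  exact: rderD (DP _ s01) (rderZ (-1) (DH _ s01)).
have -> : P 1 = P 0 + -1 * H 0 + H 1 by rewrite -E; ring.
ring.
Qed.

Lemma Int_ext h1 h2 : (forall s : R, 0 <= s <= 1 -> h1 s = h2 s) -> Int h1 = Int h2.
Proof.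
move=> E; rewrite /Int; suff -> : prim01 h1 = prim01 h2 by [].
rewrite /prim01; congr xget; apply/seteqP; split=> H /= D s s01; have := D s s01;
 by rewrite E.
Qed.

Lemma Int_bound h b k : cont01 h ->
  (forall s : R, 0 <= s <= 1 -> rn (h s) <= b * s ^+ k) ->
  rn (Int h) <= 2 * (b / k.+1%:R).
Proof.
move=> /cont01_antider[H D] B; rewrite (Int_FTC D); exact: rder_bound D B.
Qed.

Lemma Int_lin c h1 h2 : cont01 h1 -> cont01 h2 ->
  Int (fun s => c * h1 s + h2 s) = c * Int h1 + Int h2.
Proof.
move=> /cont01_antider[H1 D1] /cont01_antider[H2 D2].
rewrite (Int_FTC D1) (Int_FTC D2).
rewrite (@Int_FTC (fun s => c * H1 s + H2 s)); first by ring.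
by move=> s s01; apply: rderD (D2 _ s01); apply: rderZ (D1 _ s01).
Qed.

Lemma cont01_lin c h1 h2 : cont01 h1 -> cont01 h2 ->
  cont01 (fun s => c * h1 s + h2 s).
Proof.
move=> c1 c2 s s01 e e0.
have q0 : 0 < e / 2 / (rn c + 1) by rewrite !divr_gt0 // ltr_wpDl // rn_ge0.
have [d1 d10 {}c1] := c1 s s01 _ q0.
have [d2 d20 {}c2] := c2 s s01 (e / 2) (divr_gt0 e0 (ltr0Sn _ 1)).
exists (Num.min d1 d2); first by rewrite lt_min d10.
move=> t t01; rewrite lt_min => /andP[/(c1 t t01) A /(c2 t t01) B].
have -> : c * h1 t + h2 t - (c * h1 s + h2 s) = c * (h1 t - h1 s) + (h2 t - h2 s) by ring.
apply: le_lt_trans (rnD _ _) _; rewrite rnM.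
have A' : rn (h1 t - h1 s) * (rn c + 1) < e / 2.
  by rewrite -ltr_pdivlMr // ltr_wpDl // rn_ge0.
have := rn_ge0 (h1 t - h1 s); have := rn_ge0 c; nra.
Qed.

Lemma Int_half h : cont01 h ->
  Int h = toC (2^-1) * Int (fun s => h (0 + s * 2^-1)) +
          toC (2^-1) * Int (fun s => h (2^-1 + s * 2^-1)).
Proof.
move=> ch; have [H D] := cont01_antider ch.
have D' a s : 0 <= a <= 2^-1 -> 0 <= s <= 1 ->
  rder (fun t => toC 2 * H (a + t * 2^-1)) s (h (a + s * 2^-1)).
  move=> a0 s01.
  rewrite -[h _](_ : toC 2 * (toC (2^-1) * h (a + s * 2^-1)) = _); last first.
    by rewrite mulrA -toCM mulfV ?pnatr_eq0 // mul1r.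
  by apply: rderZ; apply: rder_aff; apply: D; lra.
have a0 : 0 <= (0 : R) <= 2^-1 by lra.
have a1 : 0 <= (2^-1 : R) <= 2^-1 by lra.
rewrite (Int_FTC D) (Int_FTC (fun s => D' 0 s a0)) (Int_FTC (fun s => D' _ s a1)).
rewrite -!mulrBr !mulrA -!toCM !mulVf ?pnatr_eq0 // !toC1 !mul1r.
rewrite !mul0r !addr0 !add0r.
have -> : 2^-1 + 2^-1 = 1 :> R by lra.
ring.
Qed.

End RealDer.

(** * The complex exponential and the mean value inequality *)

Section CExp.
Context {R : realType}.
Local Notation C := (Cplx R).

Definition cexp (z : C) : C :=
  toC (expR (rRe z)) * (toC (cos (rIm z)) + Ci R * toC (sin (rIm z))).

Lemma cexp_Re z : rRe (cexp z) = expR (rRe z) * cos (rIm z).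
Proof. by rewrite /cexp !cE; ring. Qed.
Lemma cexp_Im z : rIm (cexp z) = expR (rRe z) * sin (rIm z).
Proof. by rewrite /cexp !cE; ring. Qed.
Lemma cexp0 : cexp 0 = 1.
Proof. by apply: C_ext; rewrite ?cexp_Re ?cexp_Im !cE expR0 ?cos0 ?sin0; ring. Qed.
Lemma cexpD z w : cexp (z + w) = cexp z * cexp w.
Proof.
by apply: C_ext; rewrite !(cexp_Re, cexp_Im, cE) expRD ?cosD ?sinD; ring.
Qed.
Lemma cexpN z : cexp z * cexp (- z) = 1.
Proof. by rewrite -cexpD subrr cexp0. Qed.
Lemma cexp_neq0 z : cexp z != 0.
Proof. by apply/eqP => E; have := cexpN z; rewrite E mul0r => /eqP; rewrite eq_sym oner_eq0. Qed.
Lemma cexpNV z : cexp (- z) = (cexp z)^-1.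
Proof. by apply: (mulfI (cexp_neq0 z)); rewrite cexpN divff // cexp_neq0. Qed.
Lemma rn_cexp z : rn (cexp z) = expR (rRe z).
Proof.
apply/eqP; rewrite -(eqrXn2 (n := 2)) ?rn_ge0 ?expR_ge0 //.
rewrite rnS cexp_Re cexp_Im !exprMn -mulrDr cos2Dsin2 mulr1 //.
Qed.
Lemma cexp_2pi z : cexp (z + Ci R * toC (2 * pi)) = cexp z.
Proof.
rewrite cexpD; suff -> : cexp (Ci R * toC (2 * pi)) = 1 by rewrite mulr1.
apply: C_ext; rewrite ?cexp_Re ?cexp_Im !cE.
  by rewrite !mul0r !mulr0 subr0 mul1r add0r expR0 mul1r mulr_natl cos2pi.
by rewrite !mul0r !mulr0 subr0 mul1r add0r mulr_natl sin2pi mulr0.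
Qed.
Lemma cexp_surj (z : C) : z != 0 -> exists w, cexp w = z.
Proof.
move=> z0; have n0 : 0 < rn z by rewrite rn_gt0.
pose c := rRe z / rn z; pose s := rIm z / rn z.
have cs : c ^+ 2 + s ^+ 2 = 1.
  rewrite /c /s !expr_div_n -mulrDl -rnS divff // expf_neq0 //.
  by rewrite gt_eqF.
have c1 : -1 <= c <= 1.
  by rewrite -ler_norml -(@expr_le1 _ 2) // real_normK ?num_real // -cs lerDl sqr_ge0.
(* The arc cosine fixes the cosine only; the sign of the sine selects the half-circle. *)
pose t := if 0 <= s then acos c else - acos c.
exists (toC (ln (rn z)) + Ci R * toC t).
have ct : cos t = c by rewrite /t; case: ifP => _; rewrite ?cosN acosK.
have st : sin t = s.
  have E : 1 - c ^+ 2 = s ^+ 2 by rewrite -cs; ring.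
  rewrite /t; case: ifPn => s0; rewrite ?sinN sin_acos // E sqrtr_sqr.
    by rewrite ger0_norm.
  by rewrite ltr0_norm ?opprK // ltNge.
apply: C_ext; rewrite ?cexp_Re ?cexp_Im !cE !mul0r !mulr0 subr0 !addr0 mul1r add0r lnK ?posrE //.
  by rewrite ?add0r ct /c mulrC divfK // gt_eqF.
by rewrite ?add0r st /s mulrC divfK // gt_eqF.
Qed.

Definition cder (f : C -> C) (x l : C) := hasD f x (fun h => h * l).

Lemma cder_eps (f : C -> C) (x l : C) : (forall e : R, 0 < e ->
    exists2 d : R, 0 < d & forall h : C, rn h < d ->
    rn (f (x + h) - f x - h * l) <= e * rn h) -> cder f x l.
Proof.
move=> H; split => //.
- by move=> a u v; rewrite /GRing.scale /=; ring.
- by exists (rn l) => v; rewrite rnM mulrC.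
Qed.

(** The addition law reduces to z = 0, where first-order expansions of exp, cos and sin leave five
    error terms of total at most 7 e / 8 |h|. *)
Lemma cder_cexp z : cder cexp z (cexp z).
Proof.
suff D0 : forall e : R, 0 < e -> exists2 d : R, 0 < d & forall h : C, rn h < d ->
    rn (cexp h - 1 - h) <= e * rn h.
  have c0 : 0 < rn (cexp z) by rewrite rn_gt0 cexp_neq0.
  apply: cder_eps => e e0; have [d d0 H] := D0 (e / rn (cexp z)) (divr_gt0 e0 c0).
  exists d => // h /H {}H.
  have -> : cexp (z + h) - cexp z - h * cexp z = cexp z * (cexp h - 1 - h).
    by rewrite cexpD; ring.
  rewrite rnM; apply: le_trans (ler_wpM2l (rn_ge0 _) H) _.
  by rewrite mulrA mulrCA divff ?mulr1 // gt_eqF.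
move=> e e0; have e8 : 0 < e / 8 by lra.
have [d1 d10 H1] := (is_derive_eps _ _ _).1 (is_derive_expR (0 : R)) _ e8.
have [d2 d20 H2] := (is_derive_eps _ _ _).1 (is_derive_cos (0 : R)) _ e8.
have [d3 d30 H3] := (is_derive_eps _ _ _).1 (is_derive_sin (0 : R)) _ e8.
exists (Num.min (Num.min d1 d2) (Num.min d3 (Num.min 1 (e / 8)))).
  by rewrite !lt_min d10 d20 d30 ltr01.
move=> h; rewrite !lt_min => /andP[/andP[h1 h2] /and3P[h3 h4 h5]].
set a := rRe h; set b := rIm h.
have an : `|a| <= rn h by exact: Re_le.
have bn : `|b| <= rn h by exact: Im_le.
have := H1 a (le_lt_trans an h1); rewrite add0r expR0 mul1r => {}H1.
have := H2 b (le_lt_trans bn h2); rewrite add0r cos0 sin0 oppr0 mul0r subr0 => {}H2.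
have := H3 b (le_lt_trans bn h3); rewrite add0r cos0 sin0 mul1r subr0 => {}H3.
apply: le_trans (rn_le _) _; rewrite !(cexp_Re, cexp_Im, cE) -/a -/b oppr0 addr0.
have -> : expR a * cos b - 1 - a = (expR a - 1 - a) * cos b + (1 + a) * (cos b - 1).
  ring.
have -> : expR a * sin b - b = (expR a - 1 - a) * sin b + (1 + a) * (sin b - b) + a * b.
  ring.
have cb : `|cos b| <= 1 by rewrite ler_norml cos_geN1 cos_le1.
have sb : `|sin b| <= 1 by rewrite ler_norml sin_geN1 sin_le1.
have a1 : `|1 + a| <= 2 by apply: le_trans (ler_normD _ _) _; rewrite normr1; lra.
have T1 : `|(expR a - 1 - a) * cos b| <= e / 8 * rn h.
  rewrite normrM; apply: le_trans (ler_wpM2l _ cb) _ => //; rewrite mulr1.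
  by apply: le_trans H1 _; rewrite ler_pM2l.
have T2 : `|(1 + a) * (cos b - 1)| <= 2 * (e / 8 * rn h).
  rewrite normrM; apply: ler_pM => //; apply: le_trans H2 _; by rewrite ler_pM2l.
have T3 : `|(expR a - 1 - a) * sin b| <= e / 8 * rn h.
  rewrite normrM; apply: le_trans (ler_wpM2l _ sb) _ => //; rewrite mulr1.
  by apply: le_trans H1 _; rewrite ler_pM2l.
have T4 : `|(1 + a) * (sin b - b)| <= 2 * (e / 8 * rn h).
  rewrite normrM; apply: ler_pM => //; apply: le_trans H3 _; by rewrite ler_pM2l.
have T5 : `|a * b| <= e / 8 * rn h.
  rewrite normrM; apply: ler_pM => //; lra.
have := ler_normD ((expR a - 1 - a) * cos b) ((1 + a) * (cos b - 1)).
have := ler_normD ((expR a - 1 - a) * sin b + (1 + a) * (sin b - b)) (a * b).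
have := ler_normD ((expR a - 1 - a) * sin b) ((1 + a) * (sin b - b)).
have : 0 <= e * rn h by rewrite mulr_ge0 ?rn_ge0 // ltW.
lra.
Qed.

Lemma rder_line (V : normedModType C) (f : V -> C) x v s :
  differentiable f (x + toC s *: v) ->
  rder (fun t => f (x + toC t *: v)) s ('d f (x + toC s *: v) v).
Proof.
move=> /differentiable_hasD [_ _ D] e e0.
have v0 : 0 < rn v + 1 by rewrite ltr_wpDl // rn_ge0.
have [d d0 {}D] := D (e / (rn v + 1)) (divr_gt0 e0 v0).
exists (d / (rn v + 1)); first exact: divr_gt0.
move=> h hd.
have hv : rn (toC h *: v) <= `|h| * (rn v + 1).
  by rewrite rnZ rn_toC ler_wpM2l // lerDl.
have -> : x + toC (s + h) *: v = x + toC s *: v + toC h *: v.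
  by rewrite toCD scalerDl addrA.
have := D (toC h *: v); rewrite linearZ => {}D.
apply: le_trans (D _) _; last first.
  rewrite mulrAC ler_pdivrMr //; rewrite -mulrA; apply: ler_wpM2l => //; exact: ltW.
by apply: le_lt_trans hv _; rewrite -ltr_pdivlMr.
Qed.

Lemma mean_value (V : normedModType C) (f : V -> C) x y (b : R) :
  (forall s : R, 0 <= s <= 1 -> differentiable f (x + toC s *: (y - x))) ->
  (forall s : R, 0 <= s <= 1 -> rn ('d f (x + toC s *: (y - x)) (y - x)) <= b) ->
  rn (f y - f x) <= 2 * b.
Proof.
move=> D B.
have := @rder_bound _ (fun t => f (x + toC t *: (y - x)))
  (fun s => 'd f (x + toC s *: (y - x)) (y - x)) b 0.
have -> : x + toC 1 *: (y - x) = y by rewrite toC1 scale1r addrC subrK.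
rewrite toC0 scale0r addr0 divr1; apply.
  by move=> s s01; apply: rder_line; apply: D.
by move=> s s01; rewrite expr0 mulr1; apply: B.
Qed.
End CExp.

(** * Goursat's theorem on rectangles *)

Section Goursat.
Context {R : realType}.
Local Notation C := (Cplx R).

(** The integral of [f] along the segment from p to p + v, divided by v: an average, meaningful also
    for v = 0. In [bdry] the factors w and i h are restored, which gives the counterclockwise
    contour integral over the rectangle with lower left corner p. *)
Definition seg (f : C -> C) (p v : C) : C := Int (fun s => f (p + toC s * v)).
Definition bdry (f : C -> C) (p : C) (w h : R) : C :=
  toC w * (seg f p (toC w) - seg f (p + Ci R * toC h) (toC w)) +
  Ci R * toC h * (seg f (p + toC w) (Ci R * toC h) - seg f p (Ci R * toC h)).

Definition inrect (p : C) (w h : R) (z : C) :=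
  0 <= rRe (z - p) <= w /\ 0 <= rIm (z - p) <= h.

Lemma cont01_seg (f : C -> C) p v :
  (forall s : R, 0 <= s <= 1 -> differentiable f (p + toC s * v)) ->
  cont01 (fun s => f (p + toC s * v)).
Proof.
move=> D s s01 e e0.
have D1 := @rder_line _ C^o f p v s (D s s01).
have [d d0 H] := rder_cont D1 e0.
exists d => // t _ td; have := H _ td.
by rewrite [s + _]addrC subrK.
Qed.

Lemma seg_half f p v :
  (forall s : R, 0 <= s <= 1 -> differentiable f (p + toC s * v)) ->
  seg f p v = toC 2^-1 * seg f p (toC 2^-1 * v) +
              toC 2^-1 * seg f (p + toC 2^-1 * v) (toC 2^-1 * v).
Proof.
move=> /cont01_seg D; rewrite /seg (Int_half D); congr (_ * _ + _ * _).
  by apply: Int_ext => s _; rewrite add0r toCM mulrA.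
by apply: Int_ext => s _; rewrite toCD toCM mulrDl addrA mulrA.
Qed.

Lemma seg_inrect_h p w h (s t : R) : 0 <= w -> 0 <= s <= 1 -> 0 <= t <= h ->
  inrect p w h (p + Ci R * toC t + toC s * toC w).
Proof. by move=> w0 s01 th; split; rewrite !cE; nra. Qed.
Lemma seg_inrect_v p w h (s t : R) : 0 <= h -> 0 <= s <= 1 -> 0 <= t <= w ->
  inrect p w h (p + toC t + toC s * (Ci R * toC h)).
Proof. by move=> w0 s01 th; split; rewrite !cE; nra. Qed.

Lemma bdry_split f p w h : 0 <= w -> 0 <= h ->
  (forall z, inrect p w h z -> differentiable f z) ->
  let w' := w / 2 in let h' := h / 2 in
  bdry f p w h = bdry f p w' h' + bdry f (p + toC w') w' h' +
    (bdry f (p + Ci R * toC h') w' h' + bdry f (p + toC w' + Ci R * toC h') w' h').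
Proof.
move=> w0 h0 D w' h'.
have Dh (t : R) : 0 <= t <= h -> seg f (p + Ci R * toC t) (toC w) =
   toC 2^-1 * seg f (p + Ci R * toC t) (toC w') +
   toC 2^-1 * seg f (p + Ci R * toC t + toC w') (toC w').
  move=> t0; rewrite seg_half; first by rewrite -toCM [2^-1 * _]mulrC.
  by move=> s s01; apply: D; apply: seg_inrect_h.
have Dv (t : R) : 0 <= t <= w -> seg f (p + toC t) (Ci R * toC h) =
   toC 2^-1 * seg f (p + toC t) (Ci R * toC h') +
   toC 2^-1 * seg f (p + toC t + Ci R * toC h') (Ci R * toC h').
  move=> t0; rewrite seg_half; last first.
    by move=> s s01; apply: D; apply: seg_inrect_v.
  by rewrite mulrCA -toCM [2^-1 * _]mulrC.
have Dh0 := Dh 0; have Dhm := Dh h'; have Dhh := Dh h.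
have Dv0 := Dv 0; have Dvm := Dv w'; have Dvw := Dv w.
rewrite toC0 mulr0 addr0 in Dh0; rewrite toC0 addr0 in Dv0.
rewrite /bdry Dh0 ?lexx // Dv0 ?lexx // Dhh ?lexx ?h0 // Dvw ?lexx ?w0 //.
have -> : toC w = toC w' + toC w' by rewrite -toCD -splitr.
have -> : toC h = toC h' + toC h' by rewrite -toCD -splitr.
move: (seg f) => S; rewrite !addrA.
have -> : p + toC w' + Ci R * toC h' = p + Ci R * toC h' + toC w' by ring.
have -> : p + Ci R * (toC h' + toC h') = p + Ci R * toC h' + Ci R * toC h' by ring.
have -> : p + Ci R * toC h' + Ci R * toC h' + toC w' =
          p + Ci R * toC h' + toC w' + Ci R * toC h' by ring.
have -> : p + toC w' + toC w' + Ci R * toC h' =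
          p + Ci R * toC h' + toC w' + toC w' by ring.
rewrite toCV toC_nat; field; by [].
Qed.

Lemma rder_toC (u : R -> R) (s l : R) : is_derive s 1 u l -> rder (fun t => toC (u t)) s (toC l).
Proof. by move=> D; apply/rder_parts; split => //=; apply: is_derive_cst. Qed.

Lemma rder_mulr (u : R -> R) (s l : R) (c : C) :
  is_derive s 1 u l -> rder (fun t => toC (u t) * c) s (toC l * c).
Proof.
move=> /rder_toC /(rderZ c); rewrite mulrC => D.
by rewrite [X in rder X](_ : _ = (fun t => c * toC (u t))) //; apply/funext => t; rewrite mulrC.
Qed.

Lemma seg_affine (z0 a l p v : C) :
  seg (fun z => a + (z - z0) * l) p v = a + (p + toC 2^-1 * v - z0) * l.
Proof.
rewrite /seg (@Int_FTC _ (fun s => toC s * (a + (p - z0) * l) + toC (2^-1 * s ^+ 2) * (v * l))).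
  by rewrite !toC1 !toC0 expr1n expr0n /= !mulr1 mulr0 toC0 !mul0r addr0 subr0; ring.
move=> s _.
have -> : a + (p + toC s * v - z0) * l = toC 1 * (a + (p - z0) * l) + toC s * (v * l).
  by rewrite toC1; ring.
apply: rderD; first by apply: rder_mulr; exact: is_derive_id.
apply: rder_mulr.
have := is_deriveZ (2^-1) (is_deriveM (is_derive_id s (1:R)) (is_derive_id s (1:R))).
have -> : 2^-1 *: (id s *: 1 + id s *: 1) = s :> R by rewrite /GRing.scale /=; lra.
by [].
Qed.

Lemma seg_bound (g : C -> C) p v (b : R) :
  cont01 (fun s => g (p + toC s * v)) ->
  (forall s : R, 0 <= s <= 1 -> rn (g (p + toC s * v)) <= b) ->
  rn (seg g p v) <= 2 * b.
Proof.
move=> cg B; have := Int_bound (b := b) (k := 0) cg; rewrite divr1; apply.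
by move=> s s01; rewrite expr0 mulr1; apply: B.
Qed.

Lemma seg_add (g1 g2 : C -> C) p v :
  cont01 (fun s => g1 (p + toC s * v)) -> cont01 (fun s => g2 (p + toC s * v)) ->
  seg (fun z => g1 z + g2 z) p v = seg g1 p v + seg g2 p v.
Proof.
move=> c1 c2; have := Int_lin 1 c1 c2; rewrite mul1r => <-.
by apply: Int_ext => s _; rewrite mul1r.
Qed.

Lemma inrect_dist p w h z z' : inrect p w h z -> inrect p w h z' ->
  rn (z - z') <= w + h.
Proof.
rewrite /inrect !cE => -[a b] [a' b']; apply: le_trans (rn_le _) _; rewrite !cE.
by apply: lerD; rewrite ler_norml; lra.
Qed.

(** The affine part of [f] integrates to zero over the boundary, since [seg_affine] evaluates its
    edge averages at midpoints; only the remainder, at most e (w + h) on each edge, contributes. *)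
Lemma bdry_bound f p w h z0 l e : 0 <= w -> 0 <= h -> 0 <= e ->
  (forall z, inrect p w h z -> differentiable f z) -> inrect p w h z0 ->
  (forall z, inrect p w h z -> rn (f z - f z0 - (z - z0) * l) <= e * rn (z - z0)) ->
  rn (bdry f p w h) <= 4 * e * (w + h) ^+ 2.
Proof.
move=> w0 h0 e0 D iz0 B.
pose A z := f z0 + (z - z0) * l; pose g z := f z - A z.
have dA z : differentiable A z.
  have : is_diff z A (fun h => h * l).
    have := @hasD_differentiable _ C^o C^o A z (fun h => h * l); case.
      split; [by move=> a u v; rewrite /GRing.scale /=; ring| |].
        by exists (rn l) => v; rewrite rnM mulrC.
      move=> e1 e10; exists 1 => // k _.
      have -> : A (z + k) - A z - k * l = 0 by rewrite /A; ring.
      by rewrite rn0 mulr_ge0 ?rn_ge0 // ltW.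
    by move=> dA EA; apply: DiffDef.
  by case.
have dg z : inrect p w h z -> differentiable g z.
  by move=> iz; apply: differentiableB => //; apply: D.
have fE : f = (fun z => A z + g z) by apply/funext => z; rewrite /g; ring.
have S q v : (forall s : R, 0 <= s <= 1 -> inrect p w h (q + toC s * v)) ->
  seg f q v = A (q + toC 2^-1 * v) + seg g q v /\ rn (seg g q v) <= 2 * (e * (w + h)).
  move=> H; split.
    rewrite {1}fE seg_add ?seg_affine //.
      by apply: cont01_seg => s _; apply: dA.
    by apply: cont01_seg => s s01; apply: dg; apply: H.
  apply: seg_bound; first by apply: cont01_seg => s s01; apply: dg; apply: H.
  move=> s s01; have := B _ (H s s01); rewrite /g /A opprD addrA => /le_trans; apply.
  by apply: ler_wpM2l => //; apply: inrect_dist (H s s01) iz0.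
have Sh (t : R) : 0 <= t <= h -> _ := fun th => S (p + Ci R * toC t) (toC w)
   (fun s s01 => seg_inrect_h p w0 s01 th).
have Sv (t : R) : 0 <= t <= w -> _ := fun th => S (p + toC t) (Ci R * toC h)
   (fun s s01 => seg_inrect_v p h0 s01 th).
have := Sh 0; rewrite toC0 mulr0 addr0 lexx h0 => /(_ isT) [E1 B1].
have := Sv 0; rewrite toC0 addr0 lexx w0 => /(_ isT) [E2 B2].
have := Sh h; rewrite lexx h0 => /(_ isT) [E3 B3].
have := Sv w; rewrite lexx w0 => /(_ isT) [E4 B4].
rewrite /bdry E1 E2 E3 E4.
move: (seg g p (toC w)) B1 => s1 B1; move: (seg g p (Ci R * toC h)) B2 => s2 B2.
move: (seg g (p + Ci R * toC h) _) B3 => s3 B3.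
move: (seg g (p + toC w) _) B4 => s4 B4.
set b := e * (w + h) in B1 B2 B3 B4.
have -> : toC w * (A (p + toC 2^-1 * toC w) + s1 -
     (A (p + Ci R * toC h + toC 2^-1 * toC w) + s3)) +
   Ci R * toC h * (A (p + toC w + toC 2^-1 * (Ci R * toC h)) + s4 -
     (A (p + toC 2^-1 * (Ci R * toC h)) + s2)) =
   toC w * (s1 - s3) + Ci R * toC h * (s4 - s2) by rewrite /A; ring.
apply: le_trans (rnD _ _) _; rewrite !rnM rn_i mul1r !rn_toC !ger0_norm //.
have := rnB s1 s3; have := rnB s4 s2; rewrite expr2.
have b0 : 0 <= b by rewrite /b; nra.
have -> : 4 * e * ((w + h) * (w + h)) = 4 * b * (w + h) by rewrite /b; ring.
nra.
Qed.

Lemma pow_small (a d : R) : 0 < d -> exists n, a / 2 ^+ n < d.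
Proof.
move=> d0; have := archi_boundP (normr_ge0 (a / d)); set n := Num.bound _ => H.
exists n; rewrite ltr_pdivrMr ?exprn_gt0 // -ltr_pdivrMl // mulrC.
apply: le_lt_trans (ler_norm _) _; apply: lt_trans H _.
by rewrite -natrX ltr_nat ltn_expl.
Qed.

Lemma nested_itv (a l : nat -> R) : (forall n, a n <= a n.+1) ->
  (forall n, a n.+1 + l n.+1 <= a n + l n) -> (forall n, 0 <= l n) ->
  exists c, forall n, a n <= c <= a n + l n.
Proof.
move=> ai al l0.
have I n m : (n <= m)%N -> a n <= a m /\ a m + l m <= a n + l n.
  move=> /subnKC <-; elim: (m - n)%N => [|k [IH1 IH2]]; first by rewrite addn0.
  rewrite addnS; split; [exact: le_trans IH1 (ai _)|exact: le_trans (al _) IH2].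
have ub n m : a m <= a n + l n.
  case: (leqP n m) => [/I[_]|/ltnW /I[A _]]; first by have := l0 m; lra.
  by have := l0 n; lra.
have hs : has_sup [set x | exists n, x = a n].
  split; first by exists (a 0), 0%N.
  by exists (a 0 + l 0) => _ [n ->]; exact: ub.
exists (sup [set x | exists n, x = a n]) => n; apply/andP; split.
  by apply: sup_upper_bound => //; exists n.
apply: ge_sup; first by exists (a 0), 0%N.
by move=> _ [m ->]; exact: ub.
Qed.

(** Bisection: nested quarters keep at least the fraction 4^-n of the integral, while
    differentiability at their common point [c] bounds it by an arbitrarily small multiple of
    4^-n. *)
Theorem goursat f p w h : 0 <= w -> 0 <= h ->
  (forall z, inrect p w h z -> differentiable f z) -> bdry f p w h = 0.
Proof.
move=> w0 h0 D; set d := rn (bdry f p w h).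
(* Corner of a quarter whose boundary integral is at least b. When the three tests fail, the fourth
   quarter must qualify, as [big] shows. *)
pose pk q w' h' b := if b <= rn (bdry f q w' h') then q else
  if b <= rn (bdry f (q + toC w') w' h') then q + toC w' else
  if b <= rn (bdry f (q + Ci R * toC h') w' h') then q + Ci R * toC h' else
  q + toC w' + Ci R * toC h'.
pose W n := w / 2 ^+ n; pose H n := h / 2 ^+ n.
have W0 n : 0 <= W n by rewrite divr_ge0 // exprn_ge0.
have H0 n : 0 <= H n by rewrite divr_ge0 // exprn_ge0.
have WS n : W n.+1 = W n / 2 by rewrite /W exprS invfM [2^-1 * _]mulrC mulrA.
have HS n : H n.+1 = H n / 2 by rewrite /H exprS invfM [2^-1 * _]mulrC mulrA.
pose fix P n := if n is m.+1 then pk (P m) (W m.+1) (H m.+1) (d / 4 ^+ m.+1) else p.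
have PS n : rRe (P n) <= rRe (P n.+1) /\ rRe (P n.+1) + W n.+1 <= rRe (P n) + W n
         /\ rIm (P n) <= rIm (P n.+1) /\ rIm (P n.+1) + H n.+1 <= rIm (P n) + H n.
  have := W0 n; have := H0 n.
  rewrite [P n.+1]/(pk (P n) (W n.+1) (H n.+1) (d / 4 ^+ n.+1)) /pk WS HS.
  by repeat case: ifP => _; rewrite ?cE; lra.
have [x Hx] := nested_itv (fun n => proj1 (PS n)) (fun n => proj1 (proj2 (PS n))) W0.
have [y Hy] := nested_itv (fun n => proj1 (proj2 (proj2 (PS n))))
  (fun n => proj2 (proj2 (proj2 (PS n)))) H0.
have sub n z : inrect (P n) (W n) (H n) z -> inrect p w h z.
  elim: n z => [|n IH] z; first by rewrite /W /H !expr0 !divr1.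
  move=> iz; apply: IH; move: iz; have := PS n; rewrite /inrect !cE; lra.
have big n : d / 4 ^+ n <= rn (bdry f (P n) (W n) (H n)).
  elim: n => [|n IH]; first by rewrite /W /H !expr0 !divr1 lexx.
  have := @bdry_split f (P n) (W n) (H n) (W0 n) (H0 n) (fun z iz => D z (sub n z iz)).
  rewrite /= -WS -HS => E; rewrite /pk.
  case: ifPn => // /negbTE /negbT; rewrite -ltNge => A1.
  case: ifPn => // /negbTE /negbT; rewrite -ltNge => A2.
  case: ifPn => // /negbTE /negbT; rewrite -ltNge => A3.
  have E4 : d / 4 ^+ n = 4 * (d / 4 ^+ n.+1).
    by rewrite exprS invfM mulrCA [4 * _]mulrA divff ?mul1r // pnatr_eq0.
  rewrite E4 E in IH.
  have := rnD (bdry f (P n) (W n.+1) (H n.+1) + bdry f (P n + toC (W n.+1)) (W n.+1) (H n.+1)) (bdry f (P n + Ci R * toC (H n.+1)) (W n.+1) (H n.+1) + bdry f (P n + toC (W n.+1) + Ci R * toC (H n.+1)) (W n.+1) (H n.+1)).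
  have := rnD (bdry f (P n) (W n.+1) (H n.+1)) (bdry f (P n + toC (W n.+1)) (W n.+1) (H n.+1)).
  have := rnD (bdry f (P n + Ci R * toC (H n.+1)) (W n.+1) (H n.+1)) (bdry f (P n + toC (W n.+1) + Ci R * toC (H n.+1)) (W n.+1) (H n.+1)).
  move: A1 A2 A3 IH; set q := d / 4 ^+ n.+1; lra.
pose c : C := toC x + Ci R * toC y.
have ic n : inrect (P n) (W n) (H n) c.
  by have := Hx n; have := Hy n; rewrite /inrect !cE; lra.
have dge : 0 <= d by exact: rn_ge0.
have [d0|/rn_eq0P //] : 0 < d \/ d = 0.
  by move: dge; rewrite le_eqVlt => /orP[/eqP <-|]; [right|left].
exfalso.
set k := (w + h) ^+ 2; have k0 : 0 <= k by exact: sqr_ge0.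
(* With this e the upper bound 4 e k / 4^n is below d / 4^n; k + 1 covers a degenerate rectangle,
   where k = 0. *)
have e0 : 0 < d / (8 * (k + 1)) by rewrite divr_gt0 // mulr_gt0 // ltr_wpDl.
set e := d / _ in e0.
have Ee : e * (8 * (k + 1)) = d by rewrite /e divfK // gt_eqF // mulr_gt0 // ltr_wpDl.
have [_ _ /(_ e e0) [dl dl0 Hd]] := differentiable_hasD (D c (sub 0%N c (ic 0%N))).
have [n Hn] := pow_small (w + h) dl0.
have := @bdry_bound f (P n) (W n) (H n) c ('d f c 1) e (W0 n) (H0 n) (ltW e0)
   (fun z iz => D z (sub n z iz)) (ic n).
have WH : W n + H n = (w + h) / 2 ^+ n by rewrite /W /H mulrDl.
move=> /(_ _)/Wrap[].
  move=> z iz.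
  have zc : rn (z - c) < dl.
    by apply: le_lt_trans (inrect_dist iz (ic n)) _; rewrite WH.
  have := Hd _ zc; rewrite [c + _]addrC subrK.
  suff -> : 'd f c (z - c) = (z - c) * 'd f c 1 by [].
  by rewrite -[in LHS](mulr1 (z - c)) -/((z - c) *: 1) linearZ.
move=> B; have := le_trans (big n) B.
rewrite WH expr_div_n -exprM mulnC exprM -/k.
have -> : 2 ^+ 2 = 4 :> R by rewrite expr2; lra.
rewrite mulrA ler_pdivrMr ?exprn_gt0 // divfK ?gt_eqF ?exprn_gt0 //.
nra.
Qed.
End Goursat.

(** * Cauchy's estimate for the first derivative *)

Section Cauchy.
Context {R : realType}.
Local Notation C := (Cplx R).

Lemma differentiable_cexp (z : C) : differentiable (@cexp R) z.
Proof. by have [] := hasD_differentiable (cder_cexp z). Qed.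

(* Goursat on rectangles suffices: in the variable w with z = exp w, the function
   (f (exp w) - f 0) exp (- w) is 2 i pi-periodic and tends to
   f' (0) as Re w -> -oo, so no integral over a circle is needed. *)
Lemma cauchy0 (f : C -> C) (r M : R) : 0 < r ->
  (forall z, rn z < r -> differentiable f z) ->
  (forall z, rn z < r -> rn (f z) <= M) ->
  rn ('d f 0 1) <= 8 * M / r.
Proof.
move=> r0 D B.
pose Phi z : C := (f (cexp z) - f 0) * cexp (- z).
have rz z : rRe z <= ln (r / 2) -> rn (cexp z) <= r / 2.
  by move=> H; rewrite rn_cexp -[r / 2]lnK ?posrE ?divr_gt0 // ler_expR.
have DPhi z : rRe z <= ln (r / 2) -> differentiable Phi z.
  move=> /rz H; apply: differentiableM.
    apply: differentiableB => //; apply: differentiable_comp; first exact: differentiable_cexp.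
    by apply: D; lra.
  apply: (@differentiable_comp _ _ _ _ (fun z : C => - z) (@cexp R)).
    exact: differentiableN.
  exact: differentiable_cexp.
set b := ln (r / 2) in rz DPhi.
have pi0 : 0 <= 2 * pi :> R by rewrite mulr_ge0 // pi_ge0.
pose J a := seg Phi (toC a) (Ci R * toC (2 * pi)).
(* Goursat on the rectangle of height 2 pi between the abscissas a and b: periodicity cancels the
   horizontal sides, so the averages over the vertical sides agree. *)
have Jcst a : a <= b -> J a = J b.
  move=> ab; have ba : 0 <= b - a by lra.
  have := @goursat _ Phi (toC a) (b - a) (2 * pi) ba pi0.
  move=> /(_ _)/Wrap[].
  move=> z.
    by rewrite /inrect !cE => -[H _]; apply: DPhi; lra.
  rewrite /bdry.
  have -> : seg Phi (toC a + Ci R * toC (2 * pi)) (toC (b - a)) = seg Phi (toC a) (toC (b - a)).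
    apply: Int_ext => s _; rewrite addrAC /Phi cexp_2pi opprD.
    by rewrite -[in cexp (- _ - _)](cexp_2pi) subrK.
  have -> : toC a + toC (b - a) = toC b by rewrite -toCD addrC subrK.
  rewrite subrr mulr0 add0r => E; apply/esym/eqP; rewrite -subr_eq0; apply/eqP.
  apply: (mulfI (x := Ci R * toC (2 * pi))); last by rewrite mulr0.
  by rewrite -rn_gt0 rnM rn_i mul1r rn_toC normr_gt0 mulf_neq0 // gt_eqF ?pi_gt0.
have cPhi a : a <= b -> cont01 (fun s => Phi (toC a + toC s * (Ci R * toC (2 * pi)))).
  by move=> ab; apply: cont01_seg => s s01; apply: DPhi; rewrite !cE; lra.
have M0 : 0 <= M by apply: le_trans (rn_ge0 _) (B 0 _); rewrite rn0.
(* The constant 8 is the product of 2 from [seg_bound], 2 from f - f 0 and 2 from the radius r /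
   2. *)
have Jb : rn (J b) <= 2 * (2 * M / (r / 2)).
  apply: seg_bound; first exact: cPhi.
  move=> s s01; set z := toC b + _.
  have zb : rRe z = b by rewrite /z !cE; ring.
  have nz : rn (cexp z) = r / 2 by rewrite rn_cexp zb lnK ?posrE ?divr_gt0.
  rewrite /Phi rnM cexpNV rnV nz; apply: ler_wpM2r; first by rewrite invr_ge0; lra.
  apply: le_trans (rnB _ _) _.
  have := B (cexp z); have := B 0; rewrite rn0 nz => /(_ r0); lra.
apply/ler_addgt0Pr => e e0.
have e2 : 0 < e / 2 by lra.
have D0 : differentiable f 0 by apply: D; rewrite rn0.
have [_ _ /(_ _ e2) [d d0 Hd]] := differentiable_hasD D0.
set l := 'd f 0 1.
have lE h : 'd f 0 h = h * l by rewrite -[h in LHS]mulr1 -/(h *: 1) linearZ.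
(* Far enough to the left, exp z lies where the difference quotient of f at 0 is within e / 2 of
   l. *)
pose a := Num.min b (ln (d / 2)).
have ab : a <= b by rewrite /a ge_min lexx.
have ad : expR a < d.
  apply: (@le_lt_trans _ _ (d / 2)); last by lra.
  by rewrite -[d / 2]lnK ?posrE ?divr_gt0 // ler_expR /a ge_min lexx orbT.
rewrite -(Jcst a ab) in Jb.
pose g z := Phi z - l.
have cl : cont01 (fun _ : R => l).
  by move=> s _ e1 e10; exists 1 => // t _ _; rewrite subrr rn0.
have cg : cont01 (fun s => g (toC a + toC s * (Ci R * toC (2 * pi)))).
  have := cont01_lin (-1) cl (cPhi a ab).
  suff -> : (fun s : R => -1 * l + Phi (toC a + toC s * (Ci R * toC (2 * pi)))) =
    (fun s => g (toC a + toC s * (Ci R * toC (2 * pi)))) by [].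
  by apply/funext => s; rewrite /g; ring.
have JE : J a = l + seg g (toC a) (Ci R * toC (2 * pi)).
  have := seg_affine 0 l 0 (toC a) (Ci R * toC (2 * pi)); rewrite mulr0 addr0 => <-.
  rewrite -seg_add //; last first.
    suff -> : (fun s => l + (toC a + toC s * (Ci R * toC (2 * pi)) - 0) * 0) = (fun _ : R => l) by [].
    by apply/funext => s; rewrite mulr0 addr0.
  by apply: Int_ext => s _; rewrite /g; ring.
have gB : rn (seg g (toC a) (Ci R * toC (2 * pi))) <= 2 * (e / 2).
  apply: seg_bound => // s s01; set z := toC a + _.
  have za : rRe z = a by rewrite /z !cE; ring.
  have nz : rn (cexp z) = expR a by rewrite rn_cexp za.
  have := Hd (cexp z); rewrite nz add0r lE => /(_ ad) H.
  have -> : g z = (f (cexp z) - f 0 - cexp z * l) * cexp (- z).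
    transitivity (Phi z - l * (cexp z * cexp (- z))); first by rewrite cexpN mulr1.
    by rewrite /Phi; ring.
  rewrite rnM cexpNV rnV nz ler_pdivrMr ?expR_gt0 //.
have -> : l = J a - seg g (toC a) (Ci R * toC (2 * pi)) by rewrite JE; ring.
apply: le_trans (rnB _ _) _.
have -> : 8 * M / r = 2 * (2 * M / (r / 2)) by field; rewrite gt_eqF.
lra.
Qed.

(** The one-variable estimate on the complex line t -> x + t v, whose disc of radius r / |v| is
    mapped into the ball. *)
Lemma cauchy_est (V : normedModType C) (f : V -> C) x v (r M : R) : 0 < r ->
  (forall y, rn (y - x) < r -> differentiable f y) ->
  (forall y, rn (y - x) < r -> rn (f y) <= M) ->
  rn ('d f x v) <= 8 * M / r * rn v.
Proof.
move=> r0 D B.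
have [->|v0] := eqVneq v 0; first by rewrite linear0 !rn0 mulr0.
have nv : 0 < rn v by rewrite rn_gt0.
pose p (t : C) : V := x + t *: v.
have pr t : rn t < r / rn v -> rn (p t - x) < r.
  by rewrite ltr_pdivlMr // /p addrAC subrr add0r rnZ.
have dp (t : C) : is_diff t p (fun h => h *: v).
  have /hasD_differentiable[dp E] : hasD p t (fun h => h *: v).
    split; [by move=> a u w; rewrite scalerDl scalerA| |].
      by exists (rn v) => w; rewrite rnZ mulrC.
    move=> e e0; exists 1 => // h _.
    have -> : p (t + h) - p t - h *: v = 0.
      by rewrite /p scalerDl addrA addrAC addrAC [X in X - _]addrAC subrr add0r subrr.
    by rewrite rn0 mulr_ge0 ?rn_ge0 // ltW.
  exact: DiffDef.
have p0 : p 0 = x by rewrite /p scale0r addr0.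
have := @cauchy0 (f \o p) (r / rn v) M (divr_gt0 r0 nv).
move=> /(_ _ _)/Wrap[].
- move=> t /pr /D Df; apply: differentiable_comp => //; by case: (dp t).
- by move=> t /pr /B.
have x0 : differentiable f (p 0) by rewrite p0; apply: D; rewrite subrr rn0.
have dp0 : differentiable p 0 by case: (dp 0).
rewrite diff_comp //= p0.
have -> : 'd p 0 = (fun h => h *: v) :> (C -> V) by case: (dp 0).
by rewrite scale1r invfM invrK mulrA.
Qed.

End Cauchy.

Opaque Cplx toC Ci rRe rIm rn Int cexp diff derive.

(** The directional derivative is sealed behind an opaque witness, so that unification never unfolds
    [diff]; [ddE] reopens it. *)
Fact dd_key (R : realType) (V : normedModType (Cplx R)) :
  {d : (V -> Cplx R) -> V -> V -> Cplx R | forall f x v, d f x v = 'd f x v}.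
Proof. by exists (fun f x v => 'd f x v). Qed.
Definition dd (R : realType) (V : normedModType (Cplx R)) := sval (@dd_key R V).
Lemma ddE (R : realType) (V : normedModType (Cplx R)) (f : V -> Cplx R) x v :
  dd f x v = 'd f x v.
Proof. exact: (svalP (@dd_key R V)). Qed.

(** * Several complex variables *)

Section Several.
Context {R : realType} {V : normedModType (Cplx R)}.
Local Notation C := (Cplx R).
Implicit Types (f g : V -> C) (x y v w h : V) (r M : R).

Lemma dd_hasD f x : differentiable f x -> hasD f x (dd f x).
Proof.
move=> /differentiable_hasD D; suff -> : dd f x = 'd f x :> (V -> C) by [].
by apply/funext => v; rewrite ddE.
Qed.

Lemma hasD_dd f x L : hasD f x L -> differentiable f x /\ forall v, dd f x v = L v.
Proof. by move=> /hasD_differentiable [df E]; split => // v; rewrite ddE E. Qed.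

Lemma ddP f x (a : C) u v : dd f x (a *: u + v) = a * dd f x u + dd f x v.
Proof. by rewrite !ddE linearP. Qed.
Lemma dd0 f x : dd f x 0 = 0. Proof. by rewrite ddE linear0. Qed.
Lemma ddZ f x (a : C) u : dd f x (a *: u) = a * dd f x u.
Proof. by rewrite -[a *: u]addr0 ddP dd0 addr0. Qed.
Lemma ddD f x u v : dd f x (u + v) = dd f x u + dd f x v.
Proof. by rewrite -[u]scale1r ddP scale1r mul1r. Qed.

Lemma dd_add f g x v : differentiable f x -> differentiable g x ->
  dd (fun u => f u + g u) x v = dd f x v + dd g x v.
Proof. by move=> df dg; rewrite !ddE; have /(congr1 (@^~ v)) := diffD df dg. Qed.
Lemma dd_sub f g x v : differentiable f x -> differentiable g x ->
  dd (fun u => f u - g u) x v = dd f x v - dd g x v.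
Proof. by move=> df dg; rewrite !ddE; have /(congr1 (@^~ v)) := diffB df dg. Qed.
Lemma dd_mul f g x v : differentiable f x -> differentiable g x ->
  dd (fun u => f u * g u) x v = f x * dd g x v + g x * dd f x v.
Proof. by move=> df dg; rewrite !ddE; have /(congr1 (@^~ v)) := diffM df dg. Qed.

Lemma dd_line f x v (s : R) : differentiable f (x + toC s *: v) ->
  rder (fun t => f (x + toC t *: v)) s (dd f (x + toC s *: v) v).
Proof. by rewrite ddE; exact: rder_line. Qed.

Lemma mean_value_dd f x y (b : R) :
  (forall s : R, 0 <= s <= 1 -> differentiable f (x + toC s *: (y - x))) ->
  (forall s : R, 0 <= s <= 1 -> rn (dd f (x + toC s *: (y - x)) (y - x)) <= b) ->
  rn (f y - f x) <= 2 * b.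
Proof. by move=> D B; apply: mean_value => // s s01; rewrite -ddE; exact: B. Qed.

Lemma differentiable_linear f : (forall (a : C) u v, f (a *: u + v) = a * f u + f v) ->
  (exists M, forall v, rn (f v) <= M * rn v) ->
  forall x, differentiable f x /\ forall v, dd f x v = f v.
Proof.
move=> L B x; apply: hasD_dd; split => // e e0; exists 1 => // h _.
have -> : f (x + h) - f x - f h = 0.
  have -> : f (x + h) = f x + f h by rewrite -[x]scale1r L scale1r mul1r.
  ring.
by rewrite rn0 mulr_ge0 ?rn_ge0 // ltW.
Qed.

Definition holb f x r M := forall y, rn (y - x) < r ->
  differentiable f y /\ rn (f y) <= M.

Lemma holb_sub f x r M y r' : holb f x r M -> r' + rn (y - x) <= r -> holb f y r' M.
Proof.
move=> H rr z zy; apply: H; apply: le_lt_trans (rn_tri y _ _) _; lra.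
Qed.

Lemma holb_M f x r M : 0 < r -> holb f x r M -> 0 <= M.
Proof. by move=> r0 /(_ x); rewrite subrr rn0 => /(_ r0) [_]; apply: le_trans; exact: rn_ge0. Qed.

Lemma holb_est f x r M v : 0 < r -> holb f x r M -> rn (dd f x v) <= 8 * M / r * rn v.
Proof. by move=> r0 H; rewrite ddE; apply: cauchy_est => // y /H []. Qed.

Lemma seg_ball x y z r (s : R) : 0 <= s <= 1 -> rn (y - x) < r -> rn (z - x) < r ->
  rn (y + toC s *: (z - y) - x) < r.
Proof.
move=> s01 yr zr.
have -> : y + toC s *: (z - y) - x = toC (1 - s) *: (y - x) + toC s *: (z - x).
  have -> : z - y = (z - x) - (y - x) by rewrite opprB addrA subrK.
  by rewrite toCB toC1 scalerBl scale1r scalerBr addrAC -!addrA [- (toC s *: (y - x)) + _]addrC.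
apply: le_lt_trans (rnD _ _) _; rewrite !rnZ !rn_toC !ger0_norm; [|lra|lra].
have := mulr_ge0 (andP s01).1 (ltW (_ : 0 < r - rn (z - x))).
have := mulr_ge0 (_ : 0 <= 1 - s) (ltW (_ : 0 < r - rn (y - x))).
rewrite !subr_ge0 !subr_gt0 => /(_ (andP s01).2 yr) h1 /(_ zr) h2.
case: (ltrP 0 s) => s0; first by have := mulr_gt0 s0 (_ : 0 < r - rn (z - x)); rewrite subr_gt0 => /(_ zr); lra.
have s00 : s = 0 by lra.
by rewrite s00 subr0 mul1r mul0r addr0.
Qed.

Lemma holb_lip f x r M y z : 0 < r -> holb f x r M ->
  rn (y - x) < r / 2 -> rn (z - x) < r / 2 ->
  rn (f z - f y) <= 32 * M / r * rn (z - y).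
Proof.
move=> r0 H yr zr.
have -> : 32 * M / r * rn (z - y) = 2 * (8 * M / (r / 2) * rn (z - y)).
  by field; rewrite gt_eqF.
have S (s : R) : 0 <= s <= 1 -> holb f (y + toC s *: (z - y)) (r / 2) M.
  by move=> s01; apply: holb_sub H _; have := seg_ball s01 yr zr; lra.
have r2 : 0 < r / 2 by lra.
apply: mean_value_dd => s s01; last exact: holb_est (S s s01).
by have [] := S s s01 (y + toC s *: (z - y)); rewrite ?subrr ?rn0.
Qed.

Lemma differentiable_shift f a x : differentiable f (x + a) ->
  differentiable (fun y => f (y + a)) x /\ forall v, dd (fun y => f (y + a)) x v = dd f (x + a) v.
Proof.
move=> /dd_hasD [L M H]; apply: hasD_dd; split => //.
by move=> e /H[d d0 {}H]; exists d => // k kd; rewrite [x + k + a]addrAC; exact: H.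
Qed.

(** Cauchy's estimate applied to the difference f (y + a) - f y, itself O(|a|) by [holb_lip]: no
    second derivative is involved. The constant is 8 times 32 times 4. *)
Lemma holb_dlip f x r M y v : 0 < r -> holb f x r M -> rn (y - x) < r / 4 ->
  rn (dd f y v - dd f x v) <= 1024 * M / r ^+ 2 * rn (y - x) * rn v.
Proof.
move=> r0 H yr; pose a := y - x.
have xa : x + a = y by rewrite /a addrC subrK.
have D u : rn (u - x) < r / 4 -> [/\ differentiable f u, differentiable (fun y => f (y + a)) u
    & rn (u + a - x) < r / 2].
  move=> ur; have ua : rn (u + a - x) < r / 2.
    by rewrite addrAC; apply: le_lt_trans (rnD _ _) _; rewrite /a; lra.
  split => //; first by apply: (H u _).1; lra.
  by have [] := @differentiable_shift f a u; first by apply: (H _ _).1; lra.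
pose g u := f (u + a) - f u.
have B : holb g x (r / 4) (32 * M / r * rn a).
  move=> u ur; have [d1 d2 ua] := D u ur; split; first exact: differentiableB.
  have := @holb_lip f x r M u (u + a) r0 H; rewrite [u + a - u]addrAC subrr add0r; apply => //.
  by lra.
have r4 : 0 < r / 4 by lra.
have := holb_est v r4 B.
have xx : rn (x - x) < r / 4 by rewrite subrr rn0.
have [d1 d2 _] := D x xx.
have E : dd (fun u => f (u + a)) x v = dd f y v.
  have [] := @differentiable_shift f a x; rewrite xa //; apply: (H _ _).1; lra.
rewrite (dd_sub v d2 d1) E => /le_trans; apply.
have -> : 8 * (32 * M / r * rn a) / (r / 4) = 1024 * M / r ^+ 2 * rn a.
  by field; rewrite gt_eqF.
by [].
Qed.

(** The mean value inequality for f - dd f x, whose derivative is small by [holb_dlip]. The constant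
    depends only on r and M, so the remainder is uniform over sequences and along paths. *)
Lemma holb_taylor f x r M h : 0 < r -> holb f x r M -> rn h < r / 4 ->
  rn (f (x + h) - f x - dd f x h) <= 2048 * M / r ^+ 2 * rn h ^+ 2.
Proof.
move=> r0 H hr; pose g y := f y - dd f x y.
have df : differentiable f x by apply: (H x _).1; rewrite subrr rn0.
have dl := @differentiable_linear (dd f x) (ddP f x).
have {}dl y : differentiable (dd f x) y /\ forall v, dd (dd f x) y v = dd f x v.
  by apply: dl; have [] := dd_hasD df.
have dgE y : differentiable f y -> differentiable g y /\ forall v, dd g y v = dd f y v - dd f x v.
  move=> dy; have [d1 d2] := dl y; split; first exact: differentiableB.
  by move=> v; rewrite (dd_sub v dy d1) d2.
have -> : f (x + h) - f x - dd f x h = g (x + h) - g x.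
  by rewrite /g ddD opprB opprD; ring.
have -> : 2048 * M / r ^+ 2 * rn h ^+ 2 = 2 * (1024 * M / r ^+ 2 * rn h * rn h) by ring.
have K0 : 0 <= 1024 * M / r ^+ 2.
  apply: divr_ge0; last exact: sqr_ge0.
  by apply: mulr_ge0; [exact: ler0n|exact: holb_M r0 H].
have hx : x + h - x = h by rewrite addrAC subrr add0r.
have hh (s : R) : 0 <= s <= 1 -> rn (x + toC s *: h - x) <= rn h.
  move=> s01; rewrite addrAC subrr add0r rnZ rn_toC.
  by rewrite ger0_norm ?(andP s01).1 // ler_piMl ?rn_ge0 // (andP s01).2.
have hd (s : R) : 0 <= s <= 1 -> differentiable f (x + toC s *: h).
  by move=> s01; apply: (H _ _).1; have := hh s s01; have := rn_ge0 h; lra.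
apply: mean_value_dd => s s01; rewrite hx; first exact: (dgE _ (hd s s01)).1.
rewrite (dgE _ (hd s s01)).2.
have hs := hh s s01.
apply: le_trans (holb_dlip _ r0 H (le_lt_trans hs hr)) _.
apply: ler_wpM2r; first exact: rn_ge0.
apply: ler_wpM2l; [exact: K0|exact: hs].
Qed.

Definition cvS (W : normedModType C) (u : nat -> W) (l : W) :=
  forall e : R, 0 < e -> exists N, forall n, (N <= n)%N -> rn (u n - l) <= e.

Lemma cvS_unique (W : normedModType C) (u : nat -> W) l1 l2 :
  cvS u l1 -> cvS u l2 -> l1 = l2.
Proof.
move=> c1 c2; apply/eqP; rewrite -subr_eq0 -rn_eq0; apply/eqP.
apply/eqP; rewrite eq_le rn_ge0 andbT; apply/ler_addgt0Pr => e e0; rewrite add0r.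
have e2 : 0 < e / 2 by lra.
have [N1 H1] := c1 _ e2; have [N2 H2] := c2 _ e2.
apply: le_trans (rn_tri (u (maxn N1 N2)) _ _) _.
have := H1 _ (leq_maxl N1 N2); have := H2 _ (leq_maxr N1 N2).
rewrite [rn (l1 - _)]rnC; lra.
Qed.

Lemma cvS_lin (W : normedModType C) (u1 u2 : nat -> W) l1 l2 (a : C) :
  cvS u1 l1 -> cvS u2 l2 -> cvS (fun n => a *: u1 n + u2 n) (a *: l1 + l2).
Proof.
move=> c1 c2 e e0; have a0 : 0 < rn a + 1 by rewrite ltr_wpDl // rn_ge0.
have e1 : 0 < e / 2 / (rn a + 1) by rewrite divr_gt0 //; lra.
have e2 : 0 < e / 2 by lra.
have [N1 H1] := c1 _ e1; have [N2 H2] := c2 _ e2.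
exists (maxn N1 N2) => n; rewrite geq_max => /andP[/H1 h1 /H2 h2].
rewrite opprD addrACA -scalerBr; apply: le_trans (rnD _ _) _; rewrite rnZ.
move: h1; rewrite ler_pdivlMr // => h1.
have := rn_ge0 (u1 n - l1); have := rn_ge0 a; nra.
Qed.

Lemma cvS_le (W : normedModType C) (u : nat -> W) l b N :
  cvS u l -> (forall n, (N <= n)%N -> rn (u n) <= b) -> rn l <= b.
Proof.
move=> c B; apply/ler_addgt0Pr => e e0; have [N1 H1] := c _ e0.
have := H1 _ (leq_maxl N1 N); have := B _ (leq_maxr N1 N).
have := rn_tri (u (maxn N1 N)) l 0; rewrite !subr0 [rn (l - _)]rnC; lra.
Qed.

Definition cauchyS (W : normedModType C) (u : nat -> W) :=
  forall e : R, 0 < e -> exists N, forall n m, (N <= n)%N -> (N <= m)%N -> rn (u n - u m) <= e.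

Lemma C_complete (u : nat -> C) : cauchyS u -> exists l, cvS u l.
Proof.
move=> cu.
have aux (p : C -> R) : (forall z, `|p z| <= rn z) -> (forall z w : C, p (z - w) = p z - p w) ->
   exists l : R, forall e : R, 0 < e -> exists N, forall n, (N <= n)%N -> `|p (u n) - l| <= e.
  move=> pn pB.
  have : cvg ((fun n => p (u n)) @ \oo).
    apply/cauchy_cvgP; apply: cauchy_exP => e e0.
    have e2 : 0 < e / 2 by lra.
    have [N H] := cu _ e2; exists (p (u N)); exists N => // n /= Nn.
    rewrite -ball_normE /= -pB; apply: le_lt_trans (pn _) _.
    by have := H N n (leqnn _) Nn; lra.
  move=> /cvg_ex[l /cvgrPdist_le cl]; exists l => e /cl [N _ H].
  by exists N => n /H; rewrite distrC.
have reB (z w : C) : rRe (z - w) = rRe z - rRe w by rewrite !cE.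
have imB (z w : C) : rIm (z - w) = rIm z - rIm w by rewrite !cE.
have [l1 H1] := aux (@rRe R) (@Re_le R) reB.
have [l2 H2] := aux (@rIm R) (@Im_le R) imB.
exists (toC l1 + Ci R * toC l2) => e e0; have e2 : 0 < e / 2 by lra.
have [N1 h1] := H1 _ e2; have [N2 h2] := H2 _ e2.
exists (maxn N1 N2) => n; rewrite geq_max => /andP[/h1 {}h1 /h2 {}h2].
apply: le_trans (rn_le _) _; rewrite !cE !(mul0r, mulr0, mul1r, add0r, addr0, subr0, oppr0).
lra.
Qed.

(** Cauchy's estimate on F n - F m makes the derivatives a Cauchy sequence; their limit [L] is the
    derivative of f because the Taylor remainders of all F n share one quadratic bound. *)
Lemma weierstrass (F : nat -> V -> C) f x r M : 0 < r ->
  (forall n, holb (F n) x r M) ->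
  (forall e : R, 0 < e -> exists N, forall n, (N <= n)%N -> forall y, rn (y - x) < r ->
     rn (F n y - f y) <= e) ->
  differentiable f x /\ forall v, cvS (fun n => dd (F n) x v) (dd f x v).
Proof.
move=> r0 H U.
have xx : rn (x - x) < r by rewrite subrr rn0.
have cv v : exists l, cvS (fun n => dd (F n) x v) l.
  apply: C_complete => e e0.
  have e1 : 0 < e * r / (16 * (rn v + 1)).
    by rewrite divr_gt0 ?mulr_gt0 // ltr_wpDl // rn_ge0.
  have [N HN] := U _ e1; exists N => n m Nn Nm.
  pose G y := F n y - F m y.
  have B : holb G x r (2 * (e * r / (16 * (rn v + 1)))).
    move=> y yr; split; first by apply: differentiableB; apply: (H _ _ yr).1.
    apply: le_trans (rn_tri (f y) _ _) _.
    have := HN n Nn y yr; have := HN m Nm y yr; rewrite [rn (f y - _)]rnC; lra.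
  have := holb_est v r0 B; rewrite (dd_sub v (H n _ xx).1 (H m _ xx).1).
  move=> /le_trans; apply.
  have v0 := rn_ge0 v.
  have -> : 8 * (2 * (e * r / (16 * (rn v + 1)))) / r * rn v = e * (rn v / (rn v + 1)).
    by field; apply/andP; split; rewrite gt_eqF // ltr_wpDl.
  by rewrite ler_piMr ?ltW // ltr_pdivrMr ?ltr_wpDl // mul1r ltrDl.
pose L v := xget 0 [set l | cvS (fun n => dd (F n) x v) l].
have HL v : cvS (fun n => dd (F n) x v) (L v).
  by rewrite /L; case: xgetP => // nl; have [l Hl] := cv v; case: (nl l).
have Ux y : rn (y - x) < r -> cvS (F ^~ y) (f y).
  by move=> yr e /U[N HN]; exists N => n /HN; apply.
have M0 := holb_M r0 (H 0%N).
have D : hasD f x L.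
  split.
  - move=> a u v; apply: (cvS_unique (HL _)).
    have := cvS_lin a (HL u) (HL v); congr cvS; apply/funext => n.
    by rewrite ddP.
  - exists (8 * M / r) => v; apply: (@cvS_le _ _ _ _ 0%N (HL v)) => n _; exact: holb_est.
  move=> e e0; pose K := 2048 * M / r ^+ 2.
  have K0 : 0 <= K.
    apply: divr_ge0; last exact: sqr_ge0.
    by apply: mulr_ge0; [exact: ler0n|exact: M0].
  exists (Num.min (r / 4) (e / (K + 1))); first by rewrite lt_min !divr_gt0 // ltr_wpDl.
  move=> h; rewrite lt_min => /andP[hr he].
  have hr' : rn (x + h - x) < r by rewrite addrAC subrr add0r; have := rn_ge0 h; lra.
  have -> : f (x + h) - f x - L h = -1 *: (1 *: f x + L h) + f (x + h).
    by rewrite /GRing.scale /=; ring.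
  apply: (@cvS_le _ (fun n => -1 *: (1 *: F n x + dd (F n) x h) + F n (x + h)) _ _ 0%N).
    by apply: cvS_lin; [apply: cvS_lin => //; exact: Ux|exact: Ux].
  move=> n _.
  have -> : -1 *: (1 *: F n x + dd (F n) x h) + F n (x + h) = F n (x + h) - F n x - dd (F n) x h.
    by rewrite /GRing.scale /=; ring.
  apply: le_trans (holb_taylor r0 (H n) hr) _.
  rewrite -/K expr2 mulrA; apply: ler_wpM2r; first exact: rn_ge0.
  move: he; rewrite ltr_pdivlMr ?ltr_wpDl // => he.
  have := rn_ge0 h; nra.
have [df E] := hasD_dd D; split => // v; rewrite E; exact: HL.
Qed.

End Several.

(** * Second derivatives and their symmetry *)

Section Holo.
Context {R : realType} {V : normedModType (Cplx R)}.
Local Notation C := (Cplx R).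
Implicit Types (f g : V -> C) (x y v w h : V) (r M : R) (U : set V).

Definition holo U f := forall x, U x -> differentiable f x.

Lemma open_ball U x : open U -> U x -> exists r : R, 0 < r /\ forall y, rn (y - x) < r -> U y.
Proof. by move=> /rn_open oU /oU. Qed.

Lemma differentiable_cont f x (e : R) : differentiable f x -> 0 < e ->
  exists2 d : R, 0 < d & forall y, rn (y - x) < d -> rn (f y - f x) < e.
Proof.
move=> /dd_hasD [_ [M HM] D] e0; have [d d0 {}D] := D 1 ltr01.
have M1 : 0 < `|M| + 2 by rewrite ltr_wpDl.
exists (Num.min d (e / (`|M| + 2))); first by rewrite lt_min d0 divr_gt0.
move=> y; rewrite lt_min => /andP[yd]; rewrite ltr_pdivlMr // => ye.
have := D (y - x) yd; rewrite [x + _]addrC subrK mul1r => H.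
have := HM (y - x) => H2.
have -> : f y - f x = (f y - f x - dd f x (y - x)) + dd f x (y - x) by ring.
apply: le_lt_trans (rnD _ _) _; apply: le_lt_trans ye.
have := ler_norm M; have := rn_ge0 (y - x); nra.
Qed.

Lemma holo_holb U f x : open U -> holo U f -> U x ->
  exists r M, [/\ 0 < r, holb f x r M & forall y, rn (y - x) < r -> U y].
Proof.
move=> oU hf Ux; have [r [r0 rU]] := open_ball oU Ux.
have [d d0 H] := differentiable_cont (hf x Ux) ltr01.
exists (Num.min r d), (rn (f x) + 1); split; first by rewrite lt_min r0.
  move=> y; rewrite lt_min => /andP[/rU /hf df /H fy]; split => //.
  by have := rnBB (f y) (f x); lra.
by move=> y; rewrite lt_min => /andP[/rU].
Qed.

Lemma cvS_inv (a : R) : 0 <= a -> forall e : R, 0 < e -> exists N, forall n, (N <= n)%N -> a / n.+1%:R <= e.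
Proof.
move=> a0 e e0; have := archi_boundP (divr_ge0 a0 (ltW e0)); set N := Num.bound _ => H.
exists N => n Nn; rewrite ler_pdivrMr ?ltr0n // mulrC -ler_pdivrMr //.
by apply: le_trans (ltW H) _; rewrite ler_nat (leq_trans Nn).
Qed.

Lemma cvS_quot f x v : differentiable f x ->
  cvS (fun n => toC n.+1%:R * (f (x + toC n.+1%:R^-1 *: v) - f x)) (dd f x v).
Proof.
move=> /dd_hasD [_ _ D] e e0; have v1 : 0 < rn v + 1 by rewrite ltr_wpDl // rn_ge0.
have [d d0 {}D] := D (e / (rn v + 1)) (divr_gt0 e0 v1).
have d2 : 0 < d / 2 by lra.
have [N HN] := cvS_inv (rn_ge0 v) d2; exists N => n /HN Hn.
have k0 : 0 < n.+1%:R :> R by rewrite ltr0n.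
have kk : toC n.+1%:R * toC n.+1%:R^-1 = 1 :> C by rewrite -toCM mulfV ?gt_eqF.
have nh : rn (toC n.+1%:R^-1 *: v) = rn v / n.+1%:R.
  by rewrite rnZ rn_toC ger0_norm ?invr_ge0 ?ltW // mulrC.
have := D (toC n.+1%:R^-1 *: v); rewrite nh ddZ => /(_ (le_lt_trans Hn _)) H.
have {}H := H (ltac:(lra)).
have -> : toC n.+1%:R * (f (x + toC n.+1%:R^-1 *: v) - f x) - dd f x v =
  toC n.+1%:R * (f (x + toC n.+1%:R^-1 *: v) - f x - toC n.+1%:R^-1 * dd f x v).
  by rewrite [RHS]mulrBr mulrA kk mul1r.
rewrite rnM rn_toC ger0_norm; last exact: ltW.
apply: le_trans (ler_wpM2l (ltW k0) H) _.
have -> : n.+1%:R * (e / (rn v + 1) * (rn v / n.+1%:R)) = e * (rn v / (rn v + 1)).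
  by field; apply/andP; split; rewrite gt_eqF.
by rewrite ler_piMr ?ltW // ltr_pdivrMr // mul1r ltrDl.
Qed.

(** The derivative in direction v is a uniform limit of difference quotients near x, hence
    differentiable by [weierstrass]. The second conclusion records the convergence of their
    derivatives, for use in [dd_comm]; the shift N0 keeps the displaced points in the ball. *)
Lemma holb_dd f x r M v : 0 < r -> holb f x r M ->
  differentiable (fun y => dd f y v) x /\
  exists N0, forall w, cvS (fun n => toC (N0 + n).+1%:R *
     (dd f (x + toC (N0 + n).+1%:R^-1 *: v) w - dd f x w)) (dd (fun y => dd f y v) x w).
Proof.
move=> r0 H; have r8 : 0 < r / 16 by lra.
have M0 := holb_M r0 H.
have [N0 HN0] := cvS_inv (rn_ge0 v) r8.
pose k n : R := (N0 + n).+1%:R.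
have k0 n : 0 < k n by rewrite ltr0n.
have kk n : toC (k n) * toC (k n)^-1 = 1 :> C by rewrite -toCM mulfV ?gt_eqF.
have nh n : rn (toC (k n)^-1 *: v) = rn v / k n.
  by rewrite rnZ rn_toC ger0_norm ?invr_ge0 ?ltW // mulrC.
have sh n : rn v / k n <= r / 16 by apply: HN0; rewrite leq_addr.
pose F n y := toC (k n) * (f (y + toC (k n)^-1 *: v) - f y).
have [K K0 KE] : exists2 K : R, 0 <= K & K = 2048 * M / (r / 2) ^+ 2.
  exists (2048 * M / (r / 2) ^+ 2); last by [].
  apply: divr_ge0; last exact: sqr_ge0.
  by apply: mulr_ge0; [exact: ler0n|exact: M0].
have r2 : 0 < r / 2 by lra.
have hb y : rn (y - x) < r / 2 -> holb f y (r / 2) M.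
  by move=> yr; apply: holb_sub H _; lra.
have est n y : rn (y - x) < r / 2 -> rn (F n y - dd f y v) <= K * rn v ^+ 2 / k n.
  move=> yr; have := @holb_taylor _ _ f y (r / 2) M (toC (k n)^-1 *: v) r2 (hb y yr).
  rewrite nh -KE ddZ => /(_ (le_lt_trans (sh n) _)) T.
  have {}T := T (ltac:(lra)).
  have -> : F n y - dd f y v = toC (k n) * (f (y + toC (k n)^-1 *: v) - f y - toC (k n)^-1 * dd f y v).
    by rewrite [RHS]mulrBr mulrA kk mul1r.
  rewrite rnM rn_toC ger0_norm ?(ltW (k0 n)) //.
  apply: le_trans (ler_wpM2l (ltW (k0 n)) T) _.
  rewrite le_eqVlt; apply/orP; left; apply/eqP.
  have G (a b c : R) : 0 < c -> c * (a * (b / c) ^+ 2) = a * b ^+ 2 / c.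
    by move=> c0; field; rewrite gt_eqF.
  exact: G.
have dF n y : rn (y - x) < r / 2 -> differentiable (F n) y /\
   forall w, dd (F n) y w = toC (k n) * (dd f (y + toC (k n)^-1 *: v) w - dd f y w).
  move=> yr; have d1 : differentiable f (y + toC (k n)^-1 *: v).
    apply: (H _ _).1; rewrite addrAC; apply: le_lt_trans (rnD _ _) _; rewrite nh.
    by have := sh n; set q := rn v / k n; lra.
  have d2 : differentiable f y by apply: (H _ _).1; lra.
  have [d3 E3] := differentiable_shift d1.
  pose G u := f (u + toC (k n)^-1 *: v) - f u.
  have dG : differentiable G y by exact: differentiableB.
  have dc : differentiable (fun _ : V => toC (k n)) y by exact: differentiable_cst.
  split; first by apply: differentiableM.
  move=> w; rewrite -E3 -(dd_sub w d3 d2).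
  have -> : dd (F n) y w = dd (fun u => toC (k n) * G u) y w by [].
  rewrite dd_mul //; have -> : dd (fun _ : V => toC (k n)) y w = 0.
    by rewrite ddE diff_cst.
  by rewrite mulr0 addr0.
have [] := @weierstrass _ _ F (fun y => dd f y v) x (r / 2) (8 * M / (r / 2) * rn v + K * rn v ^+ 2) r2.
- move=> n y yr; split; first exact: (dF n y yr).1.
  have := est n y yr; have := holb_est v r2 (hb y yr) => h1 h2.
  have -> : F n y = dd f y v + (F n y - dd f y v) by ring.
  apply: le_trans (rnD _ _) _; apply: lerD => //; apply: le_trans h2 _.
  apply: ler_piMr; first by apply: mulr_ge0; [exact: K0|exact: sqr_ge0].
  by rewrite invf_le1 ?k0 // ler1n.
- move=> e e0; have Kv : 0 <= K * rn v ^+ 2 by apply: mulr_ge0; [exact: K0|exact: sqr_ge0].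
  have [N HN] := cvS_inv Kv e0; exists N => n Nn y yr.
  by apply: le_trans (est n y yr) _; apply: HN; rewrite (leq_trans Nn) // leq_addl.
move=> d cv; split => //; exists N0 => w e e0; have [N HN] := cv w e e0.
exists N => n /HN; rewrite (dF n x _).2 //; by rewrite subrr rn0.
Qed.

Lemma holo_dd U f v : open U -> holo U f -> holo U (fun y => dd f y v).
Proof.
by move=> oU hf x Ux; have [r [M [r0 H _]]] := holo_holb oU hf Ux; have [] := holb_dd v r0 H.
Qed.

(** The difference quotients in direction v of the derivative along w tend to the left side by
    [holb_dd] and to the right side by [cvS_quot]. *)
Lemma dd_comm U f x v w : open U -> holo U f -> U x ->
  dd (fun y => dd f y v) x w = dd (fun y => dd f y w) x v.
Proof.
move=> oU hf Ux; have [r [M [r0 H _]]] := holo_holb oU hf Ux.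
have [_ [N0 /(_ w) c1]] := holb_dd v r0 H.
have c2 := @cvS_quot (fun y => dd f y w) x v (holo_dd w oU hf Ux).
apply: cvS_unique c1 _ => e /c2 [N HN]; exists N => n Nn; apply: HN.
by rewrite (leq_trans Nn) // leq_addl.
Qed.

Lemma cont01_mul (h1 h2 : R -> C) : cont01 h1 -> cont01 h2 -> cont01 (fun s => h1 s * h2 s).
Proof.
move=> c1 c2 s s01 e e0.
have a0 := rn_ge0 (h1 s); have b0 := rn_ge0 (h2 s).
have q1 : 0 < e / 2 / (rn (h2 s) + 1) by rewrite divr_gt0 //; lra.
have q2 : 0 < Num.min 1 (e / 2 / (rn (h1 s) + 1)) by rewrite lt_min ltr01 divr_gt0 //; lra.
have [d1 d10 {}c1] := c1 s s01 _ q1; have [d2 d20 {}c2] := c2 s s01 _ q2.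
exists (Num.min d1 d2); first by rewrite lt_min d10.
move=> t t01; rewrite lt_min => /andP[/(c1 t t01) A /(c2 t t01)].
rewrite lt_min => /andP[B1 B2].
have -> : h1 t * h2 t - h1 s * h2 s = (h1 t - h1 s) * h2 t + h1 s * (h2 t - h2 s) by ring.
apply: le_lt_trans (rnD _ _) _; rewrite !rnM.
have {}A : rn (h1 t - h1 s) * (rn (h2 s) + 1) < e / 2 by rewrite -ltr_pdivlMr //; lra.
have {}B2 : rn (h2 t - h2 s) * (rn (h1 s) + 1) < e / 2 by rewrite -ltr_pdivlMr //; lra.
have := rnBB (h2 t) (h2 s) => h3.
have A' : rn (h1 t - h1 s) * rn (h2 t) <= rn (h1 t - h1 s) * (rn (h2 s) + 1).
  by apply: ler_wpM2l; [exact: rn_ge0|lra].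
have B' : rn (h1 s) * rn (h2 t - h2 s) <= rn (h2 t - h2 s) * (rn (h1 s) + 1).
  by rewrite mulrC; apply: ler_wpM2l; [exact: rn_ge0|lra].
lra.
Qed.

Lemma cont01_rder (h h' : R -> C) : (forall s : R, 0 <= s <= 1 -> rder h s (h' s)) -> cont01 h.
Proof.
move=> D s s01 e e0; have [d d0 H] := rder_cont (D s s01) e0.
by exists d => // t _ /H; rewrite [s + _]addrC subrK.
Qed.

Lemma rder_id (s : R) : rder (fun t : R => toC t) s 1.
Proof.
move=> e e0; exists 1 => // h _.
have -> : toC (s + h) - toC s - toC h * 1 = 0 :> C by rewrite toCD; ring.
by rewrite rn0 mulr_ge0 ?normr_ge0 // ltW.
Qed.

Lemma rder_idM (h : R -> C) (s : R) (l : C) : rder h s l ->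
  rder (fun t => toC t * h t) s (h s + toC s * l).
Proof.
move=> D e e0.
have e2 : 0 < e / 2 by lra.
have q : 0 < e / 2 / (`|s| + 1) by rewrite divr_gt0 // ltr_wpDl.
have [d1 d10 H1] := D _ q; have [d2 d20 H2] := rder_cont D e2.
exists (Num.min d1 d2); first by rewrite lt_min d10.
move=> k; rewrite lt_min => /andP[/H1 A /H2 B].
have -> : toC (s + k) * h (s + k) - toC s * h s - toC k * (h s + toC s * l) =
  toC s * (h (s + k) - h s - toC k * l) + toC k * (h (s + k) - h s) by rewrite toCD; ring.
apply: le_trans (rnD _ _) _; rewrite !rnM !rn_toC.
have s1 : `|s| * rn (h (s + k) - h s - toC k * l) <= e / 2 * `|k|.
  apply: le_trans (ler_wpM2l (normr_ge0 s) A) _; rewrite mulrA.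
  apply: ler_wpM2r => //; rewrite mulrCA ler_piMr ?ltW // ltr_pdivrMr ?ltr_wpDl //.
  by rewrite mul1r ltrDl.
have := ler_wpM2l (normr_ge0 k) (ltW B).
lra.
Qed.

End Holo.

(** * Primitives of holomorphic functions in one direction *)

Section Prim.
Context {R : realType} {V : normedModType (Cplx R)}.
Local Notation C := (Cplx R).
Implicit Types (f g : V -> C) (x y v w h : V) (r M : R) (U : set V).
Variables (l : V -> C) (e : V).
Hypothesis llin : forall (a : C) u v, l (a *: u + v) = a * l u + l v.
Hypothesis lbd : exists M, forall v, rn (l v) <= M * rn v.
Hypothesis le1 : l e = 1.

(* [slide s x] is the point of the line x + C e where l takes the value s * l x. *)
Definition slide (s : R) (x : V) : V := x - (toC (1 - s) * l x) *: e.

Lemma slide1 x : slide 1 x = x.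
Proof. by rewrite /slide subrr toC0 mul0r scale0r subr0. Qed.
Lemma slideD s x h : slide s (x + h) = slide s x + slide s h.
Proof.
have lD : l (x + h) = l x + l h by rewrite -[x]scale1r llin scale1r mul1r.
by rewrite /slide lD mulrDr scalerDl opprD addrACA.
Qed.
Lemma slideP s (a : C) u v : slide s (a *: u + v) = a *: slide s u + slide s v.
Proof. by rewrite /slide llin mulrDr scalerDl opprD scalerBr addrACA scalerA mulrCA. Qed.
Lemma slide_line s x : slide s x = slide 0 x + toC s *: (l x *: e).
Proof. by rewrite /slide subr0 toC1 mul1r toCB toC1 mulrBl mul1r scalerBl opprB addrA addrAC scalerA. Qed.
Lemma slide_e s : slide s e = toC s *: e.
Proof. by rewrite /slide le1 mulr1 toCB toC1 scalerBl scale1r opprB addrC subrK. Qed.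
Lemma slide_bd : exists2 k : R, 0 < k & forall s h, 0 <= s <= 1 -> rn (slide s h) <= k * rn h.
Proof.
have [M HM] := lbd; exists (1 + `|M| * rn e); first by rewrite ltr_pwDl // mulr_ge0 // rn_ge0.
move=> s h s01; rewrite /slide; apply: le_trans (rnB _ _) _; rewrite rnZ rnM rn_toC.
rewrite mulrDl mul1r lerD2l ger0_norm; last by lra.
have h0 := rn_ge0 h; have e0 := rn_ge0 e.
have H1 : rn (l h) <= `|M| * rn h.
  apply: le_trans (HM h) _; apply: ler_wpM2r => //; exact: ler_norm.
have l0 := rn_ge0 (l h).
rewrite [X in _ <= X]mulrAC; apply: ler_wpM2r => //.
by apply: le_trans _ H1; rewrite ler_piMl //; lra.
Qed.

(** The integral of [g] along e from the hyperplane l = 0 to x, rescaled to [0, 1]. *)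
Definition prim g x : C := l x * Int (fun s => g (slide s x)).

Definition star U := forall x, U x -> forall s : R, 0 <= s <= 1 -> U (slide s x).

(** Compactness of [0, 1] gives one radius and one bound for the whole segment. A single parameter i
    tending to infinity plays both roles, as the bound i and as the radius 1 / i. *)
Lemma slide_cover U g x : open U -> holo U g -> star U -> U x ->
  exists2 r, 0 < r & exists M, forall s : R, 0 <= s <= 1 -> holb g (slide s x) r M /\
    forall y, rn (y - slide s x) < r -> U y.
Proof.
move=> oU hg sU Ux.
have := @segment_compact R 0 1 => /compact_near_coveringP.
move=> /(_ R (pinfty_nbhs R) (fun i s => holb g (slide s x) i^-1 i /\
    forall y, rn (y - slide s x) < i^-1 -> U y) _).
case/(_ _)/Wrap => [s|].
  rewrite /= in_itv /= => s01.
  have [r [M [r0 H HU]]] := holo_holb oU hg (sU x Ux s s01).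
  have c0 : 0 < rn (l x *: e) + 1 by rewrite ltr_wpDl // rn_ge0.
  exists (ball s (r / 2 / (rn (l x *: e) + 1)), [set i | Num.max M (2 / r) < i]).
    split; first by apply: nbhsx_ballx; rewrite divr_gt0 //; lra.
    by exists (Num.max M (2 / r)); split; rewrite ?num_real.
  move=> [t i] /= [st]; rewrite gt_max => /andP[Mi ri].
  move: st; rewrite -ball_normE /= ltr_pdivlMr // => st.
  have i0 : 0 < i by apply: lt_trans ri; rewrite divr_gt0.
  have ir : i^-1 < r / 2.
    by rewrite -[X in _ < X]invrK ltf_pV2 ?posrE ?invr_gt0 ?divr_gt0 // invf_div.
  have D : rn (slide t x - slide s x) < r / 2.
    rewrite (slide_line t) (slide_line s) opprD addrACA subrr add0r -scalerBl -toCB rnZ rn_toC distrC.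
    apply: le_lt_trans st; apply: ler_wpM2l => //; lra.
  have sub y : rn (y - slide t x) < i^-1 -> rn (y - slide s x) < r.
    by move=> yt; apply: le_lt_trans (rn_tri (slide t x) _ _) _; lra.
  split=> [y /sub yr|y /sub]; last exact: HU.
  by have [dy By] := H y yr; split => //; lra.
move=> [i0 [_ H]].
have ip : 0 < Num.max i0 0 + 1 by rewrite ltr_wpDl // le_max lexx orbT.
exists (Num.max i0 0 + 1)^-1; first by rewrite invr_gt0.
exists (Num.max i0 0 + 1) => s s01; apply: H; last by rewrite /= in_itv.
by apply: (@le_lt_trans _ _ (Num.max i0 0)); rewrite ?le_max ?lexx // ltrDl.
Qed.

Lemma cont01_slide U g x : holo U g -> star U -> U x -> cont01 (fun s => g (slide s x)).
Proof.
move=> hg sU Ux; apply: (@cont01_rder R _ (fun s => dd g (slide s x) (l x *: e))) => s s01.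
have -> : (fun s => g (slide s x)) = (fun t => g (slide 0 x + toC t *: (l x *: e))).
  by apply/funext => t; rewrite -slide_line.
rewrite (slide_line s x); apply: dd_line; rewrite -(slide_line s x); apply: hg; exact: sU.
Qed.

Lemma rder_slide U g x (s : R) : holo U g -> star U -> U x -> 0 <= s <= 1 ->
  rder (fun s => g (slide s x)) s (dd g (slide s x) (l x *: e)).
Proof.
move=> hg sU Ux s01.
have -> : (fun s => g (slide s x)) = (fun t => g (slide 0 x + toC t *: (l x *: e))).
  by apply/funext => t; rewrite -slide_line.
rewrite (slide_line s x); apply: dd_line; rewrite -(slide_line s x); apply: hg; exact: sU.
Qed.

(** Differentiation under the integral, the Taylor remainder being uniform along the segment by
    [slide_cover]. In direction e the result is the integral of the derivative of s g (slide s x),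
    that is g x. *)
Lemma prim_holo U g x : open U -> holo U g -> star U -> U x ->
  differentiable (prim g) x /\ dd (prim g) x e = g x.
Proof.
move=> oU hg sU Ux.
have [r r0 [M HM]] := slide_cover oU hg sU Ux.
have [k k0 Hk] := slide_bd.
have [r1 [r10 HU]] := open_ball oU Ux.
have M0 : 0 <= M by have [] := HM 0 (ltac:(by rewrite lexx ler01)); move=> /(holb_M r0).
pose G y := Int (fun s => g (slide s y)).
pose T h := Int (fun s => dd g (slide s x) (slide s h)).
have cg y : U y -> cont01 (fun s => g (slide s y)) by exact: cont01_slide.
have cd v : cont01 (fun s => dd g (slide s x) v).
  exact: (cont01_slide (holo_dd v oU hg) sU Ux).
have cid : cont01 (fun s : R => toC s : C).
  by apply: (@cont01_rder R _ (fun=> 1)) => s _; exact: rder_id.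
have cT h : cont01 (fun s => dd g (slide s x) (slide s h)).
  have := cont01_lin 1 (cont01_mul cid (cd (l h *: e))) (cd (slide 0 h)).
  congr cont01; apply/funext => s.
  by rewrite mul1r (slide_line s h) ddD addrC (ddZ g (slide s x) (toC s)).
have Tlin (a : C) u v : T (a *: u + v) = a *: T u + T v.
  rewrite -[a *: T u]/(a * T u) -Int_lin //.
  by apply: Int_ext => s s01; rewrite slideP ddP.
have [K K0 KE] : exists2 K : R, 0 <= K & K = 2048 * M / r ^+ 2.
  exists (2048 * M / r ^+ 2); last by [].
  by apply: divr_ge0; [apply: mulr_ge0; [exact: ler0n|exact: M0]|exact: sqr_ge0].
have HG : hasD G x T.
  split => //.
    exists (2 * (8 * M / r * k)) => v.
    have := @Int_bound R (fun s => dd g (slide s x) (slide s v)) (8 * M / r * k * rn v) 0 (cT v).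
    rewrite divr1 mulrA; apply => s s01; rewrite expr0 mulr1.
    have [h1 _] := HM s s01; apply: le_trans (holb_est _ r0 h1) _.
    rewrite -[X in _ <= X]mulrA; apply: ler_wpM2l; last exact: Hk.
    by apply: divr_ge0; [apply: mulr_ge0; [exact: ler0n|exact: M0]|exact: ltW].
  move=> ee ee0.
  pose K' := 2 * (K * k ^+ 2).
  have K'0 : 0 <= K' by rewrite mulr_ge0 // mulr_ge0 // sqr_ge0.
  exists (Num.min r1 (Num.min (r / 4 / k) (ee / (K' + 1)))).
    by rewrite !lt_min r10 !divr_gt0 // ltr_wpDl.
  move=> h; rewrite !lt_min => /and3P[h1 h2 h3].
  have Uh : U (x + h) by apply: HU; rewrite addrAC subrr add0r.
  have -> : G (x + h) - G x - T h = -1 * (1 * G x + T h) + G (x + h) by ring.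
  rewrite -(Int_lin 1 (cg x Ux) (cT h)).
  have cc := cont01_lin 1 (cg x Ux) (cT h).
  rewrite -(Int_lin (-1) cc (cg _ Uh)).
  have := @Int_bound R _ (K * k ^+ 2 * rn h ^+ 2) 0 (cont01_lin (-1) cc (cg _ Uh)).
  rewrite divr1 => /(_ _)/Wrap[].
    move=> s s01; rewrite expr0 mulr1.
    have [H1 _] := HM s s01.
    have -> : -1 * (1 * g (slide s x) + dd g (slide s x) (slide s h)) + g (slide s (x + h)) =
       g (slide s x + slide s h) - g (slide s x) - dd g (slide s x) (slide s h).
      by rewrite slideD; ring.
    have hs := Hk s h s01.
    have h4 : rn (slide s h) < r / 4.
      by apply: le_lt_trans hs _; rewrite mulrC -ltr_pdivlMr.
    apply: le_trans (holb_taylor r0 H1 h4) _; rewrite -KE -mulrA -exprMn.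
    apply: ler_wpM2l => //; rewrite ler_pXn2r ?nnegrE ?rn_ge0 // mulr_ge0 ?rn_ge0 ?(ltW k0) //.
  move=> /le_trans; apply.
  rewrite mulrA -/K' expr2 mulrA; apply: ler_wpM2r; first exact: rn_ge0.
  move: h3; rewrite ltr_pdivlMr ?ltr_wpDl // => h3.
  have := rn_ge0 h; nra.
have [dG EG] := hasD_dd HG.
have [dl El] := differentiable_linear llin lbd x.
split; first exact: differentiableM.
rewrite -[prim g]/(fun y => l y * G y) (dd_mul e dl dG) EG El le1 mulr1.
have cse : cont01 (fun s => toC s * dd g (slide s x) e) by apply: cont01_mul.
have -> : T e = Int (fun s => toC s * dd g (slide s x) e).
  by apply: Int_ext => s _; rewrite slide_e ddZ.
rewrite -(Int_lin (l x) cse (cg x Ux)).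
rewrite (@Int_FTC R (fun s => toC s * g (slide s x))); first by rewrite toC1 toC0 mul1r mul0r subr0 slide1.
move=> s s01; have := rder_idM (rder_slide hg sU Ux s01); rewrite ddZ.
suff -> : g (slide s x) + toC s * (l x * dd g (slide s x) e) =
  l x * (toC s * dd g (slide s x) e) + g (slide s x) by [].
ring.
Qed.

Lemma prim_bound U g x (b : R) n : holo U g -> star U -> U x ->
  (forall s : R, 0 <= s <= 1 -> rn (g (slide s x)) <= b * s ^+ n) ->
  rn (prim g x) <= rn (l x) * (2 * (b / n.+1%:R)).
Proof.
move=> hg sU Ux B; rewrite /prim rnM; apply: ler_wpM2l; first exact: rn_ge0.
by apply: Int_bound => //; exact: (cont01_slide hg sU Ux).
Qed.

End Prim.

Section Geo.
Context {R : realType}.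
Local Notation C := (Cplx R).

Lemma geo_cauchy (W : normedModType C) (u : nat -> W) (a : R) : 0 <= a ->
  (forall n, rn (u n.+1 - u n) <= a / 2 ^+ n) ->
  forall n m, (n <= m)%N -> rn (u m - u n) <= 2 * a / 2 ^+ n.
Proof.
move=> a0 H n m /subnKC <-; move: (m - n)%N => k {m}.
suff : rn (u (n + k)%N - u n) <= 2 * a / 2 ^+ n * (1 - 1 / 2 ^+ k).
  move=> /le_trans; apply; apply: ler_piMr; first by rewrite divr_ge0 ?mulr_ge0 ?exprn_ge0.
  by have : 0 <= 1 / 2 ^+ k :> R; [rewrite divr_ge0 ?exprn_ge0|lra].
elim: k => [|k IH]; first by rewrite addn0 subrr rn0 expr0 divr1 subrr mulr0.
rewrite addnS; apply: le_trans (rn_tri (u (n + k)%N) _ _) _.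
apply: le_trans (lerD (H _) IH) _; rewrite exprD exprS le_eqVlt; apply/orP; left; apply/eqP.
by field; rewrite !expf_neq0 // pnatr_eq0.
Qed.

Lemma geo_cvg (u : nat -> C) (a : R) : 0 <= a ->
  (forall n, rn (u n.+1 - u n) <= a / 2 ^+ n) ->
  exists l, cvS u l /\ forall n, rn (u n - l) <= 2 * a / 2 ^+ n.
Proof.
move=> a0 H; have G := geo_cauchy a0 H.
have [l cl] : exists l, cvS u l.
  apply: C_complete => e e0; have e2 : 0 < e / 2 by lra.
  have [N HN] := pow_small (2 * a) e2; exists N => n m Nn Nm.
  apply: le_trans (rn_tri (u N) _ _) _; rewrite [rn (u N - _)]rnC.
  have := G N n Nn; have := G N m Nm; lra.
exists l; split => // n; apply: (@cvS_le R _ (fun m => u n - u m) (u n - l) _ n); last first.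
  by move=> m nm; rewrite rnC; exact: G.
move=> e /cl[N HN]; exists N => m /HN.
move=> h; have E : u n - u m - (u n - l) = l - u m by ring.
by rewrite E rnC.
Qed.

Lemma line_cder (V : normedModType C) (f : V -> C) (x v : V) (t : C) :
  differentiable f (x + t *: v) ->
  cder (fun t => f (x + t *: v)) t (dd f (x + t *: v) v).
Proof.
move=> /dd_hasD [_ _ D]; apply: cder_eps => e e0.
have v1 : 0 < rn v + 1 by rewrite ltr_wpDl // rn_ge0.
have [d d0 {}D] := D (e / (rn v + 1)) (divr_gt0 e0 v1).
exists (d / (rn v + 1)); first exact: divr_gt0.
move=> h; rewrite ltr_pdivlMr // => hd.
have hv : rn (h *: v) <= rn h * (rn v + 1).
  by rewrite rnZ; apply: ler_wpM2l; rewrite ?rn_ge0 // lerDl.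
have := D (h *: v) (le_lt_trans hv hd).
rewrite ddZ scalerDl addrA => /le_trans; apply.
rewrite mulrAC ler_pdivrMr // -mulrA; apply: ler_wpM2l hv; exact: ltW.
Qed.

(** Only a disc in direction v is required, not a ball, so the radius can follow the distance to the
    boundary in that direction. *)
Lemma cauchy_line (V : normedModType C) (f : V -> C) (x v : V) (r M : R) : 0 < r ->
  (forall t : C, rn t < r -> differentiable f (x + t *: v) /\ rn (f (x + t *: v)) <= M) ->
  rn (dd f x v) <= 8 * M / r.
Proof.
move=> r0 H.
have := @cauchy0 R (fun t => f (x + t *: v)) r M r0 => /(_ _ _)/Wrap[].
- by move=> t /H [/line_cder /hasD_differentiable[] + _ _].
- by move=> t /H [].
have [D0 _] := H 0 (ltac:(by rewrite rn0)).
have [_ E] := hasD_differentiable (line_cder D0).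
by rewrite E mul1r scale0r addr0.
Qed.

(** This is (1 + 1/n)^n <= e, in the form met when the distance c is shortened by c / (n + 1). *)
Lemma euler_bound n (c : R) : 0 < c ->
  (1 / (c * (n%:R / n.+1%:R))) ^+ n <= expR 1 * (1 / c) ^+ n.
Proof.
case: n => [|n] c0; first by rewrite !expr0 mulr1 -expR0 ler_expR.
have p0 : 0 < n.+1%:R :> R by rewrite ltr0n.
have -> : 1 / (c * (n.+1%:R / n.+2%:R)) = (1 + 1 / n.+1%:R) * (1 / c) :> R.
  have -> : n.+2%:R = n.+1%:R + 1 :> R by rewrite natr1.
  by move: p0; set p := n.+1%:R => p0; field; rewrite !gt_eqF // addr_gt0.
rewrite exprMn; apply: ler_wpM2r; first by rewrite exprn_ge0 // divr_ge0 ?ltW.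
have -> : expR 1 = expR (1 / n.+1%:R) ^+ n.+1 :> R.
  by rewrite -expRM_natl mulrCA divff ?mulr1 // gt_eqF.
rewrite ler_pXn2r ?nnegrE ?expR_ge0 ?expR_ge1Dx //.
Qed.

Lemma lin_facts (V : normedModType C) (l : V -> C) :
  (forall (a : C) u v, l (a *: u + v) = a * l u + l v) ->
  [/\ l 0 = 0, forall u v, l (u + v) = l u + l v & forall (a : C) u, l (a *: u) = a * l u].
Proof.
move=> lin; have lD u v : l (u + v) = l u + l v by rewrite -[u]scale1r lin scale1r mul1r.
have l0 : l 0 = 0.
  by have := lD 0 0; rewrite addr0 => /esym/eqP; rewrite -subr_eq0 addrK => /eqP.
by split => // a u; rewrite -[a *: u]addr0 lin l0 addr0.
Qed.
End Geo.

(** * Contact charts *)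

Section PDE.
Context {R : realType} {V : normedModType (Cplx R)}.
Local Notation C := (Cplx R).
Variables (l2 l3 : V -> C) (e2 e3 : V) (B : V -> C) (Om : set V) (rho b : R).
Hypothesis l2lin : forall (a : C) u v, l2 (a *: u + v) = a * l2 u + l2 v.
Hypothesis l2bd : exists M, forall v, rn (l2 v) <= M * rn v.
Hypothesis l3lin : forall (a : C) u v, l3 (a *: u + v) = a * l3 u + l3 v.
Hypothesis l3bd : exists M, forall v, rn (l3 v) <= M * rn v.
Hypothesis l22 : l2 e2 = 1.
Hypothesis l32 : l3 e2 = 0.
Hypothesis l23 : l2 e3 = 0.
Hypothesis l33 : l3 e3 = 1.
Hypothesis oOm : open Om.
Hypothesis sOm : star l2 e2 Om.
Hypothesis Om3 : forall X, Om X -> rn (l3 X) < rho.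
Hypothesis Omt : forall X t, Om X -> rn (l3 X + t) < rho -> Om (X + t *: e3).
Hypothesis hB : holo Om B.
Hypothesis bB : forall X, Om X -> rn (B X) <= b.
Hypothesis b0 : 0 <= b.

(* Picard iteration for v = l3 - \int_0^(l2) B v_3; the n-th term is at most
   rho (N |l2| / (rho - |l3|)) ^ n with N = pN, the derivative along e3 costing a factor
   n / (rho - |l3|) by Cauchy's estimate on a disc of radius (rho - |l3|) / n. *)
Fixpoint pv (n : nat) : V -> C :=
  if n is m.+1 then fun X => - prim l2 e2 (fun Y => B Y * dd (pv m) Y e3) X else l3.

(** The factors are 8 from Cauchy's estimate, 2 from the integral bound, e from [euler_bound] and b
    from [B]. *)
Definition pN : R := 16 * expR 1 * b.

Lemma pN_ge0 : 0 <= pN.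
Proof. by rewrite /pN !mulr_ge0 // expR_ge0. Qed.

Lemma l2_slide s X : l2 (slide l2 e2 s X) = toC s * l2 X.
Proof.
by have [_ lD lZ] := lin_facts l2lin; rewrite /slide -scaleNr lD lZ l22 toCB toC1; ring.
Qed.
Lemma l3_slide s X : l3 (slide l2 e2 s X) = l3 X.
Proof. by have [_ lD lZ] := lin_facts l3lin; rewrite /slide -scaleNr lD lZ l32; ring. Qed.

(** Cauchy's estimate on the disc of radius d / (n + 1) in direction e3, where l2 is constant and
    the weight (rho - |l3|)^-n grows at most by the factor e. *)
Lemma pv_dd n X (K : R) : 0 <= K -> Om X -> holo Om (pv n) ->
  (forall Y, Om Y -> rn (pv n Y) <= K * rn (l2 Y) ^+ n * (1 / (rho - rn (l3 Y))) ^+ n) ->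
  rn (dd (pv n) X e3) <=
    8 * expR 1 * K * n.+1%:R * rn (l2 X) ^+ n * (1 / (rho - rn (l3 X))) ^+ n.+1.
Proof.
move=> K0 OX hv Bv; have [_ l2D l2Z] := lin_facts l2lin; have [_ l3D l3Z] := lin_facts l3lin.
set d := rho - rn (l3 X); have d0 : 0 < d by rewrite subr_gt0 Om3.
have n0 : 0 < n.+1%:R :> R by rewrite ltr0n.
have r0 : 0 < d / n.+1%:R by rewrite divr_gt0.
have dn : d - d / n.+1%:R = d * (n%:R / n.+1%:R).
  by rewrite -[in RHS](addrK 1 n%:R) natr1; field; rewrite gt_eqF.
have y0 : 0 <= rn (l2 X) by exact: rn_ge0.
have := @cauchy_line R V (pv n) X e3 (d / n.+1%:R)
  (K * rn (l2 X) ^+ n * (expR 1 * (1 / d) ^+ n)) r0.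
case/(_ _)/Wrap => [t tr|].
  have zt : rn (l3 X + t) < rho.
    apply: le_lt_trans (rnD _ _) _; have : d / n.+1%:R <= d.
      by rewrite ler_pdivrMr //; apply: ler_peMr; [exact: ltW|rewrite ler1n].
    move: tr; set q := d / n.+1%:R => tr qd.
    by have : d = rho - rn (l3 X) by []; lra.
  have OXt := Omt OX zt; split; first exact: hv.
  apply: le_trans (Bv _ OXt) _; rewrite l2D l2Z l23 mulr0 addr0 l3D l3Z l33 mulr1.
  apply: ler_wpM2l; first by rewrite mulr_ge0 // exprn_ge0.
  apply: le_trans _ (euler_bound n d0).
  case: n {hv Bv n0 r0} tr dn => [|n] tr dn; first by rewrite !expr0.
  have p0 : 0 < d * (n.+1%:R / n.+2%:R) by rewrite mulr_gt0 // divr_gt0 // ltr0n.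
  have q0 : d * (n.+1%:R / n.+2%:R) <= rho - rn (l3 X + t).
    have := rnD (l3 X) t; rewrite -dn; move: tr; set q := d / _ => tr.
    by have : d = rho - rn (l3 X) by []; lra.
  have q1 := lt_le_trans p0 q0.
  rewrite ler_pXn2r ?nnegrE ?divr_ge0 ?(ltW q1) ?(ltW p0) //.
  by rewrite !div1r lef_pV2.
move=> /le_trans; apply; rewrite le_eqVlt; apply/orP; left; apply/eqP.
rewrite exprSr; set q := (1 / d) ^+ n; set p := rn (l2 X) ^+ n.
by field; rewrite !gt_eqF.
Qed.

(** The factor n + 1 lost in [pv_dd] is regained by integrating s^n, since along the slide l2 is
    multiplied by s while l3 is constant. *)
Lemma pv_spec n : holo Om (pv n) /\
  forall X, Om X -> rn (pv n X) <= rho * pN ^+ n * rn (l2 X) ^+ n * (1 / (rho - rn (l3 X))) ^+ n.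
Proof.
elim: n => [|n [hv Bv]].
  split; first by move=> X _; have [] := differentiable_linear l3lin l3bd X.
  by move=> X OX; rewrite !expr0 !mulr1 /=; apply: ltW; exact: Om3.
have N0 := pN_ge0.
pose g Y := B Y * dd (pv n) Y e3.
have hg : holo Om g.
  by move=> X OX; apply: differentiableM; [exact: hB|exact: (holo_dd e3 oOm hv OX)].
split.
  move=> X OX /=; have [d _] := prim_holo l2lin l2bd l22 oOm hg sOm OX.
  exact: differentiableN.
move=> X OX; rewrite /= rnN -/g.
have rho0 : 0 <= rho by apply: le_trans (rn_ge0 _) (ltW (Om3 OX)).
have K0 : 0 <= rho * pN ^+ n by rewrite mulr_ge0 // exprn_ge0.
set d := rho - rn (l3 X); have d0 : 0 < d by rewrite subr_gt0 Om3.
pose K := b * (8 * expR 1 * (rho * pN ^+ n) * n.+1%:R * (1 / d) ^+ n.+1) * rn (l2 X) ^+ n.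
have := @prim_bound R V l2 e2 Om g X K n hg sOm OX.
case/(_ _)/Wrap => [s s01|].
  have Os := sOm OX s01; rewrite /g rnM.
  have := pv_dd K0 Os hv Bv; rewrite l2_slide l3_slide -/d rnM rn_toC ger0_norm ?(andP s01).1 // => H.
  apply: le_trans (ler_pM (rn_ge0 _) (rn_ge0 _) (bB Os) H) _.
  rewrite le_eqVlt; apply/orP; left; apply/eqP; rewrite /K [(s * _) ^+ n]exprMn.
  by set q := (1 / d) ^+ n.+1; set p := pN ^+ n; ring.
move=> /le_trans; apply; rewrite le_eqVlt; apply/orP; left; apply/eqP.
rewrite /K [pN ^+ n.+1]exprSr [rn _ ^+ n.+1]exprSr.
set q := (1 / d) ^+ n.+1; set p := pN ^+ n; set y := rn (l2 X) ^+ n.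
rewrite [X in p * X]/pN.
have n0 : n.+1%:R != 0 :> R by rewrite pnatr_eq0.
by move: n0; set m := n.+1%:R => n0; field.
Qed.

(** Where the ratio pN |l2| / (rho - |l3|) is below 1/2, so that the series of the [pv n] converges
    geometrically. *)
Definition Om' : set V := [set X | Om X /\ 2 * pN * rn (l2 X) + rn (l3 X) < rho].

Lemma open_Om' : open Om'.
Proof.
apply/rn_open => X [OX lt]; have [r [r0 HU]] := open_ball oOm OX.
have [_ l2D _] := lin_facts l2lin; have [_ l3D _] := lin_facts l3lin.
have [M2 H2] := l2bd; have [M3 H3] := l3bd; have N0 := pN_ge0.
set g := rho - (2 * pN * rn (l2 X) + rn (l3 X)).
have g0 : 0 < g by rewrite subr_gt0.
set m := 2 * pN * `|M2| + `|M3| + 1.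
have m0 : 0 < m by rewrite ltr_wpDl // addr_ge0 // mulr_ge0 // mulr_ge0.
exists (Num.min r (g / m)); split; first by rewrite lt_min r0 divr_gt0.
move=> Y; rewrite lt_min => /andP[/HU OY]; rewrite ltr_pdivlMr // => Yg; split => //.
have YX : Y = X + (Y - X) by rewrite addrC subrK.
have h0 := rn_ge0 (Y - X).
have A2 : rn (l2 Y) <= rn (l2 X) + `|M2| * rn (Y - X).
  rewrite {1}YX l2D; apply: le_trans (rnD _ _) _; rewrite lerD2l.
  by apply: le_trans (H2 _) _; apply: ler_wpM2r => //; exact: ler_norm.
have A3 : rn (l3 Y) <= rn (l3 X) + `|M3| * rn (Y - X).
  rewrite {1}YX l3D; apply: le_trans (rnD _ _) _; rewrite lerD2l.
  by apply: le_trans (H3 _) _; apply: ler_wpM2r => //; exact: ler_norm.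
have A4 := ler_wpM2l (mulr_ge0 (ler0n R 2) N0) A2.
rewrite /m /g in Yg; lra.
Qed.

Lemma pv_small n X : Om' X -> rn (pv n X) <= rho / 2 ^+ n.
Proof.
move=> [OX lt]; have [_ /(_ X OX) H] := pv_spec n; apply: le_trans H _.
have rho0 : 0 <= rho by apply: le_trans (rn_ge0 _) (ltW (Om3 OX)).
rewrite -!mulrA; apply: ler_wpM2l => //; rewrite -!exprMn -exprVn.
have d0 : 0 < rho - rn (l3 X) by rewrite subr_gt0 Om3.
have N0 := pN_ge0; have y0 := rn_ge0 (l2 X).
apply: lerXn2r; rewrite ?nnegrE ?invr_ge0 //.
  by rewrite mulr_ge0 // mulr_ge0 // divr_ge0 // ltW.
by rewrite mulrA mul1r ler_pdivrMr //; lra.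
Qed.

Fixpoint pS n : V -> C := if n is m.+1 then fun X => pS m X + pv m.+1 X else pv 0.

Lemma pS_holo n : holo Om (pS n).
Proof.
elim: n => [|n IH]; first by have [] := pv_spec 0.
by move=> X OX; apply: differentiableD; [exact: IH|have [H _] := pv_spec n.+1; exact: H].
Qed.

Lemma pS_rec n X : Om X -> dd (pS n.+1) X e2 = - B X * dd (pS n) X e3.
Proof.
move=> OX; have l3d := differentiable_linear l3lin l3bd X.
have P m : dd (pv m.+1) X e2 = - (B X * dd (pv m) X e3).
  have [hv _] := pv_spec m.
  pose g Y := B Y * dd (pv m) Y e3.
  have hg : holo Om g.
    by move=> Y OY; apply: differentiableM; [exact: hB|exact: (holo_dd e3 oOm hv OY)].
  have [d E] := prim_holo l2lin l2bd l22 oOm hg sOm OX.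
  have c0 : differentiable (fun _ : V => 0 : C) X by exact: differentiable_cst.
  have -> : dd (pv m.+1) X e2 = dd (fun Y => 0 - prim l2 e2 g Y) X e2.
    by congr (dd _ X e2); apply/funext => Y; rewrite sub0r.
  by rewrite (dd_sub e2 c0 d) E ddE diff_cst /= sub0r.
elim: n => [|n IH].
  have [h1 _] := pv_spec 1.
  have -> : dd (pS 1) X e2 = dd (fun Y => pv 0 Y + pv 1 Y) X e2 by [].
  by rewrite (dd_add e2 l3d.1 (h1 X OX)) P l3d.2 l32 add0r mulNr.
have [h1 _] := pv_spec n.+2; have [h0 _] := pv_spec n.+1.
have -> : dd (pS n.+2) X e2 = dd (fun Y => pS n.+1 Y + pv n.+2 Y) X e2 by [].
rewrite (dd_add e2 (pS_holo n.+1 OX) (h1 X OX)) IH P.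
have -> : dd (pS n.+1) X e3 = dd (fun Y => pS n Y + pv n.+1 Y) X e3 by [].
rewrite (dd_add e3 (pS_holo n OX) (h0 X OX)); ring.
Qed.

(** The index shift in [pS_rec] disappears in the limit, since [weierstrass] gives convergence of
    both derivatives. Every correction is a primitive taken from l2 = 0, whence the initial value
    l3. *)
Lemma transport_solution : exists v : V -> C, [/\ holo Om' v,
  forall X, Om' X -> dd v X e2 + B X * dd v X e3 = 0 &
  forall X, Om' X -> l2 X = 0 -> v X = l3 X].
Proof.
have ex X : exists l, Om' X -> cvS (pS ^~ X) l /\ forall n, rn (pS n X - l) <= 2 * rho / 2 ^+ n.
  have [OX|nO] := pselect (Om' X); last by exists 0.
  have rho0 : 0 <= rho by apply: le_trans (rn_ge0 _) (ltW (Om3 OX.1)).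
  have [|l [c1 c2]] := @geo_cvg R (pS ^~ X) rho rho0.
    move=> n; rewrite [pS n.+1 X]/(pS n X + pv n.+1 X) addrAC subrr add0r.
    apply: le_trans (pv_small _ OX) _.
    by apply: ler_wpM2l => //; rewrite lef_pV2 ?posrE ?exprn_gt0 // exprS ler_peMl ?exprn_ge0 // ler1n.
  by exists l.
have [v Hv] := choice ex.
have W X : Om' X -> differentiable v X /\ forall w, cvS (fun n => dd (pS n) X w) (dd v X w).
  move=> OX; have [r [r0 HU]] := open_ball open_Om' OX.
  have rho0 : 0 <= rho by apply: le_trans (rn_ge0 _) (ltW (Om3 OX.1)).
  apply: (@weierstrass R V pS v X r (2 * rho)) => //.
    move=> n Y /HU OY; split; first exact: (pS_holo n OY.1).
    suff : rn (pS n Y) <= rho * (2 - 1 / 2 ^+ n).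
      move=> /le_trans; apply; rewrite mulrC; apply: ler_wpM2r => //.
      by have : 0 <= 1 / 2 ^+ n :> R; [rewrite divr_ge0 // exprn_ge0|lra].
    elim: n => [|n IH]; first by have := pv_small 0 OY; rewrite /= expr0 !divr1; lra.
    rewrite /=; apply: le_trans (rnD _ _) _; have := pv_small n.+1 OY => H.
    apply: le_trans (lerD IH H) _; rewrite exprS le_eqVlt; apply/orP; left; apply/eqP.
    by field; rewrite expf_neq0 // pnatr_eq0.
  move=> e e0; have [N HN] := pow_small (2 * rho) e0; exists N => n Nn Y /HU OY.
  have [_ H] := Hv Y OY; apply: le_trans (H n) _; apply: le_trans _ (ltW HN).
  apply: ler_wpM2l; first by rewrite mulr_ge0.
  by rewrite lef_pV2 ?posrE ?exprn_gt0 // ler_weXn2l // ler1n.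
exists v; split.
- by move=> X /W[].
- move=> X OX; have [_ cw] := W X OX.
  have c2 : cvS (fun n => dd (pS n.+1) X e2) (dd v X e2).
    by move=> e /(cw e2)[N HN]; exists N => n Nn; apply: HN; rewrite ltnW.
  have cz : @cvS R C (fun=> 0) 0.
    by move=> e e0; exists 0%N => n _; rewrite subrr rn0 ltW.
  have c3 := cvS_lin (- B X) (cw e3) cz.
  have := cvS_unique c2; move=> /(_ (- B X *: dd v X e3 + 0)) -> //.
    by rewrite addr0 /GRing.scale /= mulNr addrC subrr.
  move: c3; congr cvS; apply/funext => n; rewrite (pS_rec n OX.1) addr0 //.
move=> X OX l2X; have [c1 _] := Hv X OX; apply: cvS_unique c1 _ => e e0.
exists 0%N => n _; suff -> : pS n X = l3 X by rewrite subrr rn0 ltW.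
by elim: n => [//|n IH] /=; rewrite IH /prim l2X mul0r oppr0 addr0.
Qed.
End PDE.

Transparent rn.

(** * Row-vector-valued maps and the chain rule *)

Section Vec.
Context {R : realType}.
Local Notation C := (Cplx R).

Lemma rn_entry m n (M : 'M[C]_(m, n)) i j : rn (M i j) <= rn M.
Proof.
rewrite -toC_le -!normE.
change (`|M (i, j).1 (i, j).2| <= mx_norm M); rewrite mx_normE.
rewrite -[leLHS]nngE num_le.
exact: (le_bigmax _ (fun ij : 'I_m * 'I_n => `|M ij.1 ij.2|%:nng) (i, j)).
Qed.

Lemma rn_mx_le m n (M : 'M[C]_(m, n)) (b : R) : 0 <= b ->
  (forall i j, rn (M i j) <= b) -> rn M <= b.
Proof.
move=> b0 H; have [->|M0] := eqVneq (rn M) 0; first by [].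
have : mx_norm M != 0.
  by apply: contraNneq M0 => /mx_norm_eq0 ->; rewrite rn0.
move=> /mx_norm_neq0 [ij E].
suff -> : rn M = rn (M ij.1 ij.2) by [].
by rewrite /rn [X in rRe X]E.
Qed.

Definition DV (V : normedModType C) n (F : V -> 'rV[C]_n) (x v : V) : 'rV[C]_n :=
  \row_i dd (fun X => F X 0 i) x v.

Lemma hasD_row (V : normedModType C) n (F : V -> 'rV[C]_n) x :
  (forall i, differentiable (fun X => F X 0 i) x) -> hasD F x (DV F x).
Proof.
move=> H; have D i := dd_hasD (H i); split.
- by move=> a u v; apply/rowP => i; rewrite !mxE ddP.
- have ex i : exists Mi : R, forall v, rn (dd (fun X => F X 0 i) x v) <= Mi * rn v.
    by have [_ ?] := D i.
  have [M HM] := choice ex; exists (\sum_i `|M i|) => v; apply: rn_mx_le.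
    by rewrite mulr_ge0 ?rn_ge0 // sumr_ge0.
  move=> i j; rewrite mxE; apply: le_trans (HM j v) _; apply: ler_wpM2r; first exact: rn_ge0.
  apply: le_trans (ler_norm _) _; rewrite (bigD1 j) //= lerDl sumr_ge0 //.
move=> e e0.
have ex i : exists di : R, 0 < di /\ forall h, rn h < di ->
    rn (F (x + h) 0 i - F x 0 i - dd (fun X => F X 0 i) x h) <= e * rn h.
  by have [_ _ /(_ e e0) [d d0 ?]] := D i; exists d.
have [d Hd] := choice ex; exists (\big[Num.min/1]_i d i).
  by apply: lt_bigmin => // i _; have [] := Hd i.
move=> h hd; apply: rn_mx_le; first by rewrite mulr_ge0 ?rn_ge0 // ltW.
move=> i j; rewrite (ord1 i) !mxE; apply: (Hd j).2; apply: lt_le_trans hd _.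
exact: bigmin_le.
Qed.

Lemma differentiable_row (V : normedModType C) n (F : V -> 'rV[C]_n) x :
  (forall i, differentiable (fun X => F X 0 i) x) -> differentiable F x.
Proof. by move=> /hasD_row /hasD_differentiable[]. Qed.

Lemma differentiable_entry (V : normedModType C) m n (F : V -> 'M[C]_(m, n)) x i j :
  differentiable F x -> differentiable (fun X => F X i j) x.
Proof.
move=> dF; apply: (@differentiable_comp _ _ _ _ F (fun M : 'M[C]_(m, n) => M i j)) => //.
exact: differentiable_coord.
Qed.

Lemma dd_chain (V : normedModType C) n (g : 'rV[C]_n -> C) (F : V -> 'rV[C]_n) x :
  (forall i, differentiable (fun X => F X 0 i) x) -> differentiable g (F x) ->
  differentiable (fun X => g (F X)) x /\
  forall v, dd (fun X => g (F X)) x v = dd g (F x) (DV F x v).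
Proof.
move=> dF dg; have [dF' EF] := hasD_differentiable (hasD_row dF).
split; first exact: (@differentiable_comp _ _ _ _ F g).
move=> v; rewrite !ddE -EF.
exact: (congr1 (@^~ v) (diff_comp dF' dg)).
Qed.

End Vec.

(** * Inverse function theorem for perturbations of the identity *)

Section IFT.
Context {R : realType} {n : nat}.
Local Notation C := (Cplx R).
Local Notation V := 'rV[C]_n.
Variables (E : V -> V) (U : set V).
Hypothesis oU : open U.
Hypothesis U0 : U 0.
Hypothesis hE : forall i, holo U (fun X => E X 0 i).
Hypothesis E0 : E 0 = 0.
Hypothesis dE0 : forall i v, dd (fun X => E X 0 i) 0 v = 0.

(** By [holb_dlip] the derivative, zero at 0, is at most 1/4 nearby; the mean value inequality
    doubles this to 1/2. *)
Lemma small_derivative_contracting : exists r : R, [/\ 0 < r, forall X, rn X < r -> U X &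
  forall X X', rn X < r -> rn X' < r -> rn (E X - E X') <= 2^-1 * rn (X - X')].
Proof.
have ex i : exists r : R, 0 < r /\ forall X X', rn X < r -> rn X' < r ->
    U X /\ rn (E X 0 i - E X' 0 i) <= 2^-1 * rn (X - X').
  have [r [M [r0 H HU]]] := holo_holb oU (hE i) U0.
  have [K K0 KE] : exists2 K : R, 0 <= K & K = 1024 * M / r ^+ 2.
    exists (1024 * M / r ^+ 2); last by [].
    by apply: divr_ge0; [apply: mulr_ge0; [exact: ler0n|exact: holb_M r0 H]|exact: sqr_ge0].
  exists (Num.min (r / 4) (4 * (K + 1))^-1); split.
    by rewrite lt_min divr_gt0 // invr_gt0 mulr_gt0 // ltr_wpDl.
  move=> X X'; rewrite !lt_min => /andP[X1 X2] /andP[X'1 X'2]; split.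
    by apply: HU; rewrite subr0; lra.
  rewrite rnC; rewrite (_ : 2^-1 * _ = 2 * (4^-1 * rn (X' - X))); last first.
    by rewrite rnC; field.
  have sb (s : R) : 0 <= s <= 1 -> rn (X + toC s *: (X' - X)) < Num.min (r / 4) (4 * (K + 1))^-1.
    move=> s01; rewrite -[X + _]subr0; apply: seg_ball => //; rewrite subr0 lt_min.
      by rewrite X1.
    by rewrite X'1.
  have d1 (s : R) : 0 <= s <= 1 -> differentiable (fun X0 => E X0 0 i) (X + toC s *: (X' - X)).
    move=> /sb; rewrite lt_min => /andP[h _]; apply: (H _ _).1; rewrite subr0; lra.
  rewrite -rnN opprB.
  apply: (@mean_value_dd R V (fun X0 => E X0 0 i) X X') => // s s01.
  have := sb s s01; rewrite lt_min => /andP[h1 h2].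
  have h1' : rn (X + toC s *: (X' - X) - 0) < r / 4 by rewrite subr0.
  have := holb_dlip (X' - X) r0 H h1'; rewrite dE0 !subr0 -KE => /le_trans; apply.
  apply: ler_wpM2r; first exact: rn_ge0.
  apply: (@le_trans _ _ (K * (4 * (K + 1))^-1)); first by apply: ler_wpM2l => //; exact: ltW.
  rewrite invfM mulrCA ler_piMr ?invr_ge0 // ler_pdivrMr ?ltr_wpDl // mul1r lerDl //.
have [r Hr] := choice ex.
(* The minimum starts from the radius of a ball inside [U], so that the inclusion in [U] does not
   rest on the components. *)
exists (\big[Num.min/(xget 1 [set r0 | 0 < r0 /\ forall X, rn X < r0 -> U X])]_i r i).
have [u0 uU] : [set r0 : R | 0 < r0 /\ forall X, rn X < r0 -> U X]
    (xget 1 [set r0 | 0 < r0 /\ forall X, rn X < r0 -> U X]).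
  apply: xgetPex; have [r0 [r00 H]] := open_ball oU U0.
  by exists r0; split => // X Xr; apply: H; rewrite subr0.
split; first by apply: lt_bigmin => // i _; have [] := Hr i.
  by move=> X Xr; apply: uU; apply: lt_le_trans Xr _; exact: bigmin_le_id.
move=> X X' h h'; apply: rn_mx_le; first by rewrite mulr_ge0 ?rn_ge0 // invr_ge0.
move=> j i; rewrite (ord1 j) !mxE; apply: ((Hr i).2 X X' _ _).2.
  by apply: lt_le_trans h _; exact: bigmin_le.
by apply: lt_le_trans h' _; exact: bigmin_le.
Qed.

Fixpoint ift_it (k : nat) (Y : V) : V := if k is m.+1 then Y + E (ift_it m Y) else 0.

(** The equation X - E X = Y is solved by iterating X -> Y + E X, which contracts with ratio 1/2, so
    |X| <= 2 |Y|. The iterates are holomorphic in Y and converge uniformly, so [weierstrass] makes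
    the inverse holomorphic. *)
Lemma inverse_function : exists (r : R) (H : V -> V), [/\ 0 < r, forall X, rn X < r -> U X,
  forall Y, rn Y < r / 2 -> rn (H Y) < r /\ H Y - E (H Y) = Y,
  forall Y i, rn Y < r / 2 -> differentiable (fun Y => H Y 0 i) Y &
  forall X X', rn X < r -> rn X' < r -> X - E X = X' - E X' -> X = X'].
Proof.
have [r [r0 rU ct]] := small_derivative_contracting.
have r00 : rn (0 : V) < r by rewrite rn0.
have half X : rn X < r -> rn (E X) <= 2^-1 * rn X.
  by move=> Xr; have := ct X 0 Xr r00; rewrite E0 !subr0.
have itb k Y : rn Y < r / 2 -> rn (ift_it k Y) <= 2 * rn Y.
  move=> Yr; elim: k => [|k IH] /=; first by rewrite rn0 mulr_ge0 ?rn_ge0.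
  apply: le_trans (rnD _ _) _; have := half (ift_it k Y) (ltac:(lra)); lra.
have itr k Y : rn Y < r / 2 -> rn (ift_it k Y) < r by move=> Yr; have := itb k Y Yr; lra.
have itg k Y : rn Y < r / 2 -> rn (ift_it k.+1 Y - ift_it k Y) <= rn Y / 2 ^+ k.
  move=> Yr; elim: k => [|k IH]; first by rewrite /= E0 addr0 subr0 expr0 divr1.
  have -> : ift_it k.+2 Y - ift_it k.+1 Y = E (ift_it k.+1 Y) - E (ift_it k Y).
    by rewrite /= opprD addrACA subrr add0r.
  apply: le_trans (ct _ _ (itr _ _ Yr) (itr _ _ Yr)) _.
  rewrite exprS invfM mulrCA; apply: ler_wpM2l; by rewrite ?invr_ge0.
have ex (Yi : V * 'I_n) : exists l : C, rn Yi.1 < r / 2 ->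
    forall k, rn (ift_it k Yi.1 0 Yi.2 - l) <= 2 * rn Yi.1 / 2 ^+ k.
  case: Yi => Y i /=; have [Yr|nY] := pselect (rn Y < r / 2); last by exists 0.
  have [|l [_ Hl]] := @geo_cvg R (fun k => ift_it k Y 0 i) (rn Y) (rn_ge0 Y).
    move=> k; apply: le_trans _ (itg k Y Yr).
    by have := rn_entry (ift_it k.+1 Y - ift_it k Y) 0 i; rewrite !mxE.
  by exists l.
have [h Hh] := choice ex.
pose H Y : V := \row_i h (Y, i).
have HH Y k : rn Y < r / 2 -> rn (ift_it k Y - H Y) <= 2 * rn Y / 2 ^+ k.
  move=> Yr; apply: rn_mx_le; first by rewrite !mulr_ge0 ?rn_ge0 // invr_ge0 exprn_ge0.
  by move=> j i; rewrite (ord1 j) !mxE; exact: (Hh (Y, i) Yr k).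
have HY Y : rn Y < r / 2 -> rn (H Y) < r.
  move=> Yr; apply: (@le_lt_trans _ _ (2 * rn Y)); last by lra.
  apply/ler_addgt0Pr => e e0; have [k hk] := pow_small (2 * rn Y) e0.
  have := rnBB (H Y) (ift_it k Y); rewrite rnC; have := HH Y k Yr; have := itb k Y Yr; lra.
exists r, H; split => //.
- move=> Y Yr; split; first exact: HY.
  apply/eqP; rewrite -subr_eq0 -rn_eq0 eq_le rn_ge0 andbT; apply/ler_addgt0Pr => e e0.
  have e2 : 0 < e / 2 by lra.
  have [k hk] := pow_small (2 * rn Y) e2.
  have hk1 : 2 * rn Y / 2 ^+ k.+1 <= e / 2.
    apply: le_trans _ (ltW hk); apply: ler_wpM2l; first by rewrite mulr_ge0 ?rn_ge0.
    by rewrite lef_pV2 ?posrE ?exprn_gt0 // exprS ler_peMl ?exprn_ge0 // ler1n.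
  have -> : H Y - E (H Y) - Y = (H Y - ift_it k.+1 Y) + (E (ift_it k Y) - E (H Y)).
    rewrite [ift_it k.+1 Y]/(Y + E (ift_it k Y)).
    by apply/rowP => i; rewrite !mxE; ring.
  apply: le_trans (rnD _ _) _; rewrite add0r [rn (H Y - _)]rnC.
  have := ct _ _ (itr k Y Yr) (HY Y Yr); have := HH Y k Yr; have := HH Y k.+1 Yr; lra.
- move=> Y i Yr.
  have q0 : 0 < r / 2 - rn Y by lra.
  have inb Z : rn (Z - Y) < r / 2 - rn Y -> rn Z < r / 2.
    by move=> ZY; have := rn_tri Y Z 0; rewrite !subr0; lra.
  have dk k Z j : rn Z < r / 2 -> differentiable (fun Z => ift_it k Z 0 j) Z.
    elim: k Z j => [|k IH] Z j Zr.
      by rewrite (_ : (fun _ => _) = cst 0) //; apply/funext => ? /=; rewrite mxE.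
    have -> : (fun Z0 : V => ift_it k.+1 Z0 0 j) = (fun Z0 : V => Z0 0 j + E (ift_it k Z0) 0 j).
      by apply/funext => Z0; rewrite /= mxE.
    apply: differentiableD; first exact: differentiable_coord.
    have [] := @dd_chain R V n (fun X => E X 0 j) (ift_it k) Z => //.
      by move=> i'; apply: IH.
    by apply: hE; apply: rU; exact: itr.
  have [] := @weierstrass R V (fun k Z => ift_it k Z 0 i) (fun Z => H Z 0 i) Y (r / 2 - rn Y) r q0 => //.
    move=> k Z /inb Zr; split; first exact: dk.
    by apply: le_trans (rn_entry _ _ _) (ltW (itr k Z Zr)).
  move=> e e0; have [N HN] := pow_small r e0; exists N => k Nk Z /inb Zr.
  have := rn_entry (ift_it k Z - H Z) 0 i; rewrite !mxE => /le_trans; apply.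
  apply: le_trans (HH Z k Zr) _; apply: le_trans _ (ltW HN).
  apply: ler_pM; rewrite ?mulr_ge0 ?rn_ge0 ?invr_ge0 ?exprn_ge0 //; first by lra.
  by rewrite lef_pV2 ?posrE ?exprn_gt0 // ler_weXn2l // ler1n.
move=> X X' Xr X'r EE; apply/eqP; rewrite -subr_eq0 -rn_eq0.
have : X - X' = E X - E X'.
  apply/rowP => i; have := congr1 (fun M : V => M 0 i) EE; rewrite !mxE => e.
  have eX : X 0 i = X' 0 i - E X' 0 i + E X 0 i by rewrite -e subrK.
  by rewrite eX; ring.
move=> D; have := ct X X' Xr X'r; rewrite -D.
have := rn_ge0 (X - X'); rewrite eq_le; lra.
Qed.
End IFT.

Definition o0 : 'I_3 := @Ordinal 3 0 isT.
Definition o1 : 'I_3 := @Ordinal 3 1 isT.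
Definition o2 : 'I_3 := @Ordinal 3 2 isT.

Section Row3.
Context {R : realType}.
Local Notation C := (Cplx R).

Lemma ord3P (P : 'I_3 -> Prop) : P o0 -> P o1 -> P o2 -> forall i, P i.
Proof.
move=> P0 P1 P2 [[|[|[|i]]] ip] //.
- by rewrite (_ : Ordinal ip = o0) //; apply: val_inj.
- by rewrite (_ : Ordinal ip = o1) //; apply: val_inj.
- by rewrite (_ : Ordinal ip = o2) //; apply: val_inj.
Qed.

Lemma sum3 (F : 'I_3 -> C) : \sum_(i < 3) F i = F o0 + F o1 + F o2.
Proof.
rewrite !big_ord_recl big_ord0 addr0 addrA; congr (_ + _ + _); congr F; exact: val_inj.
Qed.

Definition row3 (x y z : C) : C3 R :=
  \row_i (if val i == 0%N then x else if val i == 1%N then y else z).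
Lemma row3_0 x y z : row3 x y z 0 o0 = x. Proof. by rewrite mxE. Qed.
Lemma row3_1 x y z : row3 x y z 0 o1 = y. Proof. by rewrite mxE. Qed.
Lemma row3_2 x y z : row3 x y z 0 o2 = z. Proof. by rewrite mxE. Qed.
Definition row3E := (row3_0, row3_1, row3_2).
Lemma row3_eta (m : C3 R) : row3 (m 0 o0) (m 0 o1) (m 0 o2) = m.
Proof. by apply/rowP; apply: ord3P; rewrite row3E. Qed.

Lemma dd_local (V : normedModType C) (f g : V -> C) (U : set V) x : open U -> U x ->
  (forall y, U y -> f y = g y) -> differentiable g x ->
  differentiable f x /\ forall v, dd f x v = dd g x v.
Proof.
move=> oU Ux E /dd_hasD [L M D]; apply: hasD_dd; split => // e e0.
have [r [r0 HU]] := open_ball oU Ux; have [d d0 {}D] := D e e0.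
exists (Num.min r d); first by rewrite lt_min r0.
move=> h; rewrite lt_min => /andP[hr /D]; rewrite !E //.
by apply: HU; rewrite addrAC subrr add0r.
Qed.

Lemma dd_Z (V : normedModType C) (f : V -> C) x v (c : C) : differentiable f x ->
  differentiable (fun y => c * f y) x /\ dd (fun y => c * f y) x v = c * dd f x v.
Proof.
move=> df; have dc : differentiable (fun _ : V => c) x by exact: differentiable_cst.
split; first exact: differentiableM.
by rewrite (dd_mul v dc df) [dd (fun _ : V => c) x v]ddE diff_cst mulr0 addr0.
Qed.

End Row3.

(** * Contact coordinates in an adapted frame *)

Section Darboux.
Context {R : realType}.
Local Notation C := (Cplx R).
Local Notation V := (C3 R).
Variables (e1 e2 e3 : V) (l1 l2 l3 : V -> C) (A B : V -> C) (U : set V).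
Hypothesis lin1 : forall (a : C) u v, l1 (a *: u + v) = a * l1 u + l1 v.
Hypothesis lin2 : forall (a : C) u v, l2 (a *: u + v) = a * l2 u + l2 v.
Hypothesis lin3 : forall (a : C) u v, l3 (a *: u + v) = a * l3 u + l3 v.
Hypothesis bd1 : exists M, forall v, rn (l1 v) <= M * rn v.
Hypothesis bd2 : exists M, forall v, rn (l2 v) <= M * rn v.
Hypothesis bd3 : exists M, forall v, rn (l3 v) <= M * rn v.
Hypothesis (l11 : l1 e1 = 1) (l12 : l1 e2 = 0) (l13 : l1 e3 = 0).
Hypothesis (l21 : l2 e1 = 0) (l22 : l2 e2 = 1) (l23 : l2 e3 = 0).
Hypothesis (l31 : l3 e1 = 0) (l32 : l3 e2 = 0) (l33 : l3 e3 = 1).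
Hypothesis dec : forall X, X = l1 X *: e1 + l2 X *: e2 + l3 X *: e3.
Hypothesis (oU : open U) (U0 : U 0) (hA : holo U A) (hB : holo U B).
Hypothesis (A0 : A 0 = 0) (B0 : B 0 = 0).
Hypothesis kap : dd A 0 e2 - dd B 0 e1 != 0.

Lemma lin_open (l : V -> C) (rho : R) :
  (forall (a : C) u v, l (a *: u + v) = a * l u + l v) ->
  (exists M, forall v, rn (l v) <= M * rn v) -> open [set X | rn (l X) < rho].
Proof.
move=> lin bd; apply/rn_open => X /= lX.
have g0 : 0 < rho - rn (l X) by lra.
have [d d0 H] := differentiable_cont (differentiable_linear lin bd X).1 g0.
by exists d; split => // Y /H; have := rnBB (l Y) (l X); lra.
Qed.

(** A polydisc in the frame coordinates, inside a ball where [B] is bounded, has the shape required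
    by [transport_solution]. *)
Lemma first_integral : exists (O : set V) (v : V -> C), [/\ open O, O 0, O `<=` U, holo O v &
  (forall X, O X -> dd v X e2 + B X * dd v X e3 = 0) /\
  (forall X, O X -> l2 X = 0 -> v X = l3 X)].
Proof.
have [r [M [r0 H HU]]] := holo_holb oU hB U0; have M0 := holb_M r0 H.
pose S := rn e1 + rn e2 + rn e3 + 1.
have S0 : 0 < S by rewrite ltr_wpDl // !addr_ge0 // rn_ge0.
pose rho := r / S; have rho0 : 0 < rho by rewrite divr_gt0.
pose Om : set V := [set X | rn (l1 X) < rho] `&` [set X | rn (l2 X) < rho] `&` [set X | rn (l3 X) < rho].
have OmB X : Om X -> rn (X - 0) < r.
  move=> [[/= h1 h2] h3]; rewrite subr0 (dec X).
  apply: le_lt_trans (rnD _ _) _; apply: le_lt_trans (lerD (rnD _ _) (lexx _)) _; rewrite !rnZ.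
  have rS : rho * S = r by rewrite /rho divfK // gt_eqF.
  have := ler_wpM2r (rn_ge0 e1) (ltW h1); have := ler_wpM2r (rn_ge0 e2) (ltW h2).
  have := ler_wpM2r (rn_ge0 e3) (ltW h3); rewrite -rS /S; lra.
have [z1 D1 Z1] := lin_facts lin1; have [z2 D2 Z2] := lin_facts lin2.
have [z3 D3 Z3] := lin_facts lin3.
have oOm : open Om by apply: openI; [apply: openI|]; exact: lin_open.
have sOm : star l2 e2 Om.
  move=> X [[/= h1 h2] h3] s s01; split; [split|]; rewrite /= /slide -scaleNr.
  - by rewrite D1 Z1 l12 mulr0 addr0.
  - have -> : l2 (X + - (toC (1 - s) * l2 X) *: e2) = toC s * l2 X.
      by rewrite D2 Z2 l22 toCB toC1; ring.
    rewrite rnM rn_toC ger0_norm ?(andP s01).1 //; apply: le_lt_trans h2.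
    by rewrite ler_piMl ?rn_ge0 // (andP s01).2.
  - by rewrite D3 Z3 l32 mulr0 addr0.
have Om3 X : Om X -> rn (l3 X) < rho by case.
have Omt X t : Om X -> rn (l3 X + t) < rho -> Om (X + t *: e3).
  move=> [[/= h1 h2] h3] h; split; [split|]; rewrite /=.
  - by rewrite D1 Z1 l13 mulr0 addr0.
  - by rewrite D2 Z2 l23 mulr0 addr0.
  - by rewrite D3 Z3 l33 mulr1.
have hBO : holo Om B by move=> X /OmB /HU /hB.
have bB X : Om X -> rn (B X) <= M by move=> /OmB /H [].
have [v [hv v1 v2]] := transport_solution lin2 bd2 lin3 bd3 l22 l32 l23 l33 oOm sOm Om3 Omt hBO bB M0.
exists (Om' l2 l3 Om rho M), v; split => //.
- exact: open_Om'.
- split; first by split; [split|]; rewrite /= ?z1 ?z2 ?z3 rn0.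
  by rewrite z2 z3 rn0 mulr0 addr0.
- by move=> X [/OmB /HU].
Qed.

Lemma dd_lim (f : V -> C) x v (c : C) : differentiable f x ->
  (exists N, forall n, (N <= n)%N -> toC n.+1%:R * (f (x + toC n.+1%:R^-1 *: v) - f x) = c) ->
  dd f x v = c.
Proof.
move=> df [N HN]; apply: cvS_unique (cvS_quot v df) _ => e e0.
by exists N => n /HN ->; rewrite subrr rn0 ltW.
Qed.

(** Write x, y, z for the directions e1, e2, e3. As v_y = - B v_z, one has v_z (l3 - A l1 - B l2) =
    dv - p l1 with p = v_x + A v_z, so (l1, p, v) are contact coordinates. They are independent at 0
    because p_y = A_y - B_x there, which is nonzero by [kap]. *)
Lemma darboux_of_frame : exists (Th Ps : V -> V) (O : set V) (d : R),
  [/\ 0 < d, open O, O 0 & O `<=` U] /\ (Th 0 = 0 /\ Ps 0 = 0) /\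
  [/\ forall X i, O X -> differentiable (fun X => Th X 0 i) X,
      forall m, rn m < d -> O (Ps m) /\ Th (Ps m) = m,
      forall m i, rn m < d -> differentiable (fun m => Ps m 0 i) m,
      forall X X', O X -> O X' -> Th X = Th X' -> X = X' &
      forall X u, O X -> dd (fun X => Th X 0 o2) X u = Th X 0 o1 * dd (fun X => Th X 0 o0) X u ->
        l3 u = l1 u * A X + l2 u * B X].
Proof.
have [ O [v [oO O0 OU hv [v1 v2]]]] := first_integral.
have [z1 D1 Z1] := lin_facts lin1; have [z2 D2 Z2] := lin_facts lin2.
have [z3 D3 Z3] := lin_facts lin3.
have hvd w : holo O (fun X => dd v X w) by exact: holo_dd.
have hAO : holo O A by move=> X /OU /hA.
have hBO : holo O B by move=> X /OU /hB.
pose p X := dd v X e1 + A X * dd v X e3.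
have hp : holo O p.
  by move=> X OX; apply: differentiableD; [exact: hvd|apply: differentiableM; [exact: hAO|exact: hvd]].
have v0 : v 0 = 0 by rewrite v2 // z3.
have small w : exists N, forall n, (N <= n)%N -> O (0 + toC n.+1%:R^-1 *: w).
  have [r [r0 HU]] := open_ball oO O0; have r2 : 0 < r / 2 by lra.
  have [N HN] := cvS_inv (rn_ge0 w) r2; exists N => n /HN h; apply: HU.
  rewrite subr0 add0r rnZ rn_toC ger0_norm ?invr_ge0 // [_ * rn w]mulrC.
  by move: h; set Q := _ / _; lra.
(* On the plane l2 = 0 the function v coincides with l3, so its difference quotients at 0 are
   eventually constant. *)
have vl w : l2 w = 0 -> dd v 0 w = l3 w.
  move=> w2; apply: dd_lim; first exact: hv.
  have [N HN] := small w; exists N => n /HN On.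
  rewrite v2 //; last by rewrite add0r Z2 w2 mulr0.
  by rewrite v0 subr0 add0r Z3 mulrA -toCM mulfV ?mul1r // pnatr_eq0.
have ve1 : dd v 0 e1 = 0 by rewrite vl.
have ve3 : dd v 0 e3 = 1 by rewrite vl.
have ve2 : dd v 0 e2 = 0 by have := v1 0 O0; rewrite B0 mul0r addr0.
have vall w : dd v 0 w = l3 w.
  by rewrite {1}(dec w) !ddD !ddZ ve1 ve2 ve3 mulr0 mulr0 mulr1 !add0r.
have p0 : p 0 = 0 by rewrite /p ve1 A0 mul0r addr0.
pose k := dd A 0 e2 - dd B 0 e1.
(* By symmetry v_xy is the x-derivative of v_y = - B v_z, which equals - B_x at 0, where B = 0 and
   v_z = 1. *)
have pe2 : dd p 0 e2 = k.
  have d1 := hvd e1 0 O0; have d3 := hvd e3 0 O0.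
  have dA3 : differentiable (fun X => A X * dd v X e3) 0 by apply: differentiableM => //; exact: hAO.
  rewrite /p (dd_add e2 d1 dA3) (dd_mul e2 (hAO 0 O0) d3) A0 ve3 mul0r add0r mul1r.
  rewrite (dd_comm _ _ oO hv O0).
  have dB3 : differentiable (fun X => B X * dd v X e3) 0 by apply: differentiableM => //; exact: hBO.
  have [dm Em] := dd_Z e1 (-1) dB3.
  have vE y : O y -> dd v y e2 = -1 * (B y * dd v y e3).
    by move=> Oy; rewrite mulN1r; apply/eqP; rewrite -addr_eq0 v1.
  have [_ ->] := @dd_local R V (fun y => dd v y e2) (fun y => -1 * (B y * dd v y e3)) O 0 oO O0 vE dm.
  by rewrite Em (dd_mul e1 (hBO 0 O0) d3) B0 ve3 /k; ring.
pose p1 := dd p 0 e1; pose p3 := dd p 0 e3.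
have pall w : dd p 0 w = p1 * l1 w + k * l2 w + p3 * l3 w.
  by rewrite {1}(dec w) !ddD !ddZ pe2 /p1 /p3; ring.
have k0 : k != 0 by exact: kap.
have dl1 := differentiable_linear lin1 bd1; have dl2 := differentiable_linear lin2 bd2.
have dl3 := differentiable_linear lin3 bd3.
(* The function p, freed of its derivatives along e1 and e3 and rescaled: (l1, q, v) then agrees
   with the frame coordinates to first order at 0, as [inverse_function] requires. *)
pose q X := k^-1 * (p X - (p1 * l1 X + p3 * v X)).
have hq X : O X -> differentiable q X /\ forall w, dd q X w = k^-1 * (dd p X w - (p1 * dd l1 X w + p3 * dd v X w)).
  move=> OX; have [a1 _] := dd_Z 0 p1 (dl1 X).1; have [a3 _] := dd_Z 0 p3 (hv X OX).
  have a13 : differentiable (fun X => p1 * l1 X + p3 * v X) X by exact: differentiableD.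
  have ap : differentiable (fun X => p X - (p1 * l1 X + p3 * v X)) X by exact: (differentiableB (hp X OX) a13).
  split; first by have [] := dd_Z 0 k^-1 ap.
  move=> w; have [_ E] := dd_Z w k^-1 ap; rewrite /q E (dd_sub w (hp X OX) a13) (dd_add w a1 a3).
  by have [_ ->] := dd_Z w p1 (dl1 X).1; have [_ ->] := dd_Z w p3 (hv X OX).
pose E X : V := (l2 X - q X) *: e2 + (l3 X - v X) *: e3.
have hE X i : O X -> differentiable (fun X => E X 0 i) X /\
   forall w, dd (fun X => E X 0 i) X w = e2 0 i * (dd l2 X w - dd q X w) + e3 0 i * (dd l3 X w - dd v X w).
  move=> OX; have [dq _] := hq X OX.
  have a2 : differentiable (fun X => l2 X - q X) X by apply: differentiableB => //; exact: (dl2 X).1.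
  have a3 : differentiable (fun X => l3 X - v X) X by apply: differentiableB; [exact: (dl3 X).1|exact: hv].
  have EE : (fun X => E X 0 i) = (fun X => e2 0 i * (l2 X - q X) + e3 0 i * (l3 X - v X)).
    by apply/funext => Y; rewrite !mxE; ring.
  have [b2 _] := dd_Z 0 (e2 0 i) a2; have [b3 _] := dd_Z 0 (e3 0 i) a3.
  rewrite EE; split; first exact: differentiableD.
  move=> w; rewrite (dd_add w b2 b3).
  have [_ ->] := dd_Z w (e2 0 i) a2; have [_ ->] := dd_Z w (e3 0 i) a3.
  by rewrite (dd_sub w (dl2 X).1 dq) (dd_sub w (dl3 X).1 (hv X OX)).
have q0 : q 0 = 0 by rewrite /q p0 v0 z1 !mulr0 addr0 subrr mulr0.
have E0 : E 0 = 0 by rewrite /E z2 z3 q0 v0 !subrr !scale0r addr0.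
have dE0 i w : dd (fun X => E X 0 i) 0 w = 0.
  have [_ ->] := hE 0 i O0; have [_ ->] := hq 0 O0.
  rewrite (dl2 0).2 (dl1 0).2 (dl3 0).2 vall pall subrr mulr0 addr0.
  have -> : l2 w - k^-1 * (p1 * l1 w + k * l2 w + p3 * l3 w - (p1 * l1 w + p3 * l3 w)) = 0.
    by field.
  by rewrite mulr0.
(* The last conclusion divides by v_z, which must therefore not vanish. *)
pose O1 : set V := [set X | O X /\ dd v X e3 != 0].
have oO1 : open O1.
  apply/rn_open => X [OX n3]; have [r [r0 HU]] := open_ball oO OX.
  have n30 : 0 < rn (dd v X e3) by rewrite rn_gt0.
  have [dl dl0 Hd] := differentiable_cont (hvd e3 X OX) n30.
  exists (Num.min r dl); split; first by rewrite lt_min r0.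
  move=> Y; rewrite lt_min => /andP[/HU OY /Hd YX]; split => //.
  by apply: contraTneq YX => ->; rewrite sub0r rnN ltxx.
have O10 : O1 0 by split => //; rewrite ve3 oner_neq0.
have [r [H [r0 rO1 HH dH inj]]] := inverse_function oO1 O10 (fun i X OX => (hE X i OX.1).1) E0 dE0.
have rO X : rn X < r -> O X by move=> /rO1 [].
(* Linear change from (x, p, v) to (x, q, v) in the frame: T (Th X) = X - E X, so [Th] is inverted
   by T followed by the inverse H of X - E X. *)
pose T (m : V) : V := m 0 o0 *: e1 + (k^-1 * (m 0 o1 - (p1 * m 0 o0 + p3 * m 0 o2))) *: e2 + m 0 o2 *: e3.
have XE X : X - E X = l1 X *: e1 + q X *: e2 + v X *: e3.
  rewrite {1}(dec X) /E; apply/rowP => i; rewrite !mxE; ring.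
pose Th X := row3 (l1 X) (p X) (v X).
have TTh X : T (Th X) = X - E X by rewrite XE /T /Th !row3E.
pose tau := rn e1 + rn k^-1 * (1 + rn p1 + rn p3) * rn e2 + rn e3.
have tau0 : 0 <= tau by rewrite !addr_ge0 ?mulr_ge0 ?rn_ge0 // !addr_ge0 ?rn_ge0.
have Tb m : rn (T m) <= tau * rn m.
  have m0 := rn_entry m 0 o0; have m1 := rn_entry m 0 o1; have m2 := rn_entry m 0 o2.
  have mm := rn_ge0 m.
  apply: le_trans (rnD _ _) _; apply: le_trans (lerD (rnD _ _) (lexx _)) _; rewrite !rnZ ?rnM /tau !mulrDl.
  apply: lerD; last by rewrite [_ * rn m]mulrC; apply: ler_wpM2r => //; exact: rn_ge0.
  apply: lerD; first by rewrite [_ * rn m]mulrC; apply: ler_wpM2r => //; exact: rn_ge0.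
  rewrite [X in _ <= X]mulrAC; apply: ler_wpM2r; first exact: rn_ge0.
  rewrite -mulrA; apply: ler_wpM2l; first exact: rn_ge0.
  apply: le_trans (rnB _ _) _; rewrite !mulrDl mul1r -addrA; apply: lerD => //.
  apply: le_trans (rnD _ _) _; rewrite !rnM; apply: lerD; apply: ler_wpM2l => //; exact: rn_ge0.
pose Ps m := H (T m).
pose d := r / 2 / (tau + 1).
have d0 : 0 < d by rewrite divr_gt0 ?ltr_wpDl //; lra.
have Td m : rn m < d -> rn (T m) < r / 2.
  rewrite /d ltr_pdivlMr ?ltr_wpDl // => md; apply: le_lt_trans (Tb m) _.
  by apply: le_lt_trans md; rewrite mulrC; apply: ler_wpM2l; rewrite ?rn_ge0 // lerDl.
have TI m m' : T m = T m' -> m = m'.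
  move=> e; have E1 := congr1 l1 e; have E2 := congr1 l2 e; have E3 := congr1 l3 e.
  move: E1 E2 E3; rewrite /T !(D1, Z1, D2, Z2, D3, Z3) l11 l12 l13 l21 l22 l23 l31 l32 l33.
  rewrite !(mulr0, mulr1, addr0, add0r) => E1 E2 E3.
  have {}E2 := mulfI (invr_neq0 k0) E2; rewrite E1 E3 in E2.
  by rewrite -(row3_eta m) -(row3_eta m') E1 E3 (addIr _ E2).
have T0 : T 0 = 0 by rewrite /T !mxE !mulr0 addr0 subrr mulr0 !scale0r !addr0.
have ThPs m : rn m < d -> rn (Ps m) < r /\ Th (Ps m) = m.
  move=> /Td /HH [h1 h2]; split => //; apply: TI; rewrite TTh; exact: h2.
have rr0 : rn (0 : V) < r by rewrite rn0.
exists Th, Ps, [set X | rn X < r], d; split; [|split].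
- split => //.
  + apply/rn_open => X /= Xr; exists (r - rn X); split; first by lra.
    by move=> Y; have := rnBB Y X; lra.
  + by move=> X /rO /OU.
- split; first by rewrite /Th z1 p0 v0; apply/rowP; apply: ord3P; rewrite row3E mxE.
  have [h1 h2] := ThPs 0 (ltac:(by rewrite rn0)).
  apply: inj; [exact: h1|exact: rr0|]; rewrite -!TTh h2; congr T.
  by rewrite /Th z1 p0 v0; apply/rowP; apply: ord3P; rewrite row3E mxE.
have ThE0 : (fun X => Th X 0 o0) = l1 by apply/funext => X; rewrite row3E.
have ThE1 : (fun X => Th X 0 o1) = p by apply/funext => X; rewrite row3E.
have ThE2 : (fun X => Th X 0 o2) = v by apply/funext => X; rewrite row3E.
split.
- move=> X i /rO OX; move: i; apply: ord3P; rewrite ?ThE0 ?ThE1 ?ThE2.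
  + exact: (dl1 X).1.
  + exact: hp.
  + exact: hv.
- exact: ThPs.
- move=> m i /Td Tr.
  have dT j : differentiable (fun m => T m 0 j) m.
    have TL (a : C) u w : T (a *: u + w) 0 j = a * T u 0 j + T w 0 j.
      by rewrite !mxE; ring.
    have TB : exists M, forall w, rn (T w 0 j) <= M * rn w.
      by exists tau => w; apply: le_trans (rn_entry _ _ _) (Tb w).
    exact: (differentiable_linear TL TB m).1.
  by have [] := @dd_chain R V 3 (fun Y => H Y 0 i) T m dT (dH (T m) i Tr).
- move=> X X' Xr X'r e; apply: inj; [exact: Xr|exact: X'r|]; by rewrite -!TTh e.
move=> X u Xr; have OX := rO X Xr; have [_ v3] := rO1 X Xr; rewrite ThE0 ThE2 row3E (dl1 X).2 => Eu.
(* The value on u of l3 - A l1 - B l2; the hypothesis on u amounts to c v_z = 0. *)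
pose c := l3 u - l1 u * A X - l2 u * B X.
have vu : dd v X u = l1 u * p X + c * dd v X e3.
  rewrite {1}(dec u) !ddD !ddZ /p /c.
  have -> : dd v X e2 = - (B X * dd v X e3) by apply/eqP; rewrite -addr_eq0 v1.
  ring.
move: Eu; rewrite vu => /eqP; rewrite [p X * _]mulrC -subr_eq0 addrAC subrr add0r mulf_eq0 (negbTE v3) orbF.
move=> /eqP c0; have -> : l3 u = c + l1 u * A X + l2 u * B X by rewrite /c; ring.
by rewrite c0 add0r.
Qed.
End Darboux.

(** * From the contact form to an adapted frame *)

Section Eta.
Context {R : realType}.
Local Notation C := (Cplx R).
Local Notation V := (C3 R).

Lemma pairingE (a : C3dual R) (v : V) : pairing a v = v 0 o0 * a o0 0 + v 0 o1 * a o1 0 + v 0 o2 * a o2 0.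
Proof. by rewrite /pairing mxE sum3. Qed.

Lemma pairing_linl (v : V) (c : C) (a b : C3dual R) : pairing (c *: a + b) v = c * pairing a v + pairing b v.
Proof. by rewrite !pairingE !mxE; ring. Qed.
Lemma pairing_linr (a : C3dual R) (c : C) (u v : V) : pairing a (c *: u + v) = c * pairing a u + pairing a v.
Proof. by rewrite !pairingE !mxE; ring. Qed.
Lemma pairing_bd (a : C3dual R) (v : V) : rn (pairing a v) <= 3 * rn a * rn v.
Proof.
rewrite pairingE; apply: le_trans (rnD _ _) _; apply: le_trans (lerD (rnD _ _) (lexx _)) _.
have H i : rn (v 0 i * a i 0) <= rn a * rn v.
  by rewrite rnM mulrC; apply: ler_pM; rewrite ?rn_ge0 ?rn_entry.
have := H o0; have := H o1; have := H o2; lra.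
Qed.

Lemma hasD_pairing (eta : V -> C3dual R) x L (v : V) : hasD eta x L ->
  hasD (fun X => pairing (eta X) v) x (fun u => pairing (L u) v).
Proof.
move=> [Ll [M HM] D]; split.
- by move=> c a b; rewrite Ll pairing_linl.
- exists (3 * rn v * M) => u; apply: le_trans (pairing_bd _ _) _.
  rewrite [3 * rn v * M * rn u](_ : _ = 3 * (M * rn u) * rn v); last by ring.
  by apply: ler_wpM2r; rewrite ?rn_ge0 // ler_wpM2l.
move=> e e0; have c0 : 0 < 3 * rn v + 1 by rewrite ltr_wpDl // mulr_ge0 // rn_ge0.
have [d d0 {}D] := D (e / (3 * rn v + 1)) (divr_gt0 e0 c0).
exists d => // h /D {}D.
have -> : pairing (eta (x + h)) v - pairing (eta x) v - pairing (L h) v =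
   pairing (eta (x + h) - eta x - L h) v by rewrite !pairingE !mxE; ring.
apply: le_trans (pairing_bd _ _) _; rewrite mulrAC.
have v3 : 0 <= 3 * rn v by rewrite mulr_ge0 // rn_ge0.
apply: le_trans (ler_wpM2l v3 D) _; rewrite mulrA; apply: ler_wpM2r; first exact: rn_ge0.
by rewrite mulrCA ler_piMr ?ltW // ltr_pdivrMr // mul1r ltrDl.
Qed.

Lemma ext_derivE (eta : V -> C3dual R) x u v : differentiable eta x ->
  ext_deriv eta x u v = dd (fun X => pairing (eta X) v) x u - dd (fun X => pairing (eta X) u) x v.
Proof.
move=> de; have D := differentiable_hasD de; rewrite /ext_deriv !deriveE //.
have [_ ->] := hasD_dd (hasD_pairing v D); by have [_ ->] := hasD_dd (hasD_pairing u D).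
Qed.

(** In the application e1 and e2 span the kernel of l3 and D is the derivative of eta at 0: symmetry
    of D on this plane would annihilate the wedge of l3 with d eta, so the contact condition yields
    [kap]. *)
Lemma wedge_sym (W : Type) (l1 l2 l3 : W -> C) (D : W -> W -> C) (e1 e2 e3 : W) :
  D e1 e2 = D e2 e1 ->
  (forall u v, D u v = l1 u * (l1 v * D e1 e1 + l2 v * D e1 e2 + l3 v * D e1 e3) +
     l2 u * (l1 v * D e2 e1 + l2 v * D e2 e2 + l3 v * D e2 e3) +
     l3 u * (l1 v * D e3 e1 + l2 v * D e3 e2 + l3 v * D e3 e3)) ->
  forall u v w, l3 u * (D v w - D w v) + l3 v * (D w u - D u w) + l3 w * (D u v - D v u) = 0.
Proof.
move=> S12; rewrite S12; move: (D e1 e1) (D e1 e3) (D e2 e1) (D e2 e2) (D e2 e3) (D e3 e1) (D e3 e2) (D e3 e3).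
move=> d11 d13 d21 d22 d23 d31 d32 d33 E u v w; rewrite (E v w) (E w v) (E w u) (E u w) (E u v) (E v u); ring.
Qed.

Lemma dd_opp_quot (f g : V -> C) X : differentiable f X -> differentiable g X -> g X != 0 ->
  differentiable (fun X => -1 * (f X * (g X)^-1)) X /\
  (f X = 0 -> g X = 1 -> forall u, dd (fun X => -1 * (f X * (g X)^-1)) X u = - dd f X u).
Proof.
move=> df dg g0; have dV : differentiable (fun X => (g X)^-1) X by exact: differentiableV.
have dM := differentiableM df dV.
split; first by have [] := dd_Z 0 (-1) dM.
move=> f0 g1 u; have [_ E] := dd_Z u (-1) dM.
by rewrite E (dd_mul u df dV) f0 g1 invr1 mul0r add0r mul1r mulN1r.
Qed.

Lemma pairing_dec (a : C3dual R) (X e1 e2 e3 : V) (c1 c2 c3 : C) :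
  X = c1 *: e1 + c2 *: e2 + c3 *: e3 ->
  pairing a X = c1 * pairing a e1 + c2 * pairing a e2 + c3 * pairing a e3.
Proof. by move=> ->; rewrite !pairingE !mxE; ring. Qed.

(** Here e1 and e2 are the i-th and j-th basis vectors corrected to lie in the kernel of eta at 0,
    and e3 is normalised by eta (e3) = 1 at 0. Then eta = eta (e3) (l3 - A l1 - B l2) with A = - eta
    (e1) / eta (e3) and B = - eta (e2) / eta (e3), both zero at 0. The condition on sums says that
    (i, j, k) enumerates the three indices. *)
Lemma darboux_of_indices (V0 : set V) (eta : V -> C3dual R) (i j k : 'I_3) :
  (forall F : 'I_3 -> C, F o0 + F o1 + F o2 = F i + F j + F k) ->
  i != j -> i != k -> j != k -> eta 0 k 0 != 0 ->
  open V0 -> V0 0 -> holomorphic_on V0 eta -> contact_at eta (0 : V) ->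
  exists (Th Ps : V -> V) (O : set V) (d : R),
  [/\ 0 < d, open O, O 0 & O `<=` V0] /\ (Th 0 = 0 /\ Ps 0 = 0) /\
  [/\ forall X i, O X -> differentiable (fun X => Th X 0 i) X,
      forall m : V, rn m < d -> O (Ps m) /\ Th (Ps m) = m,
      forall (m : V) i, rn m < d -> differentiable (fun m => Ps m 0 i) m,
      forall X X' : V, O X -> O X' -> Th X = Th X' -> X = X' &
      forall m w : V, rn m < d -> w 0 o2 = m 0 o1 * w 0 o0 ->
        pairing (eta (Ps m)) (DV Ps m w) = 0].
Proof.
move=> S3 ij ik jk ak oV V00 heta ct.
have pE (a : C3dual R) (v : V) : pairing a v = v 0 i * a i 0 + v 0 j * a j 0 + v 0 k * a k 0.
  by rewrite pairingE (S3 (fun m => v 0 m * a m 0)).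
pose a := eta 0.
have [e3 e3E] : exists e3 : V, forall m, e3 0 m = (a k 0)^-1 * (k == m)%:R.
  by exists ((a k 0)^-1 *: delta_mx 0 k) => m; rewrite !mxE eqxx /= eq_sym.
have eE n : exists e : V, forall m, e 0 m = (n == m)%:R - a n 0 * e3 0 m.
  by exists (delta_mx 0 n - a n 0 *: e3) => m; rewrite !mxE eqxx /= [m == n]eq_sym.
have [e1 e1E] := eE i; have [e2 e2E] := eE j.
pose l1 (X : V) : C := X 0 i; pose l2 (X : V) : C := X 0 j.
pose l3 (X : V) : C := pairing a X.
have lin1 (c : C) u v : l1 (c *: u + v) = c * l1 u + l1 v by rewrite /l1 !mxE.
have lin2 (c : C) u v : l2 (c *: u + v) = c * l2 u + l2 v by rewrite /l2 !mxE.
have lin3 (c : C) u v : l3 (c *: u + v) = c * l3 u + l3 v by exact: pairing_linr.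
have bd1 : exists M, forall v, rn (l1 v) <= M * rn v by exists 1 => v; rewrite mul1r rn_entry.
have bd2 : exists M, forall v, rn (l2 v) <= M * rn v by exists 1 => v; rewrite mul1r rn_entry.
have bd3 : exists M, forall v, rn (l3 v) <= M * rn v by exists (3 * rn a) => v; exact: pairing_bd.
have ji : (j == i) = false by rewrite eq_sym (negbTE ij).
have ki : (k == i) = false by rewrite eq_sym (negbTE ik).
have kj : (k == j) = false by rewrite eq_sym (negbTE jk).
have ee := (eqxx, negbTE ij, negbTE ik, negbTE jk, ji, ki, kj).
have l11 : l1 e1 = 1 by rewrite /l1 e1E e3E !ee /=; ring.
have l12 : l1 e2 = 0 by rewrite /l1 e2E e3E !ee /=; ring.
have l13 : l1 e3 = 0 by rewrite /l1 e3E !ee /=; ring.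
have l21 : l2 e1 = 0 by rewrite /l2 e1E e3E !ee /=; ring.
have l22 : l2 e2 = 1 by rewrite /l2 e2E e3E !ee /=; ring.
have l23 : l2 e3 = 0 by rewrite /l2 e3E !ee /=; ring.
have l31 : l3 e1 = 0 by rewrite /l3 pE !e1E !e3E !ee /=; field.
have l32 : l3 e2 = 0 by rewrite /l3 pE !e2E !e3E !ee /=; field.
have l33 : l3 e3 = 1 by rewrite /l3 pE !e3E !ee /=; field.
have X3 (F : 'I_3 -> Prop) : F i -> F j -> F k -> forall m, F m.
  move=> Fi Fj Fk m; have := S3 (fun x => (x == m)%:R).
  have [<- //|im] := eqVneq i m; have [<- //|jm] := eqVneq j m; have [<- //|km] := eqVneq k m.
  move=> E; exfalso; move: E; rewrite !addr0.
  move: m {im jm km}; apply: ord3P => /eqP; rewrite !(eqxx, addr0, add0r) /= ?addr0 ?add0r oner_eq0 //.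
have dec X : X = l1 X *: e1 + l2 X *: e2 + l3 X *: e3.
  apply/rowP; apply: X3; rewrite !mxE ?e1E ?e2E ?e3E !ee /= /l1 /l2 /l3 ?pE; by field.
have d0 : differentiable eta 0 by exact: heta.
pose al (v : V) X := pairing (eta X) v.
have hal v : holo V0 (al v).
  by move=> X /heta /differentiable_hasD /(hasD_pairing v) /hasD_dd[].
pose D u v := dd (al v) 0 u.
have Dl u u' (c : C) v : D (c *: u + u') v = c * D u v + D u' v by rewrite /D ddP.
have Dr v v' (c : C) u : D u (c *: v + v') = c * D u v + D u v'.
  rewrite /D; have H := differentiable_hasD d0.
  have [_ E1] := hasD_dd (hasD_pairing (c *: v + v') H).
  have [_ E2] := hasD_dd (hasD_pairing v H); have [_ E3] := hasD_dd (hasD_pairing v' H).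
  by rewrite E1 E2 E3 pairing_linr.
have kap_ : D e1 e2 - D e2 e1 != 0.
  apply/negP => /eqP k0; have D12 : D e1 e2 = D e2 e1 by apply/eqP; rewrite -subr_eq0 k0.
  have Dz1 v : D 0 v = 0 by rewrite /D dd0.
  have Dz2 u : D u 0 = 0 by have := Dr 0 0 1 u; rewrite scaler0 addr0 mul1r => /esym/eqP; rewrite -subr_eq0 addrK => /eqP.
  have Dexp u v : D u v = l1 u * (l1 v * D e1 e1 + l2 v * D e1 e2 + l3 v * D e1 e3) +
     l2 u * (l1 v * D e2 e1 + l2 v * D e2 e2 + l3 v * D e2 e3) +
     l3 u * (l1 v * D e3 e1 + l2 v * D e3 e2 + l3 v * D e3 e3).
    have Er x : D x v = l1 v * D x e1 + l2 v * D x e2 + l3 v * D x e3.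
      by rewrite {1}(dec v) -addrA !Dr -[l3 v *: e3]addr0 Dr Dz2 addr0 addrA.
    by rewrite {1}(dec u) -addrA !Dl -[l3 u *: e3]addr0 Dl Dz1 addr0 addrA !Er.
  move: ct => [u [v [w]]]; rewrite /wedge12 !ext_derivE // -!/(D _ _) -/a -!/(l3 _).
  by move=> /eqP; apply; apply: (wedge_sym D12 Dexp).
pose U : set V := [set X | V0 X /\ al e3 X != 0].
have al3 : al e3 0 = 1 by exact: l33.
have oU : open U.
  apply/rn_open => X [OX n3]; have [r [r0 HU]] := open_ball oV OX.
  have n30 : 0 < rn (al e3 X) by rewrite rn_gt0.
  have [dl' dl0 Hd] := differentiable_cont (hal e3 X OX) n30.
  exists (Num.min r dl'); split; first by rewrite lt_min r0.
  move=> Y; rewrite lt_min => /andP[/HU OY /Hd YX]; split; first exact: OY.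
  by apply: contraTneq YX => ->; rewrite sub0r rnN ltxx.
have U0 : U 0 by split => //; rewrite al3 oner_neq0.
pose cf v X := -1 * (al v X * (al e3 X)^-1).
have hcf v : holo U (cf v).
  by move=> X [OX n3]; exact: (dd_opp_quot (hal v X OX) (hal e3 X OX) n3).1.
have cf0 v : l3 v = 0 -> cf v 0 = 0 /\ forall u, dd (cf v) 0 u = - D u v.
  move=> lv; have v0 : al v 0 = 0 by exact: lv.
  have n3 : al e3 0 != 0 by rewrite al3; exact: oner_neq0.
  split; first by rewrite /cf v0 mul0r mulr0.
  by move=> u; exact: ((dd_opp_quot (hal v 0 V00) (hal e3 0 V00) n3).2 v0 al3 u).
have [A0 dA] := cf0 e1 l31; have [B0 dB] := cf0 e2 l32.
have kap' : dd (cf e1) 0 e2 - dd (cf e2) 0 e1 != 0.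
  by rewrite (dA e2) (dB e1) opprK addrC; exact: kap_.
have [Th [Ps [ O [d [[d1 oO O0 OU] [[T0 P0] [h1 h2 h3 h4 h5]]]]]]] :=
  darboux_of_frame lin1 lin2 lin3 bd1 bd2 bd3 l11 l12 l13 l21 l22 l23 l31 l32 l33 dec oU U0
    (hcf e1) (hcf e2) A0 B0 kap'.
exists Th, Ps, O, d; split; first by split => // X /OU[].
split => //; split => // m w md wm.
have [OP TP] := h2 m md.
(* As Th (Ps m) = m on the ball, the differential of [Th] inverts that of [Ps]. *)
have ch n : dd (fun X => Th X 0 n) (Ps m) (DV Ps m w) = w 0 n.
  have [_ E] := @dd_chain R V 3 (fun X => Th X 0 n) Ps m (h3 m ^~ md) (h1 (Ps m) n OP).
  rewrite -E; have oB : open [set m : V | rn m < d].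
    apply/rn_open => x /= xr; exists (d - rn x); split; first by lra.
    by move=> Y; have := rnBB Y x; lra.
  have [_ ->] := @dd_local R V (fun m => Th (Ps m) 0 n) (fun m : V => m 0 n) _ m oB md
    (fun y yd => congr1 (fun M : V => M 0 n) (h2 y yd).2) (differentiable_coord m 0 n).
  have cl (c : C) (u v : V) : (c *: u + v) 0 n = c * u 0 n + v 0 n by rewrite !mxE.
  have cb : exists M, forall v : V, rn (v 0 n) <= M * rn v by exists 1 => v; rewrite mul1r rn_entry.
  exact: (differentiable_linear (f := fun v : V => v 0 n) cl cb m).2.
have := h5 (Ps m) (DV Ps m w) OP; rewrite !ch TP => /(_ wm).
have [VP n3] := OU _ OP.
set u := DV Ps m w => Eu.
have -> : pairing (eta (Ps m)) u = l1 u * al e1 (Ps m) + l2 u * al e2 (Ps m) + l3 u * al e3 (Ps m).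
  exact: pairing_dec (dec u).
by rewrite Eu /cf; move: (al e1 _) (al e2 _) (al e3 _) n3 (l1 u) (l2 u) => p q r r0 x y; field.
Qed.

End Eta.

Section Contact.
Context {R : realType}.
Local Notation C := (Cplx R).
Local Notation V := (C3 R).

(** [Ps] is a section of [Th] over the ball of radius K and, by injectivity of [Th], its inverse
    there. The last clause says, as an inclusion of kernels, that [Ps] pulls eta back to a multiple
    of dz - y dx. *)
Definition contact_chart (V0 : set V) (eta : V -> C3dual R) (K : R) (Th Ps : V -> V) (O : set V) :=
  [/\ open O, O 0, O `<=` V0, Th 0 = 0 & Ps 0 = 0] /\
  [/\ forall X i, O X -> differentiable (fun X => Th X 0 i) X,
      forall m : V, rn m < K -> O (Ps m) /\ Th (Ps m) = m,
      forall (m : V) i, rn m < K -> differentiable (fun m => Ps m 0 i) m,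
      forall X X' : V, O X -> O X' -> Th X = Th X' -> X = X' &
      forall m w : V, rn m < K -> w 0 o2 = m 0 o1 * w 0 o0 ->
        pairing (eta (Ps m)) (DV Ps m w) = 0].

Lemma darboux_small (V0 : set V) (eta : V -> C3dual R) :
  open V0 -> V0 0 -> holomorphic_on V0 eta -> contact_at eta (0 : V) ->
  exists (d : R) (Th Ps : V -> V) (O : set V), 0 < d /\ contact_chart V0 eta d Th Ps O.
Proof.
move=> oV V00 heta ct.
have fin i j k : (forall F : 'I_3 -> C, F o0 + F o1 + F o2 = F i + F j + F k) ->
    i != j -> i != k -> j != k -> eta 0 k 0 != 0 ->
    exists (d : R) (Th Ps : V -> V) (O : set V), 0 < d /\ contact_chart V0 eta d Th Ps O.
  move=> h1 h2 h3 h4 h5.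
  have [Th [Ps [ O [d [[d0 a1 a2 a3] [[b1 b2] H]]]]]] := darboux_of_indices h1 h2 h3 h4 h5 oV V00 heta ct.
  by exists d, Th, Ps, O; split.
have [z0|n0] := eqVneq (eta 0 o0 0) 0; last first.
  by apply: (fin o1 o2 o0) => // F; ring.
have [z1|n1] := eqVneq (eta 0 o1 0) 0; last first.
  by apply: (fin o0 o2 o1) => // F; ring.
have [z2|n2] := eqVneq (eta 0 o2 0) 0; last first.
  by apply: (fin o0 o1 o2) => // F; ring.
move: ct => [u [v [w]]]; rewrite /wedge12 !pairingE z0 z1 z2.
move: (ext_deriv eta 0 v w) (ext_deriv eta 0 w u) (ext_deriv eta 0 u v) => p q r /eqP H.
exfalso; apply: H; clear; ring.
Qed.

Lemma dd_coord (m : V) i : differentiable (fun m : V => m 0 i) m /\ forall w, dd (fun m : V => m 0 i) m w = w 0 i.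
Proof.
have cl (c : C) (u v : V) : (c *: u + v) 0 i = c * u 0 i + v 0 i by rewrite !mxE.
have cb : exists M, forall v : V, rn (v 0 i) <= M * rn v by exists 1 => v; rewrite mul1r rn_entry.
exact: (differentiable_linear (f := fun v : V => v 0 i) cl cb m).
Qed.

(* Weighted dilations (x,y,z) -> (e x, e y, e^2 z) preserve dz - y dx up to a
   factor, which makes the chart as large as desired. *)
Lemma darboux (V0 : set V) (eta : V -> C3dual R) (K : R) : 0 < K ->
  open V0 -> V0 0 -> holomorphic_on V0 eta -> contact_at eta (0 : V) ->
  exists (Th Ps : V -> V) (O : set V), contact_chart V0 eta K Th Ps O.
Proof.
move=> K0 oV V00 heta ct.
have [d [Th [Ps [ O [d0 [[oO O0 OV Th0 Ps0] [h1 h2 h3 h4 h5]]]]]]] := darboux_small oV V00 heta ct.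
have [e [e0 e1 eK]] : exists e : R, [/\ 0 < e, e <= 1 & e * K <= d].
  have q0 : 0 < d / K by rewrite divr_gt0.
  have qK : d / K * K = d by rewrite divfK // gt_eqF.
  have [le1|gt1] := lerP (d / K) 1; first by exists (d / K); rewrite qK.
  by exists 1; split; rewrite ?mul1r // -qK ler_peMl ?ltW.
(* All weights are at most e because e <= 1, so the ball of radius K is sent into the ball of radius
   d. *)
pose wt (i : 'I_3) : C := if i == o2 then toC (e ^+ 2) else toC e.
have wt0 i : wt i != 0 by rewrite /wt; case: ifP => _; rewrite toC_eq0 ?expf_neq0 // gt_eqF.
have wte i : rn (wt i) <= e.
  have ee := ltW e0; rewrite /wt; case: ifP => _; rewrite rn_toC ger0_norm ?exprn_ge0 //.
  by rewrite expr2 ler_piMl.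
pose sc (m : V) : V := \row_i (wt i * m 0 i).
pose un (m : V) : V := \row_i ((wt i)^-1 * m 0 i).
have scun m : sc (un m) = m by apply/rowP => i; rewrite !mxE mulVKf.
have unsc m : un (sc m) = m by apply/rowP => i; rewrite !mxE mulKf.
have scd m : rn m < K -> rn (sc m) < d.
  move=> mK; apply: (@le_lt_trans _ _ (e * rn m)); last first.
    by apply: lt_le_trans eK; rewrite ltr_pM2l.
  apply: rn_mx_le; first by rewrite mulr_ge0 ?rn_ge0 // ltW.
  by move=> i j; rewrite (ord1 i) mxE rnM; apply: ler_pM; rewrite ?rn_ge0 // rn_entry.
have dsc m i : differentiable (fun m : V => sc m 0 i) m /\
    forall w, dd (fun m : V => sc m 0 i) m w = wt i * w 0 i.
  have E : (fun m : V => sc m 0 i) = (fun m : V => wt i * m 0 i) by apply/funext => x; rewrite mxE.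
  rewrite E; have [dc dE] := dd_coord m i.
  by have [D1 _] := dd_Z 0 (wt i) dc; split => // w; have [_ ->] := dd_Z w (wt i) dc; rewrite dE.
have dPs m i : rn m < K -> differentiable (fun m => Ps (sc m) 0 i) m /\
    forall w, dd (fun m => Ps (sc m) 0 i) m w = dd (fun m => Ps m 0 i) (sc m) (sc w).
  move=> /scd md; have [D1 D2] := @dd_chain R V 3 (fun Y => Ps Y 0 i) sc m (fun i => (dsc m i).1) (h3 _ i md).
  split => // w; rewrite D2; congr dd; apply/rowP => j; rewrite !mxE.
  by have [_ ->] := dsc m j.
exists (fun X => un (Th X)), (fun m => Ps (sc m)), O; split; split => //.
- by rewrite Th0; apply/rowP => i; rewrite !mxE mulr0.
- have -> : sc 0 = 0 by apply/rowP => i; rewrite !mxE mulr0.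
  by [].
- move=> X i OX; have E : (fun X => un (Th X) 0 i) = (fun X => (wt i)^-1 * Th X 0 i).
    by apply/funext => x; rewrite mxE.
  by rewrite E; have [] := dd_Z 0 (wt i)^-1 (h1 X i OX).
- by move=> m /scd /h2 [h h']; rewrite h' unsc.
- by move=> m i /dPs -/(_ i)[].
- by move=> X X' OX OX' E; apply: h4 => //; rewrite -(scun (Th X)) E scun.
move=> m w mK w2; have -> : DV (fun m => Ps (sc m)) m w = DV Ps (sc m) (sc w).
  by apply/rowP => i; rewrite !mxE; have [_ ->] := dPs m i mK.
apply: h5; first exact: scd.
by rewrite !mxE w2 /wt /= expr2 toCM; ring.
Qed.
End Contact.

(** * Connectedness *)

Section Connected.
Context {R : realType}.
Local Notation C := (Cplx R).
Context {V : normedModType C}.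

(** Connectedness as an induction principle. It propagates leaf membership along paths of time and
    the vanishing of y along integral curves. *)
Lemma clopen_all (T : set V) (P : V -> Prop) : connected T ->
  (forall t, T t -> exists2 r : R, 0 < r & forall u, T u -> rn (u - t) < r -> (P t <-> P u)) ->
  forall t u, T t -> T u -> P t -> P u.
Proof.
move=> cT loc t0 t1 Tt0 Tt1 P0.
pose nb (Q : V -> Prop) := [set v | exists t (r : R), [/\ T t, Q t, 0 < r,
   forall u, T u -> rn (u - t) < r -> (P t <-> P u) & rn (v - t) < r]].
have onb Q : open (nb Q).
  apply/rn_open => v [t [r [Tt Qt r0 H vt]]].
  exists (r - rn (v - t)); split; first by lra.
  by move=> u uv; exists t, r; split => //; have := rn_tri v u t; lra.
have inb Q t : T t -> Q t -> nb Q t.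
  move=> Tt Qt; have [r r0 H] := loc t Tt; exists t, r; split => //.
  by rewrite subrr rn0.
suff E : T `&` nb P = T.
  have : T t1 by []. rewrite -E => -[_ [t [r [Tt Pt r0 H ut]]]].
  exact: (H t1 Tt1 ut).1 Pt.
apply: cT.
- by exists t0; split => //; apply: inb.
- by exists (nb P).
exists (~` nb (fun t => ~ P t)); first exact: open_closedC.
apply/seteqP; split => u [Tu].
  move=> [t [r [Tt Pt r0 H ut]]]; split => // -[t' [r' [Tt' Pt' r0' H' ut']]].
  by apply: Pt'; apply: (H' u Tu ut').2; apply: (H u Tu ut).1.
move=> nP; split => //; apply: (inb P) => //; apply: contrapT => nPu.
by apply: nP; apply: (inb (fun t => ~ P t)).
Qed.

Lemma seg_connected (x y : V) : connected [set x + toC s *: (y - x) | s in `[0 : R, 1]].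
Proof.
apply: connected_continuous_connected; first exact: segment_connected.
apply: continuous_subspaceT => s A /rn_nbhs [e [e0 HA]].
have c0 : 0 < rn (y - x) + 1 by rewrite ltr_wpDl // rn_ge0.
apply/nbhs_ballP; exists (e / (rn (y - x) + 1)); first by rewrite /= divr_gt0.
move=> t; rewrite /ball /= => ts; apply: HA.
have -> : x + toC t *: (y - x) - (x + toC s *: (y - x)) = toC (t - s) *: (y - x).
  by rewrite toCB scalerBl opprD addrACA subrr add0r.
rewrite rnZ rn_toC distrC; move: ts; rewrite ltr_pdivlMr //; apply: le_lt_trans.
by apply: ler_wpM2l; rewrite ?lerDl.
Qed.

Lemma star_connected (T : set V) x : T x ->
  (forall y, T y -> forall s : R, 0 <= s <= 1 -> T (x + toC s *: (y - x))) -> connected T.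
Proof.
move=> Tx H.
have -> : T = \bigcup_(y in T) [set x + toC s *: (y - x) | s in `[0 : R, 1]].
  apply/seteqP; split => [y Ty|y [z Tz [s /= s01 <-]]]; last first.
    by apply: H => //; move: s01; rewrite in_itv.
  by exists y => //; exists 1; rewrite /= ?in_itv /= ?ler01 ?lexx // toC1 scale1r addrC subrK.
apply: bigcup_connected; last by move=> y _; exact: seg_connected.
by exists x => y Ty; exists 0; rewrite /= ?in_itv /= ?ler01 ?lexx // toC0 scale0r addr0.
Qed.

Lemma ball_connected (x : V) (r : R) : connected [set y | rn (y - x) < r].
Proof.
have [r0|r0] := lerP r 0.
  suff -> : [set y : V | rn (y - x) < r] = set0.
    by move=> B [b Bb] _ [A _ BE]; move: Bb; rewrite BE => -[].
  apply/seteqP; split => y //= yr; have := rn_ge0 (y - x); lra.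
apply: (@star_connected _ x) => /=; first by rewrite subrr rn0.
move=> y yr s s01; rewrite addrAC subrr add0r rnZ rn_toC ger0_norm; last by lra.
by apply: le_lt_trans yr; rewrite ler_piMl ?rn_ge0 //; lra.
Qed.

Lemma ball_opn (x : V) (r : R) : open [set y | rn (y - x) < r].
Proof.
apply/rn_open => y /= yr; exists (r - rn (y - x)); split; first by lra.
by move=> u uy; have := rn_tri y u x; lra.
Qed.

End Connected.

(** * Calculus of one-variable complex derivatives *)

Section Cder.
Context {R : realType}.
Local Notation C := (Cplx R).
Implicit Types (f g : C -> C) (x l m c : C).

Lemma cderE f x l : cder f x l <-> differentiable f x /\ dd f x 1 = l.
Proof.
split=> [/hasD_dd [df E]|[df E]]; first by rewrite E mul1r.
have := dd_hasD df; suff -> : dd f x = (fun h => h * l) by [].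
by apply/funext => h; rewrite -E -ddZ; congr dd; rewrite /GRing.scale /= mulr1.
Qed.
Lemma cderD f g x l m : cder f x l -> cder g x m -> cder (fun t => f t + g t) x (l + m).
Proof.
move=> /cderE[df <-] /cderE[dg <-]; apply/cderE; split; last exact: dd_add.
exact: differentiableD.
Qed.
Lemma cderB f g x l m : cder f x l -> cder g x m -> cder (fun t => f t - g t) x (l - m).
Proof.
move=> /cderE[df <-] /cderE[dg <-]; apply/cderE; split; last exact: dd_sub.
exact: differentiableB.
Qed.
Lemma cderM f g x l m : cder f x l -> cder g x m -> cder (fun t => f t * g t) x (f x * m + g x * l).
Proof.
move=> /cderE[df <-] /cderE[dg <-]; apply/cderE; split; last exact: dd_mul.
exact: differentiableM.
Qed.
Lemma cderZ f x l c : cder f x l -> cder (fun t => c * f t) x (c * l).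
Proof.
by move=> /cderE[df <-]; have [D E] := dd_Z (1 : C) c df; apply/cderE.
Qed.
Lemma cder_cst c x : cder (fun=> c) x 0.
Proof. by apply/cderE; split; [exact: differentiable_cst|rewrite ddE diff_cst]. Qed.
Lemma cder_id x : cder id x 1.
Proof. by apply: cder_eps => e e0; exists 1 => // h _; rewrite mulr1 [x + h]addrC addrK subrr rn0 mulr_ge0 ?rn_ge0 // ltW. Qed.
Lemma cderN f x l : cder f x l -> cder (fun t => - f t) x (- l).
Proof.
move=> /(cderZ (-1)); rewrite mulN1r.
by have -> : (fun t => -1 * f t) = (fun t => - f t) by apply/funext => t; rewrite mulN1r.
Qed.
Lemma cder_comp f g x l m : cder f x l -> cder g (f x) m -> cder (fun t => g (f t)) x (l * m).
Proof.
move=> [_ _ Df] [_ _ Dg]; apply: cder_eps => e e0.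
have l0 := rn_ge0 l; have m0 := rn_ge0 m.
have p1 : 0 < e / (2 * (rn m + 1)) by rewrite divr_gt0 // mulr_gt0 // ltr_wpDl.
have p2 : 0 < e / (2 * (rn l + 1)) by rewrite divr_gt0 // mulr_gt0 // ltr_wpDl.
have [d1 d10 H1] := Df _ p1.
have [d2 d20 H2] := Df 1 ltr01; have [d3 d30 H3] := Dg _ p2.
have q3 : 0 < d3 / (rn l + 1) by rewrite divr_gt0 // ltr_wpDl.
exists (Num.min d1 (Num.min d2 (d3 / (rn l + 1)))); first by rewrite !lt_min d10 d20.
move=> h; rewrite !lt_min => /and3P[/H1 h1 /H2 h2 h3].
set k := f (x + h) - f x in h1 h2.
have kb : rn k <= (rn l + 1) * rn h.
  have -> : k = (k - h * l) + h * l by rewrite subrK.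
  apply: le_trans (rnD _ _) _; rewrite rnM mulrDl mul1r [rn l * _]mulrC; lra.
have k3 : rn k < d3 by apply: le_lt_trans kb _; rewrite mulrC -ltr_pdivlMr // ltr_wpDl.
have := H3 k k3; rewrite [f x + k]addrC /k subrK -/k => {}H3.
have -> : g (f (x + h)) - g (f x) - h * (l * m) =
   (g (f (x + h)) - g (f x) - k * m) + (k - h * l) * m by ring.
apply: le_trans (rnD _ _) _; rewrite rnM.
have E1 : e / (2 * (rn l + 1)) * rn k <= e / 2 * rn h.
  apply: le_trans (ler_wpM2l (ltW p2) kb) _.
  rewrite mulrA; apply: ler_wpM2r; first exact: rn_ge0.
  rewrite le_eqVlt; apply/orP; left; apply/eqP; field; apply/eqP; lra.
have E2 : rn (k - h * l) * rn m <= e / 2 * rn h.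
  apply: le_trans (ler_wpM2r m0 h1) _; rewrite mulrAC; apply: ler_wpM2r; first exact: rn_ge0.
  have -> : e / 2 = e / (2 * (rn m + 1)) * (rn m + 1) by field; apply/eqP; lra.
  by apply: ler_wpM2l; [exact: ltW|rewrite lerDl].
by apply: le_trans (lerD H3 (le_refl _)) _; lra.
Qed.
Lemma cder_exp f x l : cder f x l -> cder (fun t => cexp (f t)) x (l * cexp (f x)).
Proof. by move=> Df; apply: cder_comp Df _; exact: cder_cexp. Qed.
Lemma cder_diff f x l : cder f x l -> differentiable f x.
Proof. by case/cderE. Qed.

Lemma cder_seg_cst f p q :
  (forall s : R, 0 <= s <= 1 -> cder f (p + toC s * (q - p)) 0) -> f q = f p.
Proof.
move=> H; apply/eqP; rewrite -subr_eq0 -rn_eq0 eq_le rn_ge0 andbT.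
rewrite -[X in _ <= X](mulr0 2); apply: mean_value_dd => s /H => [/cder_diff //|].
by move=> /hasD_dd [_ ->]; rewrite mulr0 rn0.
Qed.

Lemma cder_seg_bound f f' p q b :
  (forall s : R, 0 <= s <= 1 -> cder f (p + toC s * (q - p)) (f' (p + toC s * (q - p)))) ->
  (forall s : R, 0 <= s <= 1 -> rn (f' (p + toC s * (q - p))) <= b) ->
  rn (f q - f p) <= 2 * (rn (q - p) * b).
Proof.
move=> H B; apply: mean_value_dd => s s01; first by have /cder_diff := H s s01.
have /hasD_dd [_ ->] := H s s01; rewrite rnM.
by apply: ler_wpM2l; rewrite ?rn_ge0 // B.
Qed.

Lemma cder_ball_cst f x (r : R) : (forall t, rn (t - x) < r -> cder f t 0) ->
  forall t, rn (t - x) < r -> f t = f x.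
Proof.
move=> H t tr; apply: cder_seg_cst => s s01; apply: H.
rewrite addrAC subrr add0r rnM rn_toC ger0_norm; last by lra.
by apply: le_lt_trans tr; rewrite ler_piMl ?rn_ge0 //; lra.
Qed.

(** The case of [prim_holo] on C itself, with l the identity and e = 1. *)
Lemma cder_primitive (T : set C) (g : C -> C) : open T -> holo T g ->
  (forall x, T x -> forall s : R, 0 <= s <= 1 -> T (toC s * x)) ->
  exists2 G : C -> C, G 0 = 0 & forall x, T x -> cder G x (g x).
Proof.
move=> oT hg sT; pose l (x : C) := x.
have ll (a u v : C) : l (a *: u + v) = a * l u + l v by [].
have lb : exists M, forall v, rn (l v) <= M * rn v by exists 1 => v; rewrite mul1r.
have st : star l 1 T.
  move=> x Tx s s01; rewrite /slide /l.
  have -> : x - (toC (1 - s) * x) *: 1 = toC s * x.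
    by rewrite /GRing.scale /= mulr1 toCB toC1; ring.
  exact: sT.
exists (prim l 1 g); first by rewrite /prim /l mul0r.
by move=> x Tx; apply/cderE; exact: (prim_holo ll lb (erefl _) oT hg st Tx).
Qed.

Lemma row_is_derive (f : C -> C3 R) (t : C) (L : C3 R) :
  (forall i, cder (fun s => f s 0 i) t (L 0 i)) -> is_derive t 1 f L.
Proof.
move=> H; have D : hasD f t (DV f t) by apply: hasD_row => i; exact: cder_diff (H i).
have [df E] := hasD_differentiable D.
apply: DeriveDef; first exact/diff_derivable.
rewrite deriveE // E; apply/rowP => i; rewrite mxE.
by have /cderE[] := H i.
Qed.

Lemma is_derive_row (f : C -> C3 R) (t : C) (L : C3 R) : is_derive t 1 f L ->
  forall i, cder (fun s => f s 0 i) t (L 0 i).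
Proof.
move=> [D E] i; have df : differentiable f t by exact/derivable1_diffP.
have dfi j : differentiable (fun s => f s 0 j) t by exact: differentiable_entry.
apply/cderE; split => //; have [_ E'] := hasD_differentiable (hasD_row dfi).
move: E; rewrite deriveE // E' => <-; by rewrite mxE.
Qed.

End Cder.

(** * The model field and its holonomy *)

Section Flow.
Context {R : realType}.
Local Notation C := (Cplx R).
Local Notation V := (C3 R).
Variables (D : set C) (k : C -> C).
Hypotheses (oD : open D) (hk : holo D k).

Definition model_domain : set V := [set m | [/\ D (m 0 o0), rn (m 0 o1) < 1 & rn (m 0 o2) < 1]].
Definition model_field (m : V) : V := row3 1 (m 0 o1 * k (m 0 o0)) (m 0 o1).

Lemma model_domain_row3 x y z : model_domain (row3 x y z) <-> [/\ D x, rn y < 1 & rn z < 1].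
Proof. by rewrite /model_domain /= !row3E. Qed.

Definition same_leaf := clos_refl_trans V (on_integral_curve model_domain model_field).

Lemma oic_sym (U : set V) Z p q : on_integral_curve U Z p q -> on_integral_curve U Z q p.
Proof. by move=> [T [f [c [s [t [Ts Tt fs ft]]]]]]; exists T, f; split => //; exists t, s. Qed.

Lemma same_leaf_refl p : same_leaf p p. Proof. exact: rt_refl. Qed.
Lemma same_leaf_trans q p r : same_leaf p q -> same_leaf q r -> same_leaf p r. Proof. exact: rt_trans. Qed.
Lemma same_leaf_sym p q : same_leaf p q -> same_leaf q p.
Proof.
elim=> [a b /oic_sym h|a|a b c _ h1 _ h2]; [exact: rt_step|exact: rt_refl|exact: rt_trans h2 h1].
Qed.

Lemma curve_same_leaf (T : set C) (x y z : C -> C) s t : open T -> connected T ->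
  (forall u, T u -> model_domain (row3 (x u) (y u) (z u))) ->
  (forall u, T u -> [/\ cder x u 1, cder y u (y u * k (x u)) & cder z u (y u)]) ->
  T s -> T t -> same_leaf (row3 (x s) (y s) (z s)) (row3 (x t) (y t) (z t)).
Proof.
move=> oT cT HU HD Ts Tt; apply: rt_step; exists T, (fun u => row3 (x u) (y u) (z u)).
split; last by exists s, t.
split => // u Tu; split.
  split; first exact: HU.
  by apply/eqP => /(congr1 (fun M : V => M 0 o0)); rewrite /model_field row3E mxE => /eqP; rewrite oner_eq0.
have [Dx Dy Dz] := HD u Tu; apply: row_is_derive; rewrite /model_field; apply: ord3P; rewrite !row3E.
- by have -> : (fun s => row3 (x s) (y s) (z s) 0 o0) = x by apply/funext => v; rewrite row3E.
- by have -> : (fun s => row3 (x s) (y s) (z s) 0 o1) = y by apply/funext => v; rewrite row3E.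
- by have -> : (fun s => row3 (x s) (y s) (z s) 0 o2) = z by apply/funext => v; rewrite row3E.
Qed.

Lemma cder_shift (f : C -> C) (a u l : C) : cder f (u + a) l -> cder (fun t => f (t + a)) u l.
Proof.
have Da : cder (fun t : C => t + a) u 1.
  by have := cderD (cder_id u) (cder_cst a u); rewrite addr0.
by move=> Df; have := cder_comp Da Df; rewrite mul1r.
Qed.

Lemma ball_primitive (x0 : C) (r : R) (g : C -> C) : 0 < r ->
  holo [set x | rn (x - x0) < r] g ->
  exists2 G : C -> C, G x0 = 0 & forall x, rn (x - x0) < r -> cder G x (g x).
Proof.
move=> r0 hg; pose T : set C := [set t | rn t < r].
have oT : open T by have := ball_opn (0 : C) r; under eq_fun => t do rewrite subr0.
have hT : holo T (fun t => g (t + x0)).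
  move=> t Tt; have /hg : rn ((t + x0) - x0) < r by rewrite addrK.
  move=> dg; have /cder_shift : cder g (t + x0) (dd g (t + x0) 1) by apply/cderE.
  exact: cder_diff.
have sT x : T x -> forall s : R, 0 <= s <= 1 -> T (toC s * x).
  move=> Tx s s01; rewrite /T /= rnM rn_toC ger0_norm; last by lra.
  by apply: le_lt_trans Tx; rewrite ler_piMl ?rn_ge0 //; lra.
have [G G0 HG] := cder_primitive oT hT sT.
exists (fun x => G (x - x0)); first by rewrite subrr.
move=> x /HG; rewrite subrK; exact: cder_shift.
Qed.

(** Over a small disc of the x-plane the leaves are graphs x -> (y exp K, z + y W), with K a
    primitive of k and W one of exp K. The bounds 2 and 1 are for [base_flow]. *)
Lemma local_flow (x0 : C) : D x0 -> exists (r : R) (K W : C -> C),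
  [/\ 0 < r, K x0 = 0, W x0 = 0 &
  forall x, rn (x - x0) < r -> [/\ D x, cder K x (k x), cder W x (cexp (K x)),
     rn (cexp (K x)) <= 2 & rn (W x) <= 1]].
Proof.
move=> Dx0; have [r [r0 rD]] := open_ball oD Dx0.
have [K K0 DK] := ball_primitive r0 (fun x xr => hk (rD x xr)).
have hE : holo [set x | rn (x - x0) < r] (fun x => cexp (K x)).
  by move=> x xr; apply: cder_diff (cder_exp (DK x xr)).
have [W W0 DW] := ball_primitive r0 hE.
have x00 : rn (x0 - x0) < r by rewrite subrr rn0.
have [d1 d10 H1] := differentiable_cont (hE x0 x00) ltr01.
have [d2 d20 H2] := differentiable_cont (cder_diff (DW x0 x00)) ltr01.
exists (Num.min r (Num.min d1 d2)), K, W; split => //; first by rewrite !lt_min r0 d10.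
move=> x; rewrite !lt_min => /and3P[xr /H1 h1 /H2 h2]; split.
- exact: rD.
- exact: DK.
- exact: DW.
- have := rnBB (cexp (K x)) (cexp (K x0)); rewrite K0 cexp0 rn1 => h; move: h1; rewrite K0 cexp0; lra.
- by move: h2; rewrite W0 subr0 => /ltW.
Qed.

Lemma flow_same_leaf (x0 : C) (r : R) (K W : C -> C) (y z : C) x : K x0 = 0 -> W x0 = 0 ->
  (forall x, rn (x - x0) < r -> [/\ D x, cder K x (k x) & cder W x (cexp (K x))]) ->
  (forall x, rn (x - x0) < r -> rn (y * cexp (K x)) < 1 /\ rn (z + y * W x) < 1) ->
  rn (x - x0) < r ->
  same_leaf (row3 x0 y z) (row3 x (y * cexp (K x)) (z + y * W x)).
Proof.
move=> K0 W0 H HU xr.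
have r0 : 0 < r by apply: le_lt_trans xr; exact: rn_ge0.
have := @curve_same_leaf [set t | rn (t - x0) < r] id (fun t => y * cexp (K t)) (fun t => z + y * W t) x0 x.
rewrite /= K0 W0 cexp0 mulr1 mulr0 addr0 subrr rn0; apply => //.
- exact: ball_opn.
- exact: ball_connected.
- by move=> u ur; apply/model_domain_row3; have [? _ _] := H u ur; have [? ?] := HU u ur.
move=> u ur; have [_ dK dW] := H u ur; split; first exact: cder_id.
- by rewrite -mulrA [cexp _ * _]mulrC; apply: cderZ; exact: cder_exp.
- by have := cderD (cder_cst z u) (cderZ y dW); rewrite add0r.
Qed.

(** Whatever the factor l, the functions y exp (- K (x)) and z - y (t0) W (x) have zero derivative
    in time, so the curve stays on the graph given by [local_flow]. *)
Lemma reparam_local (T : set C) (x y z l : C -> C) (t0 : C) : open T -> T t0 ->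
  (forall t, T t -> [/\ cder x t (l t), cder y t (l t * (y t * k (x t))) & cder z t (l t * y t)]) ->
  model_domain (row3 (x t0) (y t0) (z t0)) ->
  exists2 r : R, 0 < r & forall t, rn (t - t0) < r ->
    same_leaf (row3 (x t0) (y t0) (z t0)) (row3 (x t) (y t) (z t)).
Proof.
move=> oT Tt0 HD /model_domain_row3 [Dx y1 z1].
have [r [K [W [r0 K0 W0 H]]]] := local_flow Dx.
have xr0 : rn (x t0 - x t0) < r by rewrite subrr rn0.
have dW0 x' : rn (x' - x t0) < r -> cder W x' (cexp (K x')) by case/H.
have dK0 x' : rn (x' - x t0) < r -> cder K x' (k x') by case/H.
have [d1 d10 H1] : exists2 d : R, 0 < d & forall x', rn (x' - x t0) < d -> rn (y t0 * cexp (K x')) < 1.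
  have e0 : 0 < 1 - rn (y t0) by lra.
  have [d d0 Hd] := differentiable_cont (cder_diff (cderZ (y t0) (cder_exp (dK0 _ xr0)))) e0.
  exists d => // x' /Hd; have := rnBB (y t0 * cexp (K x')) (y t0 * cexp (K (x t0))).
  by rewrite K0 cexp0 mulr1; lra.
have [d2 d20 H2] : exists2 d : R, 0 < d & forall x', rn (x' - x t0) < d -> rn (z t0 + y t0 * W x') < 1.
  have e0 : 0 < 1 - rn (z t0) by lra.
  have [d d0 Hd] := differentiable_cont (cder_diff (cderD (cder_cst (z t0) _) (cderZ (y t0) (dW0 _ xr0)))) e0.
  exists d => // x' /Hd; have := rnBB (z t0 + y t0 * W x') (z t0 + y t0 * W (x t0)).
  by rewrite W0 mulr0 addr0; lra.
pose rho := Num.min r (Num.min d1 d2).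
have rho0 : 0 < rho by rewrite !lt_min r0 d10.
have [r1 [r10 HT]] := open_ball oT Tt0.
have [Dx0 _ _] := HD t0 Tt0.
have [d d0 Hd] := differentiable_cont (cder_diff Dx0) rho0.
exists (Num.min r1 d); first by rewrite lt_min r10.
have big u : rn (u - t0) < Num.min r1 d -> T u /\ rn (x u - x t0) < rho.
  by rewrite lt_min => /andP[/HT Tu /Hd].
have rhor u : rn (u - x t0) < rho -> rn (u - x t0) < r by rewrite lt_min => /andP[].
move=> t tr.
have yE u : rn (u - t0) < Num.min r1 d -> y u * cexp (- K (x u)) = y t0 * cexp (- K (x t0)).
  apply: (@cder_ball_cst R (fun u => y u * cexp (- K (x u)))) => v /big [Tv xv].
  have [dx dy dz] := HD v Tv.
  have := cderM dy (cder_exp (cderN (cder_comp dx (dK0 _ (rhor _ xv))))).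
  rewrite [X in cder _ _ X](_ : _ = 0) //; ring.
have yE' u : rn (u - t0) < Num.min r1 d -> y u = y t0 * cexp (K (x u)).
  move=> /yE; rewrite K0 oppr0 cexp0 mulr1 => <-.
  by rewrite -mulrA [cexp (- _) * _]mulrC cexpN mulr1.
have zE u : rn (u - t0) < Num.min r1 d -> z u - y t0 * W (x u) = z t0 - y t0 * W (x t0).
  apply: (@cder_ball_cst R (fun u => z u - y t0 * W (x u))) => v vr; have [Tv xv] := big v vr.
  have [dx dy dz] := HD v Tv.
  have := cderB dz (cderZ (y t0) (cder_comp dx (dW0 _ (rhor _ xv)))).
  by rewrite (yE' v vr) [X in cder _ _ X](_ : _ = 0) //; ring.
have zE' u : rn (u - t0) < Num.min r1 d -> z u = z t0 + y t0 * W (x u).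
  by move=> /zE; rewrite W0 mulr0 subr0 => <-; rewrite subrK.
rewrite (yE' t tr) (zE' t tr).
apply: (@flow_same_leaf (x t0) rho K W (y t0) (z t0) (x t) K0 W0).
- by move=> x' /rhor /H [].
- by move=> x'; rewrite !lt_min => /and3P[_ /H1 ? /H2].
- by have [] := big t tr.
Qed.

(* The time change need not be invertible: locally the curve is a function of x,
   along which it agrees with an integral curve of the field. *)
Lemma reparam (T : set C) (x y z l : C -> C) (p q : C) : open T ->
  (forall s : R, 0 <= s <= 1 -> T (p + toC s * (q - p))) ->
  (forall t, T t -> [/\ cder x t (l t), cder y t (l t * (y t * k (x t))) & cder z t (l t * y t)]) ->
  (forall s : R, 0 <= s <= 1 -> let t := p + toC s * (q - p) in model_domain (row3 (x t) (y t) (z t))) ->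
  same_leaf (row3 (x p) (y p) (z p)) (row3 (x q) (y q) (z q)).
Proof.
move=> oT sT HD HU; pose S : set C := [set p + toC s *: (q - p) | s in `[0 : R, 1]].
pose P t := same_leaf (row3 (x p) (y p) (z p)) (row3 (x t) (y t) (z t)).
have Q := @clopen_all R C S P (@seg_connected R C p q).
suff: P q by []; apply: (Q _ p q).
- move=> t [s /=]; rewrite in_itv /= => s01 <-.
  have [r r0 Hr] := reparam_local oT (sT s s01) HD (HU s s01).
  exists r => // u _ /Hr ur; split => h; first exact: same_leaf_trans h ur.
  exact: same_leaf_trans h (same_leaf_sym ur).
- by exists 0; rewrite /= ?in_itv /= ?lexx ?ler01 // toC0 scale0r addr0.
- by exists 1; rewrite /= ?in_itv /= ?lexx ?ler01 // toC1 scale1r addrC subrK.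
- exact: same_leaf_refl.
Qed.

End Flow.

Section Bound.
Context {R : realType}.
Local Notation C := (Cplx R).

Lemma line_bd (f : C -> C) (v : C) : (forall s : R, differentiable f (toC s * v)) ->
  exists B : R, forall s : R, 0 <= s <= 1 -> rn (f (toC s * v)) <= B.
Proof.
move=> df; have [|c _ H] := @EVT_max R (fun s => rn (f (toC s * v))) 0 1 ler01; last first.
  by exists (rn (f (toC c * v))) => s s01; apply: H; rewrite in_itv.
apply: continuous_subspaceT => s A /nbhs_ballP[e /= e0 HA].
have [d d0 Hd] := differentiable_cont (df s) e0.
have c0 : 0 < rn v + 1 by rewrite ltr_wpDl // rn_ge0.
apply/nbhs_ballP; exists (d / (rn v + 1)); first by rewrite /= divr_gt0.
move=> t; rewrite /ball /= => ts; apply: HA; rewrite /ball /=.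
have tv : rn (toC t * v - toC s * v) < d.
  rewrite -mulrBl -toCB rnM rn_toC distrC; move: ts; rewrite ltr_pdivlMr //; apply: le_lt_trans.
  by apply: ler_wpM2l; rewrite ?lerDl.
have h := Hd _ tv; rewrite distrC.
have h1 := rnBB (f (toC t * v)) (f (toC s * v)); have h2 := rnBB (f (toC s * v)) (f (toC t * v)).
by move: h2; rewrite rnC => h2; rewrite ltr_norml; lra.
Qed.
End Bound.

(** * Return map of a loop around one pole *)

Section Holonomy.
Context {R : realType}.
Local Notation C := (Cplx R).
Local Notation V := (C3 R).
Variables (D : set C) (k k1 : C -> C) (p a : C).
Hypotheses (oD : open D) (hk : holo D k) (p1 : rn p = 1).
Hypothesis HD : forall x, 0 < rn (x - p) < 5/4 -> D x /\ k x = a / (x - p) + k1 x.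
Hypothesis hk1 : holo [set x | rn (x - p) < 5/4] k1.

Let P : C := Ci R * toC (2 * pi).
(** As t goes from 0 to P, the point x t runs once around p on the unit circle based at 0. Since
    dx/dt = l = x - p, the polar part a / (x - p) becomes the constant a in the time t. The
    half-plane [T] maps to |x - p| < 5/4 and, unlike the punctured disc, carries single-valued
    solutions. *)
Let x (t : C) := p - p * cexp t.
Let l (t : C) := - (p * cexp t).
Let T : set C := [set t | rRe t < 1/10].

Let cder_x t : cder x t (l t).
Proof. by have := cderB (cder_cst p t) (cderZ p (cder_cexp t)); rewrite sub0r. Qed.
Let x0 : x 0 = 0. Proof. by rewrite /x cexp0 mulr1 subrr. Qed.
Let xP t : x (t + P) = x t. Proof. by rewrite /x /P cexp_2pi. Qed.
Let xp t : x t - p = l t. Proof. by rewrite /x /l addrAC subrr add0r. Qed.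
Let rnl t : rn (l t) = expR (rRe t). Proof. by rewrite rnN rnM p1 mul1r rn_cexp. Qed.

Let expT t : T t -> expR (rRe t) < 5/4.
Proof.
move=> Tt; apply: (@lt_trans _ _ (expR (1/10))); first by rewrite ltr_expR.
have := expR_ge1Dx (- (1/10) : R); rewrite expRN => h.
have e0 := expR_gt0 (1/10 : R).
have : expR (1/10) * (expR (1/10))^-1 = 1 :> R by rewrite mulfV // gt_eqF.
nra.
Qed.

Let xT t : T t -> 0 < rn (x t - p) < 5/4.
Proof. by move=> Tt; rewrite xp rnl expR_gt0 expT. Qed.

Let T_open : open T.
Proof.
apply/rn_open => t Tt; exists (1/10 - rRe t); split; first by rewrite subr_gt0.
move=> u; have := Re_le (u - t); rewrite ler_norml !cE => /andP[_ h1] h2; rewrite /T /=; lra.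
Qed.

Let T_conv t u (s : R) : T t -> T u -> 0 <= s <= 1 -> T (t + toC s * (u - t)).
Proof.
rewrite /T /= !cE mul0r subr0 => h1 h2 /andP[s0 s1].
have [h|/ltW h] := lerP (rRe u) (rRe t).
  have h3 : 0 <= rRe t - rRe u by lra.
  have := mulr_ge0 s0 h3; lra.
have h3 : 0 <= rRe u - rRe t by lra.
have h4 : 0 <= 1 - s by lra.
have := mulr_ge0 h4 h3; lra.
Qed.

(** The lift of the loop is (x, y g, z + y H), where g = exp (a t + K (x t)) solves g' = (a + l k1)
    g and H is a primitive of l g. After one turn x and K (x) are back, so g P = exp (a P) and s = H
    P. The number B bounds g and H on the path, which keeps the lift in the model domain. *)
Lemma holonomy : exists (B : R) (s : C), 0 < B /\
  (forall y z, rn y * B < 1 -> rn z + rn y * B < 1 ->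
     same_leaf D k (row3 0 y z) (row3 0 (cexp (a * P) * y) (z + s * y))) /\
  (a = -1 -> s != 0).
Proof.
have oB := ball_opn p (5/4).
(* The disc is convex and contains 0, so primitives can be taken from 0. *)
have sB u : rn (u - p) < 5/4 -> forall s : R, 0 <= s <= 1 -> rn (toC s * u - p) < 5/4.
  move=> up s s01; have -> : toC s * u - p = toC s * (u - p) - toC (1 - s) * p.
    by rewrite toCB toC1; ring.
  apply: le_lt_trans (rnB _ _) _; rewrite !rnM !rn_toC p1 !ger0_norm; [|lra|lra].
  move: up; set w := rn _ => up; have [s0 s1] := andP s01.
  have [h|/ltW h] := lerP 1 w.
    have h1 : 0 <= 1 - s by lra.
    have h2 : 0 <= w - 1 by lra.
    have := mulr_ge0 h1 h2; lra.
  have := ler_wpM2l s0 h; lra.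
have [K K0 DK] := cder_primitive oB hk1 sB.
pose g t := cexp (a * t + K (x t)).
have Dg t : T t -> cder g t ((a + l t * k1 (x t)) * g t).
  move=> Tt; have /andP[_ xb] := xT Tt.
  have := cder_exp (cderD (cderZ a (cder_id t)) (cder_comp (cder_x t) (DK _ xb))).
  by rewrite mulr1.
have hlg : holo T (fun t => l t * g t).
  move=> t Tt; apply: cder_diff; apply: (cderM _ (Dg t Tt)).
  by apply: cderN; apply: cderZ; exact: cder_cexp.
have T0 : T 0 by rewrite /T /= rRe0; lra.
have TP : T P by rewrite /T /P /= !cE; lra.
have sT u : T u -> forall s : R, 0 <= s <= 1 -> T (toC s * u).
  by move=> Tu s s01; have := T_conv T0 Tu s01; rewrite add0r subr0.
have [H H0 DH] := cder_primitive T_open hlg sT.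
have lineT (s : R) : T (toC s * P) by rewrite /T /P /= !cE; lra.
have [B1 HB1] := line_bd (fun s => cder_diff (Dg _ (lineT s))).
have [B2 HB2] := line_bd (fun s => cder_diff (DH _ (lineT s))).
pose B := `|B1| + `|B2| + 1.
have B0 : 0 < B by rewrite ltr_wpDl // addr_ge0.
have BB1 : B1 <= B by have := ler_norm B1; have := normr_ge0 B2; rewrite /B; lra.
have BB2 : B2 <= B by have := ler_norm B2; have := normr_ge0 B1; rewrite /B; lra.
have gP : g P = cexp (a * P).
  by rewrite /g -[P in x P]add0r xP x0 K0 addr0.
have g0 : g 0 = 1 by rewrite /g mulr0 add0r x0 K0 cexp0.
exists B, (H P); split => //; split.
  move=> y z yB zB.
  have := @reparam R D k oD hk T x (fun t => y * g t) (fun t => z + y * H t) l 0 P T_open.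
  rewrite /= x0 g0 H0 gP mulr1 mulr0 addr0 -[P in x P]add0r xP x0 [y * H P]mulrC [y * cexp _]mulrC.
  apply.
  - by move=> s s01; rewrite add0r subr0; exact: lineT.
  - move=> t Tt; have [Dx kE] := HD (xT Tt); split; first exact: cder_x.
    + have := cderZ y (Dg t Tt); rewrite kE xp.
      have l0 : l t != 0 by rewrite -rn_gt0 rnl expR_gt0.
      rewrite [X in cder _ _ X -> _](_ : _ = l t * (y * g t * (a / l t + k1 (x t)))) //.
      by field.
    + have := cderD (cder_cst z t) (cderZ y (DH t Tt)); rewrite add0r.
      by rewrite [X in cder _ _ X -> _](_ : _ = l t * (y * g t)) //; ring.
  - move=> s s01; rewrite add0r subr0; apply/model_domain_row3; split.
    + by have [] := HD (xT (lineT s)).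
    + rewrite rnM; apply: le_lt_trans yB; apply: ler_wpM2l; first exact: rn_ge0.
      exact: le_trans (HB1 s s01) BB1.
    + apply: le_lt_trans (rnD _ _) _; apply: le_lt_trans zB; rewrite lerD2l rnM.
      apply: ler_wpM2l; first exact: rn_ge0.
      exact: le_trans (HB2 s s01) BB2.
(* For a = -1 the function l * g is -p exp (K (x t)), which is P-periodic, so
   H (t + P) - H t does not depend on t; its limit as Re t -> -oo is
   - P p exp (K p), which is not 0. *)
move=> a1; apply/negP => /eqP HP0.
have gE t : l t * g t = - (p * cexp (K (x t))).
  rewrite /g /l a1 cexpD mulN1r; have := cexpN t; set E := cexp t; set E' := cexp (- t) => EE.
  have -> : - (p * E) * (E' * cexp (K (x t))) = - (p * (E * E') * cexp (K (x t))) by ring.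
  by rewrite EE mulr1.
have TPt t : T t -> T (t + P) by rewrite /T /P /= !cE; lra.
have Dt t : T t -> H (t + P) - H t = 0.
  move=> Tt; transitivity (H (0 + P) - H 0); last by rewrite add0r HP0 H0 subrr.
  apply: (@cder_seg_cst R (fun t => H (t + P) - H t)) => s s01; have Ts := T_conv T0 Tt s01.
  have := cderB (cder_shift (DH _ (TPt _ Ts))) (DH _ Ts).
  by rewrite !gE xP subrr.
pose c := p * cexp (K p).
have c0 : 0 < rn c by rewrite rnM p1 mul1r rn_gt0 cexp_neq0.
have pp : rn (p - p) < 5/4 by rewrite subrr rn0; lra.
have e0 : 0 < rn c / 4 by lra.
have [d d0 Hd] := differentiable_cont (cder_diff (cder_exp (DK p pp))) e0.
pose d' := Num.min d 1 / 2.
have m0 : 0 < Num.min d 1 by rewrite lt_min d0 ltr01.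
have md : Num.min d 1 <= d by rewrite ge_min lexx.
have m1 : Num.min d 1 <= 1 by rewrite ge_min lexx orbT.
have d'0 : 0 < d' by rewrite /d'; lra.
pose t : C := toC (ln d').
have tT : rRe t <= 0 by rewrite /t cE -ln1 ler_ln ?posrE // /d'; lra.
have P0 : 0 < rn P.
  by rewrite /P rnM rn_i mul1r rn_toC gtr0_norm mulr_gt0 // pi_gt0.
have line (s : R) : rRe (t + toC s * (t + P - t)) = rRe t.
  by rewrite /P !cE; ring.
(* The function H + c id has derivative l g + c, of modulus at most |c| / 4 on this vertical path;
   its increment c P would then have modulus at most |c P| / 2. *)
have : rn (H (t + P) + (c * t + c * P) - (H t + c * t)) <= 2 * (rn (t + P - t) * (rn c / 4)).
  rewrite -mulrDr; apply: (@cder_seg_bound R (fun u => H u + c * u) (fun u => l u * g u + c)) => s s01.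
    have Ts : T (t + toC s * (t + P - t)) by rewrite /T /= line; lra.
    by have := cderD (DH _ Ts) (cderZ c (cder_id _)); rewrite mulr1.
  have := line s; set u := t + toC s * _ => uE; rewrite gE /c.
  have -> : - (p * cexp (K (x u))) + p * cexp (K p) = p * (cexp (K p) - cexp (K (x u))) by ring.
  rewrite rnM p1 mul1r rnC ltW //; apply: Hd; rewrite xp rnl uE /t cE lnK ?posrE // /d'; lra.
have Tt : T t by rewrite /T /=; lra.
have -> : H (t + P) + (c * t + c * P) - (H t + c * t) = (H (t + P) - H t) + c * P by ring.
rewrite (Dt t Tt) add0r rnM [t + P]addrC addrK; nra.
Qed.

End Holonomy.

(** * Density *)

Section Kronecker.
Context {R : realType}.
Local Notation q := (Num.sqrt 2 : R).

Lemma sqrt2 : [/\ q * q = 2, 1 < q & q < 3/2].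
Proof.
have q2 : q ^+ 2 = 2 by rewrite sqr_sqrtr.
have q0 : 0 <= q by exact: sqrtr_ge0.
rewrite expr2 in q2; split => //; nra.
Qed.

Lemma sqrt2_pow n : exists c d : int, (q - 1) ^+ n = c%:~R + d%:~R * q.
Proof.
have [q2 _ _] := sqrt2.
elim: n => [|n [c [d E]]]; first by exists 1, 0; rewrite expr0 mul0r addr0.
exists (2 * d - c), (c - d); rewrite exprSr E !intrB intrM.
have -> : (c%:~R + d%:~R * q) * (q - 1) = d%:~R * (q * q) + c%:~R * q - c%:~R - d%:~R * q by ring.
rewrite q2; ring.
Qed.

(** Powers of sqrt 2 - 1 are small elements of Z + Z sqrt 2. A change of sign makes the coefficient
    of sqrt 2 nonnegative, as it will count iterations. *)
Lemma sqrt2_small (e : R) : 0 < e -> exists (c : int) (d : nat),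
  c%:~R + d%:R * q != 0 /\ `|c%:~R + d%:R * q| < e.
Proof.
move=> e0; have [n] := pow_small 1 e0; rewrite div1r => Hn.
have [q2 q1 q3] := sqrt2; have [c [d E]] := sqrt2_pow n.
have u0 : 0 < (q - 1) ^+ n by rewrite exprn_gt0 // subr_gt0.
have ue : (q - 1) ^+ n < e.
  by apply: le_lt_trans Hn; rewrite -exprVn; apply: lerXn2r; rewrite ?nnegrE; lra.
case: d E => d E.
  by exists c, d; rewrite -[d%:R]/((Posz d)%:~R) -E gt_eqF // gtr0_norm.
exists (- c), d.+1; have -> : (- c)%:~R + d.+1%:R * q = - (q - 1) ^+ n.
  by rewrite E NegzE !mulrNz; ring.
by rewrite oppr_eq0 gt_eqF // normrN gtr0_norm.
Qed.

(** Multiples of a small v are added to an integer lying on the proper side of x: the floor of x if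
    v > 0, the next integer if v < 0. The integer coefficient may be negative: it is later absorbed
    by the period of exp or by a difference of exponents. *)
Lemma sqrt2_dense (x e : R) : 0 < e -> exists (c : int) (d : nat), `|c%:~R + d%:R * q - x| < e.
Proof.
move=> e0; have [c [d [v0 ve]]] := sqrt2_small e0; set v := _ + _ in v0 ve.
have fin (m : int) : 0 <= (x - m%:~R) / v -> exists (c : int) (d : nat), `|c%:~R + d%:R * q - x| < e.
  move=> /truncn_itv /andP[]; set n := Num.Def.trunc _ => h1 h2.
  exists (n%:Z * c + m), (n * d)%N; rewrite intrD intrM natrM.
  have -> : n%:~R * c%:~R + m%:~R + n%:R * d%:R * q - x = (n%:R - (x - m%:~R) / v) * v.
    by rewrite mulrBl divfK // /v -[n%:~R]/(n%:R); ring.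
  rewrite normrM; apply: le_lt_trans ve; rewrite ler_piMl // ler_norml.
  by move: h1 h2; rewrite -natr1; set r := _ / _; lra.
have := floor_itv x; rewrite intrD; set m := Num.Def.floor x => /andP[h1 h2].
have [vp|vn] := ltrP 0 v.
  by apply: (fin m); rewrite divr_ge0 ?subr_ge0 // ltW.
apply: (fin (m + 1)); rewrite -mulrNN -invrN; apply: divr_ge0; last by rewrite oppr_ge0.
by rewrite oppr_ge0 intrD subr_le0 ltW.
Qed.
End Kronecker.

(** * Words in partially defined return maps *)

Section Density.
Context {R : realType}.
Local Notation C := (Cplx R).
Variables (E : C -> C -> C -> C -> Prop) (dl : R).
Hypothesis Er : forall y z, E y z y z.
Hypothesis Es : forall y z y' z', E y z y' z' -> E y' z' y z.
Hypothesis Et : forall y1 z1 y z y2 z2, E y z y1 z1 -> E y1 z1 y2 z2 -> E y z y2 z2.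

(** A return map of the fibre, usable on the bidisc of radius [dl]; [E] abstracts the relation of
    lying on one leaf. *)
Definition small_move (mu s : C) := forall y z, rn y < dl -> rn z < dl -> E y z (mu * y) (z + s * y).

(** The successive shifts form a geometric series, so the total is at most 2 |s| |y| for every n.
    The shift [sg] is chosen before z, so the same word can be undone from another z. *)
Lemma iter_contr mu s n : rn mu <= 1/2 -> small_move mu s -> forall y, rn y < dl ->
  exists sg : C, rn sg <= 2 * rn s * rn y /\
    forall z, rn z + 2 * rn s * rn y < dl -> E y z (mu ^+ n * y) (z + sg).
Proof.
move=> m2 M; have s0 := rn_ge0 s; elim: n => [|n IH] y yd; have y0 := rn_ge0 y.
  exists 0; split; first by rewrite rn0 mulr_ge0 // mulr_ge0.
  by move=> z _; rewrite expr0 mul1r addr0.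
have my : rn (mu * y) <= 1/2 * rn y by rewrite rnM ler_wpM2r.
have [|sg [sb H]] := IH (mu * y); first by lra.
have smy := ler_wpM2l s0 my.
exists (s * y + sg); split.
  by apply: le_trans (rnD _ _) _; rewrite rnM; lra.
move=> z zd; have sy : rn s * rn y >= 0 by exact: mulr_ge0.
have zsy : rn (z + s * y) <= rn z + rn s * rn y by rewrite -rnM; exact: rnD.
apply: (Et (M y z yd _)); first by lra.
by rewrite exprSr -mulrA addrA; apply: H; lra.
Qed.

(** A rotation preserves |y|, so the shift grows linearly in n and is small only once |y| is. *)
Lemma iter_rot mu s n : rn mu = 1 -> small_move mu s -> forall y, rn y < dl ->
  exists sg : C, rn sg <= n%:R * rn s * rn y /\
    forall z, rn z + n%:R * rn s * rn y < dl -> E y z (mu ^+ n * y) (z + sg).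
Proof.
move=> m1 M; have s0 := rn_ge0 s; elim: n => [|n IH] y yd; have y0 := rn_ge0 y.
  exists 0; split; first by rewrite rn0 !mul0r.
  by move=> z _; rewrite expr0 mul1r addr0.
have my : rn (mu * y) = rn y by rewrite rnM m1 mul1r.
have [|sg [sb H]] := IH (mu * y); first by lra.
rewrite my in sb H; rewrite -natr1 !mulrDl mul1r.
have sy : rn s * rn y >= 0 by exact: mulr_ge0.
have nsy : 0 <= n%:R * rn s * rn y by rewrite mulr_ge0 // mulr_ge0.
exists (s * y + sg); split.
  by apply: le_trans (rnD _ _) _; rewrite rnM; lra.
move=> z zd; have zsy : rn (z + s * y) <= rn z + rn s * rn y by rewrite -rnM; exact: rnD.
apply: (Et (M y z yd _)); first by lra.
by rewrite exprSr -mulrA addrA; apply: H; lra.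
Qed.

Lemma iter_trans s (n : nat) : small_move 1 s -> forall y z, rn y < dl ->
  rn z + n%:R * rn s * rn y < dl -> E y z y (z + n%:R * (s * y)).
Proof.
move=> M y z yd; have s0 := rn_ge0 s; have y0 := rn_ge0 y.
have sy : rn s * rn y >= 0 by exact: mulr_ge0.
elim: n z => [|n IH] z; first by move=> _; rewrite mul0r addr0.
rewrite -!natr1 !mulrDl !mul1r => zd.
have nsy : 0 <= n%:R * rn s * rn y by rewrite mulr_ge0 // mulr_ge0.
have zsy : rn (z + s * y) <= rn z + rn s * rn y by rewrite -rnM; exact: rnD.
apply: (Et (y1 := y) (z1 := z + s * y)).
  by have := M y z yd; rewrite mul1r; apply; lra.
have -> : z + (n%:R * (s * y) + s * y) = z + s * y + n%:R * (s * y) by ring.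
by apply: IH; lra.
Qed.

(** A negative n uses the symmetry of [E], starting from the translated point; hence the factor 2 in
    the hypothesis. *)
Lemma iter_trans_int s (n : int) : small_move 1 s -> forall y z, rn y < dl ->
  rn z + 2 * (`|n%:~R| * rn s * rn y) < dl -> E y z y (z + n%:~R * (s * y)).
Proof.
move=> M y z yd; have nsy : 0 <= `|n%:~R| * rn s * rn y by rewrite mulr_ge0 ?rn_ge0 // mulr_ge0 ?rn_ge0.
case: n nsy => n; first by rewrite normr_nat => nsy zd; apply: iter_trans => //; lra.
rewrite NegzE mulrNz normrN -[n.+1%:~R]/(n.+1%:R) normr_nat => nsy zd.
set z' := z + _; have -> : z = z' + n.+1%:R * (s * y).
  by rewrite /z' mulrNz -[n.+1%:~R]/(n.+1%:R); ring.
apply: Es; apply: iter_trans => //.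
apply: le_lt_trans (lerD (rnD _ _) (lexx _)) _.
have -> : rn ((- n.+1%:Z)%:~R * (s * y)) = n.+1%:R * rn s * rn y.
  by rewrite mulrNz rnM rnN rnM rn_nat mulrA.
lra.
Qed.

End Density.

(** Between a rotation and its inverse, the translation by s y becomes one by s om y, and the shift
    so y of the rotation cancels. As om is not real, z moves on the lattice z + s y (Z + Z om), and
    rounding both coordinates costs at most 2 |s y|. *)
Lemma trans_lattice (R : realType) (E : Cplx R -> Cplx R -> Cplx R -> Cplx R -> Prop) (dl : R)
  (s om so : Cplx R) :
  (forall y z, E y z y z) -> (forall y z y' z', E y z y' z' -> E y' z' y z) ->
  (forall y1 z1 y z y2 z2, E y z y1 z1 -> E y1 z1 y2 z2 -> E y z y2 z2) -> s != 0 -> rIm om != 0 -> rn om = 1 -> small_move E dl 1 s -> small_move E dl om so ->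
  exists c : R, 1 <= c /\ forall y z w, y != 0 -> rn y < dl ->
    rn z + 4 * c * rn (w - z) + (8 * rn s + 2 * rn so) * rn y < dl ->
    exists z', rn (z' - w) <= 2 * rn s * rn y /\ E y z y z'.
Proof.
move=> Er Es Et s0 oi o1 Ms Mo; pose be := rIm om; have b0 : 0 < `|be| by rewrite normr_gt0.
exists (1 + `|be|^-1); split; first by rewrite lerDl invr_ge0 ltW.
move=> y z w y0 yd; set c := 1 + _ => zd.
have sn : 0 < rn s by rewrite rn_gt0.
have yn : 0 < rn y by rewrite rn_gt0.
(* The displacement in units of s y. Its real coordinates p2 and q2 in the basis (1, om) are at most
   c |u|, where c contains the inverse of |Im om|; their floors are the numbers of translations. *)
pose u := (w - z) / (s * y).
have sy0 : s * y != 0 by rewrite mulf_neq0.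
have un : rn u * (rn s * rn y) = rn (w - z) by rewrite -!rnM divfK.
pose q2 := rIm u / be; pose p2 := rRe u - q2 * rRe om.
have uE : u = toC p2 + toC q2 * om.
  by rewrite /p2 /q2 /be; apply: C_ext; rewrite !cE; [ring|field].
have u0 := rn_ge0 u.
have q2b : `|q2| <= `|be|^-1 * rn u.
  by rewrite /q2 normrM normfV mulrC; apply: ler_wpM2l; [rewrite invr_ge0 ltW|exact: Im_le].
have p2b : `|p2| <= c * rn u.
  apply: le_trans (ler_normB _ _) _; rewrite /c mulrDl mul1r; apply: lerD; first exact: Re_le.
  rewrite normrM; apply: le_trans q2b; rewrite ler_piMr // -o1; exact: Re_le.
pose n := Num.Def.floor p2; pose m := Num.Def.floor q2.
have := floor_itv p2; rewrite intrD -/n => /andP[n1 n2].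
have := floor_itv q2; rewrite intrD -/m => /andP[m1 m2].
have nb : `|n%:~R : R| <= c * rn u + 1.
  by move: p2b; rewrite !ler_norml; clear -n1 n2; lra.
have c1 : `|be|^-1 * rn u <= c * rn u by rewrite ler_wpM2r // /c lerDr.
have mb : `|m%:~R : R| <= c * rn u + 1.
  by move: q2b; rewrite !ler_norml; clear -m1 m2 c1; lra.
have so0 := rn_ge0 so; have soy : 0 <= rn so * rn y by rewrite mulr_ge0 // ltW.
have sy : 0 < rn s * rn y by exact: mulr_gt0.
have NB : `|n%:~R : R| * rn s * rn y <= c * rn (w - z) + rn s * rn y.
  by rewrite -mulrA -un; have := ler_wpM2r (ltW sy) nb; clear; lra.
have MB : `|m%:~R : R| * rn s * rn y <= c * rn (w - z) + rn s * rn y.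
  by rewrite -mulrA -un; have := ler_wpM2r (ltW sy) mb; clear; lra.
have n0 : 0 <= `|n%:~R : R| * rn s * rn y by rewrite !mulr_ge0 // ltW.
have cw : 0 <= c * rn (w - z) by rewrite mulr_ge0 ?rn_ge0 // /c addr_ge0 // invr_ge0.
have nC (k : int) : rn (k%:~R : Cplx R) = `|k%:~R|.
  have -> : k%:~R = toC k%:~R :> Cplx R.
    by case: k => k; rewrite ?NegzE ?mulrNz ?toCN -?[k%:~R]/(k%:R) -?[k.+1%:~R]/(k.+1%:R) toC_nat.
  by rewrite rn_toC.
pose z1 := z + n%:~R * (s * y).
have z1b : rn z1 <= rn z + `|n%:~R| * rn s * rn y.
  by apply: le_trans (rnD _ _) _; rewrite !rnM nC mulrA.
have oy : rn (om * y) = rn y by rewrite rnM o1 mul1r.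
pose z2 := z1 + so * y.
have z2b : rn z2 <= rn z1 + rn so * rn y by apply: le_trans (rnD _ _) _; rewrite rnM.
pose z3 := z2 + m%:~R * (s * (om * y)).
pose z4 := z1 + m%:~R * (s * (om * y)).
have z4b : rn z4 <= rn z1 + `|m%:~R| * rn s * rn y.
  by apply: le_trans (rnD _ _) _; rewrite !rnM o1 mul1r nC mulrA.
have z43 : z3 = z4 + so * y by rewrite /z3 /z4 /z2; ring.
have z0 := rn_ge0 z.
have m0 : 0 <= `|m%:~R : R| * rn s * rn y by rewrite !mulr_ge0 // ltW.
exists z4; split; last first.
  apply: (Et y z1); first by apply: (iter_trans_int Er Es Et Ms) => //; clear -yd zd NB MB n0 cw z1b z2b z4b soy sy; lra.
  apply: (Et (om * y) z2); first by apply: Mo => //; clear -yd zd NB MB n0 cw z1b z2b z4b soy sy; lra.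
  apply: (Et (om * y) z3); first by apply: (iter_trans_int Er Es Et Ms); rewrite ?oy //; clear -yd zd NB MB n0 cw z1b z2b z4b soy sy m0; lra.
  by apply: Es; rewrite z43; apply: Mo => //; clear -yd zd NB MB n0 cw z1b z2b z4b soy sy m0; lra.
have wE : w = z + u * (s * y) by rewrite /u divfK // addrC subrK.
have -> : z4 - w = s * y * ((n%:~R - toC p2) + (m%:~R - toC q2) * om).
  by rewrite wE uE /z4 /z1; ring.
have fC (k : int) (x : R) : k%:~R <= x -> x < k%:~R + 1 -> rn (k%:~R - toC x) <= 1.
  move=> h1 h2; have -> : k%:~R - toC x = toC (k%:~R - x) :> Cplx R.
    rewrite toCB; congr (_ - _).
    by case: k {h1 h2} => k; rewrite ?NegzE ?mulrNz ?toCN -?[k%:~R]/(k%:R) -?[k.+1%:~R]/(k.+1%:R) toC_nat.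
  by rewrite rn_toC ler_norml; clear -h1 h2; lra.
have F : rn ((n%:~R - toC p2) + (m%:~R - toC q2) * om) <= 2.
  apply: le_trans (rnD _ _) _; rewrite rnM o1 mulr1.
  have := fC n p2 n1 n2; have := fC m q2 m1 m2; clear; lra.
by rewrite rnM rnM; have := ler_wpM2l (ltW sy) F; clear; lra.
Qed.

(** The word takes y0 exactly to ys = a^N y1, moves z on a lattice whose mesh is proportional to
    |ys|, and undoes the N contractions of y1. As j and l are fixed before N, the drift of the
    rotations, proportional to l |ys|, is as small as wished. *)
Lemma orbit_dense (R : realType) (E : Cplx R -> Cplx R -> Cplx R -> Cplx R -> Prop) (dl : R)
  (a b om sa sb so s : Cplx R) :
  (forall y z, E y z y z) -> (forall y z y' z', E y z y' z' -> E y' z' y z) ->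
  (forall y1 z1 y z y2 z2, E y z y1 z1 -> E y1 z1 y2 z2 -> E y z y2 z2) -> 0 < dl ->
  rn a <= 1/2 -> rn b <= 1/2 -> rn om = 1 -> rIm om != 0 -> s != 0 ->
  small_move E dl a sa -> small_move E dl b sb -> small_move E dl om so -> small_move E dl 1 s ->
  exists d : R, 0 < d /\ forall y0 z0 y1 z1, rn y0 < d -> rn z0 < d -> rn y1 < d -> rn z1 < d ->
    y1 != 0 ->
    (exists j l : nat, forall N0, exists N n : nat, (N0 <= N)%N /\
      a ^+ N * y1 = om ^+ l * (b ^+ j * (a ^+ n * y0))) ->
    a != 0 ->
    forall e : R, 0 < e -> exists z, rn (z - z1) < e /\ E y0 z0 y1 z.
Proof.
move=> Er Es Et dl0 a2 b2 o1 oi s0 Ma Mb Mo Ms.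
have [c [c1 Hc]] := trans_lattice Er Es Et s0 oi o1 Ms Mo.
have [sa0 sb0 so0 ss0] := And4 (rn_ge0 sa) (rn_ge0 sb) (rn_ge0 so) (rn_ge0 s).
have [A A0 AE] : exists2 A : R, 0 <= A & 2 * rn sa = A by exists (2 * rn sa) => //; lra.
have [B B0 BE] : exists2 B : R, 0 <= B & 2 * rn sb = B by exists (2 * rn sb) => //; lra.
(* The gap left to the lattice moves is at most G d; taking 8 c G d = dl leaves room for the factor
   4 c of [trans_lattice]. *)
pose G := 3 + 3 * A + B; have G0 : 3 <= G by rewrite /G; lra.
have cG : G <= c * G by rewrite ler_peMl //; lra.
have X0 : 0 < 8 * (c * G) by lra.
exists (dl / (8 * (c * G))); split; first exact: divr_gt0.
set d := dl / _; have d0 : 0 < d by exact: divr_gt0.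
have dE : 8 * (c * G * d) = dl by rewrite mulrA mulrC /d divfK // gt_eqF.
have Gd : G * d <= c * G * d by rewrite ler_wpM2r // ltW.
have GdE : G * d = 3 * d + 3 * (A * d) + B * d by rewrite /G; ring.
have Ad : 0 <= A * d by rewrite mulr_ge0 // ltW.
have Bd : 0 <= B * d by rewrite mulr_ge0 // ltW.
move=> y0 z0 y1 z1 y0d z0d y1d z1d y1n [j [l HN]] an e e0.
have Ay0 := ler_wpM2l A0 (ltW y0d); have By0 := ler_wpM2l B0 (ltW y0d).
have Ay1 := ler_wpM2l A0 (ltW y1d).
(* The product |ys| Q dominates |ys|, the drift of the rotations, the room asked for by
   [trans_lattice] and its final error. *)
pose Q := l%:R * rn so + 10 * rn s + 2 * rn so + 1.
have lso : 0 <= l%:R * rn so by rewrite mulr_ge0.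
have Q0 : 0 < Q by rewrite /Q; lra.
have m0 : 0 < Num.min e d by rewrite lt_min e0.
have [N0 HN0] := pow_small (rn y1 * Q) m0.
have [N [n [NN YE]]] := HN N0.
pose ys := a ^+ N * y1.
have ysn : ys != 0 by rewrite mulf_neq0 // expf_neq0.
have pw (x : Cplx R) (i : nat) : rn x <= 1/2 -> rn (x ^+ i) <= 1.
  by move=> xb; rewrite rnX; apply: exprn_ile1; [exact: rn_ge0|clear -xb; lra].
have ysQ : rn ys * Q < Num.min e d.
  apply: le_lt_trans HN0; rewrite /ys rnM rnX -mulrA mulrC; apply: ler_wpM2l.
    by rewrite mulr_ge0 ?rn_ge0 // ltW.
  apply: (@le_trans _ _ ((1/2) ^+ N)); first by apply: lerXn2r; rewrite ?nnegrE ?rn_ge0 //; clear -a2; lra.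
  rewrite -exprVn div1r; apply: ler_wiXn2l => //; clear; lra.
have [ysQe ysQd] : rn ys * Q < e /\ rn ys * Q < d.
  by move: ysQ; rewrite lt_min => /andP[].
have ys0 := rn_ge0 ys.
have qE : rn ys * Q = rn ys * (l%:R * rn so) + 10 * (rn s * rn ys) + 2 * (rn so * rn ys) + rn ys.
  by rewrite /Q; ring.
have q1 : 0 <= rn ys * (l%:R * rn so) by rewrite mulr_ge0.
have q2 : 0 <= rn s * rn ys by rewrite mulr_ge0.
have q3 : 0 <= rn so * rn ys by rewrite mulr_ge0.
have y00 := rn_ge0 y0; have y10 := rn_ge0 y1.
have dd' : 3 * d <= dl by clear -dE Gd GdE Ad Bd d0; lra.
have y0dl : rn y0 < dl by clear -dd' y0d d0; lra.
have y1dl : rn y1 < dl by clear -dd' y1d d0; lra.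
have [g1 [g1b H1]] := iter_contr Er Et n a2 Ma y0dl; rewrite AE in g1b H1.
pose ya := a ^+ n * y0.
have yab : rn ya <= rn y0 by rewrite /ya rnM ler_piMl // pw.
have yadl : rn ya < dl by clear -yab y0dl; lra.
have [g2 [g2b H2]] := iter_contr Er Et j b2 Mb yadl; rewrite BE in g2b H2.
have Bya := ler_wpM2l B0 yab.
pose yb := b ^+ j * ya.
have ybE : rn yb = rn ys by rewrite /ys YE rnM rnX o1 expr1n mul1r.
have ysd : rn ys < d by clear -ysQd qE q1 q2 q3; lra.
have ysdl : rn ys < dl by clear -ysd dd' d0; lra.
have ybdl : rn yb < dl by rewrite ybE.
have [g3 [g3b H3]] := iter_rot Er Et l o1 Mo ybdl; rewrite ybE in g3b H3.
have lE : l%:R * rn so * rn ys = rn ys * (l%:R * rn so) by rewrite mulrC.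
rewrite lE in g3b H3.
have [g4 [g4b H4]] := iter_contr Er Et N a2 Ma y1dl; rewrite AE in g4b H4.
pose za := z0 + g1; pose zb := za + g2; pose zc := zb + g3.
have zab : rn za <= rn z0 + rn g1 by exact: rnD.
have zbb : rn zb <= rn za + rn g2 by exact: rnD.
have zcb : rn zc <= rn zb + rn g3 by exact: rnD.
(* Undoing the contractions of y1 subtracts g4, so the lattice moves aim at z1 + g4. *)
pose w := z1 + g4.
have wb : rn w <= rn z1 + rn g4 by exact: rnD.
have wz : rn (w - zc) <= rn w + rn zc by exact: rnB.
have lsd : rn ys * (l%:R * rn so) <= d by clear -ysQd qE q2 q3 ys0; lra.
have [za1 zb1] : rn za <= d + A * d /\ rn zb <= d + A * d + B * d.
  by clear -zab zbb g1b g2b Ay0 By0 Bya z0d; split; lra.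
have zc1 : rn zc <= 2 * d + A * d + B * d by clear -zcb zb1 g3b lsd; lra.
have w1 : rn w <= d + A * d by clear -wb g4b z1d Ay1; lra.
have wzG : rn (w - zc) <= G * d by clear -wz w1 zc1 GdE Ad; lra.
have c4 : 4 * c * rn (w - zc) <= 4 * (c * G * d).
  by clear -wzG c1; rewrite -!mulrA ler_pM2l // ler_pM2l //; lra.
have [|z' [z'b Hz]] := Hc ys zc w ysn ysdl.
  have -> : (8 * rn s + 2 * rn so) * rn ys = 8 * (rn s * rn ys) + 2 * (rn so * rn ys) by ring.
  clear -zc1 c4 ysQd qE q1 q2 q3 dE Gd GdE Ad Bd ys0 d0; lra.
have z'w : rn (z' - w) < Num.min e d.
  by apply: le_lt_trans ysQ; clear -z'b qE q1 q3 ys0 q2; rewrite -mulrA in z'b; lra.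
exists (z' - g4); have zE : z' - g4 - z1 = z' - w by rewrite /w opprD addrA addrAC.
rewrite zE; have [z'e z'd] : rn (z' - w) < e /\ rn (z' - w) < d.
  by move: z'w; rewrite lt_min => /andP[].
split => //.
have zz : rn (z' - g4) <= rn (z' - w) + rn z1.
  by rewrite -zE; have := rnBB (z' - g4) z1; clear; lra.
apply: (Et _ _ _ _ _ _ (H1 z0 _)); first by clear -Ay0 z0d dE Gd GdE Ad Bd d0; lra.
apply: (Et _ _ _ _ _ _ (H2 za _)); first by clear -Bya By0 za1 dE Gd GdE Ad Bd d0; lra.
apply: (Et _ _ _ _ _ _ (H3 zb _)); first by clear -lsd zb1 dE Gd GdE Ad Bd d0; lra.
have ysE : om ^+ l * (b ^+ j * (a ^+ n * y0)) = ys by rewrite /ys YE.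
rewrite /yb /ya ysE; apply: (Et _ _ _ _ _ _ Hz); apply: Es.
have := H4 (z' - g4); rewrite subrK; apply; clear -zz z'd z1d Ay1 dE Gd GdE Ad Bd d0; lra.
Qed.

(** * Multipliers generating a dense subgroup *)

Section Multipliers.
Context {R : realType}.
Local Notation C := (Cplx R).
Local Notation q := (Num.sqrt 2 : R).
Local Notation P := (Ci R * toC (2 * pi)).

Lemma cexpX (z : C) n : cexp z ^+ n = cexp (n%:R * z).
Proof.
elim: n => [|n IH]; first by rewrite expr0 mul0r cexp0.
by rewrite exprS IH -cexpD -natr1; congr cexp; ring.
Qed.

Lemma cexp_period (m : int) : cexp (P * toC m%:~R) = 1 :> C.
Proof.
have H (n : nat) : cexp (P * toC n%:R) = 1 :> C.
  rewrite toC_nat mulrC -cexpX.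
  by have := @cexp_2pi R 0; rewrite add0r cexp0 => ->; rewrite expr1n.
case: m => n; first exact: H.
by rewrite NegzE mulrNz toCN mulrN cexpNV -[n.+1%:~R]/(n.+1%:R) H invr1.
Qed.

(** In logarithms the equation reads log (y / y0) = - 2 pi (n - N + j sqrt 2) + 2 i pi l sqrt 2
    modulo 2 i pi, so [sqrt2_dense] treats the real and imaginary parts separately. Only n - N is
    prescribed, which leaves N free to be large. *)
Lemma multiplier_dense (y0 y1 : C) (e : R) : y0 != 0 -> 0 < e -> exists y : C,
  [/\ y != 0, rn (y - y1) < e & exists j l : nat, forall N0, exists N n : nat, (N0 <= N)%N /\
   cexp (Ci R * P) ^+ N * y =
   cexp (toC q * P) ^+ l * (cexp (Ci R * toC q * P) ^+ j * (cexp (Ci R * P) ^+ n * y0))].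
Proof.
move=> y00 e0; have pi0 : 0 < pi :> R by exact: pi_gt0.
(* The target y1 may be 0 and then has no logarithm, so it is first moved off 0. *)
have [y2 y20 y2e] : exists2 y2 : C, y2 != 0 & rn (y2 - y1) <= e / 2.
  have [->|y10] := eqVneq y1 0; last by exists y1 => //; rewrite subrr rn0 divr_ge0 ?ltW.
  exists (toC (e / 2)); first by rewrite toC_eq0; apply/eqP; lra.
  by rewrite subr0 rn_toC gtr0_norm // divr_gt0.
have [w wE] : exists w, cexp w = y2 / y0 by apply: cexp_surj; rewrite mulf_neq0 // invr_neq0.
have n0 : 0 < rn y0 by rewrite rn_gt0.
have e1 : 0 < e / 2 / rn y0 by rewrite divr_gt0 // divr_gt0.
have [d d0 Hd] := differentiable_cont (cder_diff (cder_cexp w)) e1.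
have eta0 : 0 < d / (8 * pi) by rewrite divr_gt0 // mulr_gt0.
have [i1 [j Hj]] := sqrt2_dense (- (rRe w / (2 * pi))) eta0.
have [m [l Hl]] := sqrt2_dense (rIm w / (2 * pi)) eta0.
have p2 : 2 * pi != 0 :> R by apply/eqP; lra.
pose u := i1%:~R + j%:R * q; pose v := m%:~R + l%:R * q.
pose w' : C := toC (- (2 * pi * u)) + Ci R * toC (2 * pi * v).
have ww : rn (w' - w) < d.
  have h0 : 2 * pi * (d / (8 * pi)) = d / 4.
    by field; apply/eqP; lra.
  apply: le_lt_trans (rn_le _) _; rewrite /w' !cE.
  have -> : - (2 * pi * u) + (0 * (2 * pi * v) - 1 * 0) - rRe w = - (2 * pi * (u - - (rRe w / (2 * pi)))).
    by field; apply/eqP; lra.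
  have -> : 0 + (0 * 0 + 1 * (2 * pi * v)) - rIm w = 2 * pi * (v - rIm w / (2 * pi)).
    by field; apply/eqP; lra.
  have pp : 0 < 2 * pi :> R by lra.
  rewrite normrN !normrM ger0_norm; last by lra.
  rewrite [`|pi|]gtr0_norm //.
  have := ler_wpM2l (ltW pp) (ltW Hj); have := ler_wpM2l (ltW pp) (ltW Hl); rewrite h0 -/u -/v; lra.
exists (cexp w' * y0); split; first by rewrite mulf_neq0 // cexp_neq0.
  have -> : cexp w' * y0 - y1 = (cexp w' - cexp w) * y0 + (y2 - y1).
    by rewrite wE mulrBl divfK //; ring.
  apply: le_lt_trans (rnD _ _) _; rewrite rnM.
  have := Hd w' ww; rewrite ltr_pdivlMr //; lra.
exists j, l => N0.
have [N [n [NN nE]]] : exists N n : nat, (N0 <= N)%N /\ n%:R = N%:R + i1%:~R :> R.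
  case: (i1) => k.
    by exists (N0 + k)%N, (N0 + k + k)%N; rewrite leq_addr !natrD.
  exists (N0 + k.+1)%N, N0; rewrite leq_addr natrD NegzE mulrNz -[k.+1%:~R]/(k.+1%:R).
  by rewrite addrK.
exists N, n; split => //.
have EE : N%:R * (Ci R * P) + w' = l%:R * (toC q * P) + j%:R * (Ci R * toC q * P) +
    n%:R * (Ci R * P) + P * toC m%:~R.
  have tn i : i%:R = toC (i%:R : R) :> C by rewrite toC_nat.
  by rewrite /w' /u /v (tn N) (tn l) (tn j) (tn n) nE; apply: C_ext; rewrite !cE; ring.
have := congr1 (@cexp R) EE; rewrite !cexpD cexp_period mulr1 !cexpX.
move: (cexp (N%:R * _)) (cexp w') (cexp (l%:R * _)) (cexp (j%:R * _)) (cexp (n%:R * _)).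
by move=> x1 x2 x3 x4 x5 H; rewrite mulrA H; ring.
Qed.

Lemma multiplier_a : rn (cexp (Ci R * P)) <= 1/2 /\ rn (cexp (Ci R * toC q * P)) <= 1/2.
Proof.
have [_ q1 _] := @sqrt2 R; have p2 : 2 <= pi :> R by exact: pi_ge2.
have b x : 2 <= x -> expR (- x) <= 1/2 :> R.
  move=> x2; rewrite expRN; have := expR_ge1Dx x => h.
  by rewrite -div1r ler_pdivrMr ?expR_gt0 //; lra.
split; rewrite rn_cexp !cE.
  have -> : 0 * (0 * (2 * pi) - 1 * 0) - 1 * (0 * 0 + 1 * (2 * pi)) = - (2 * pi) :> R by ring.
  by apply: b; lra.
have -> : (0 * q - 1 * 0) * (0 * (2 * pi) - 1 * 0) - (0 * 0 + 1 * q) * (0 * 0 + 1 * (2 * pi)) = - (2 * pi * q) :> R by ring.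
apply: b; nra.
Qed.

Lemma multiplier_om : rn (cexp (toC q * P)) = 1 /\ rIm (cexp (toC q * P)) != 0.
Proof.
have [_ q1 q2] := @sqrt2 R; have pi0 : 0 < pi :> R by exact: pi_gt0.
split; first by rewrite rn_cexp !cE (_ : _ - _ = 0) ?expR0 //; ring.
rewrite cexp_Im !cE mulf_neq0 //; first by rewrite gt_eqF // expR_gt0.
have -> : q * (0 * 0 + 1 * (2 * pi)) + 0 * (0 * (2 * pi) - 1 * 0) = (q * (2 * pi) - 2 * pi) + pi *+ 2 by rewrite mulr2n; ring.
rewrite sinD2pi gt_eqF //; apply: sin_gt0_pi; nra.
Qed.

End Multipliers.

(** * The model field with four poles *)

Section Model.
Context {R : realType}.
Local Notation C := (Cplx R).
Local Notation V := (C3 R).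
Local Notation q := (Num.sqrt 2 : R).
Local Notation P := (Ci R * toC (2 * pi)).

Definition pole (j : 'I_4) : C := nth 0 [:: 1; Ci R; -1; - Ci R] j.
(** In the order of the poles 1, i, -1, -i: the rotation, the two contractions, the translation. *)
Definition expo (j : 'I_4) : C := nth 0 [:: toC q; Ci R; Ci R * toC q; -1] j.
(** A union of punctured discs rather than the plane minus the poles: being bounded, it fits into a
    chart of finite size. *)
Definition model_base : set C := [set x | exists j, 0 < rn (x - pole j) < 5/4].
Definition model_coef (x : C) : C := \sum_j expo j / (x - pole j).

Lemma ord4P (Q : 'I_4 -> Prop) :
  Q (inord 0) -> Q (inord 1) -> Q (inord 2) -> Q (inord 3) -> forall i, Q i.
Proof.
move=> h0 h1 h2 h3 i; rewrite -(inord_val i); case: i => [[|[|[|[|i]]]] ip] //=.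
Qed.

Lemma rn_pole j : rn (pole j) = 1.
Proof. by move: j; apply: ord4P; rewrite /pole inordK //= ?rnN ?rn1 ?rn_i. Qed.

Lemma pole_dist i j : i != j -> 5/4 <= rn (pole i - pole j).
Proof.
have H (z : C) : 25/16 <= rRe z ^+ 2 + rIm z ^+ 2 -> 5/4 <= rn z.
  rewrite -rnS => h; have := rn_ge0 z; nra.
move=> ij; apply: H; move: i j ij.
apply: ord4P; apply: ord4P; rewrite -val_eqE /= /pole !inordK //= => _; rewrite !cE !expr2; lra.
Qed.

Lemma model_base_pole x : model_base x -> forall i, x != pole i.
Proof.
move=> [j /andP[x0 x1]] i; apply: contraTneq x1 => E; move: x0; rewrite E => x0.
have [ij|ij] := eqVneq i j; first by move: x0; rewrite ij subrr rn0 ltxx.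
by rewrite -leNgt; exact: pole_dist.
Qed.

Lemma holo_frac (U : set C) (a p : C) : (forall x, U x -> x != p) -> holo U (fun x => a / (x - p)).
Proof.
move=> Up x Ux; have x0 : x - p != 0 by rewrite subr_eq0; exact: Up.
have Dx : differentiable (fun x : C => x - p) x.
  by apply: cder_diff; exact: (cderB (cder_id x) (cder_cst p x)).
have DV : differentiable (fun x : C => (x - p)^-1) x by exact: differentiableV.
by have [] := dd_Z (1 : C) a DV.
Qed.

Lemma holo_sum (U : set C) (Q : pred 'I_4) : (forall x, U x -> forall i, Q i -> x != pole i) ->
  holo U (fun x => \sum_(i | Q i) expo i / (x - pole i)).
Proof.
move=> HU; elim: (index_enum _) => [|i r IH].
  move=> x Ux; under eq_fun => y do rewrite big_nil.
  exact: differentiable_cst.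
move=> x Ux; have [Qi|Qi] := boolP (Q i); last first.
  by under eq_fun => y do rewrite big_cons (negbTE Qi); exact: IH.
under eq_fun => y do rewrite big_cons Qi.
apply: differentiableD; last exact: IH.
by apply: (@holo_frac U _ (pole i)) => // y /HU; apply.
Qed.

Lemma model_coef_holo : holo model_base model_coef.
Proof. by apply: holo_sum => x /model_base_pole H i _. Qed.

Lemma model_base_open : open model_base.
Proof.
apply/rn_open => x [j /andP[x0 x1]].
exists (Num.min (rn (x - pole j)) (5/4 - rn (x - pole j))); split; first by rewrite lt_min x0 subr_gt0.
move=> y; rewrite lt_min => /andP[h1 h2]; exists j.
by have := rn_tri y x (pole j); have := rn_tri x y (pole j); rewrite [rn (x - y)]rnC; lra.
Qed.

Lemma model_base_ball (x : C) : rn x < 1/4 -> model_base x.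
Proof.
move=> xr; exists ord0; have := rn_pole ord0.
have := rnB x (pole ord0); have := rnBB (pole ord0) x; rewrite [rn (pole _ - _)]rnC; lra.
Qed.

Lemma model_base_bd x : model_base x -> rn x < 9/4.
Proof.
move=> [j /andP[_ h]]; have := rn_pole j; have := rnBB x (pole j); lra.
Qed.

Lemma model_holonomy j : exists (B : R) (s : C), 0 < B /\
  (forall y z, rn y * B < 1 -> rn z + rn y * B < 1 ->
     same_leaf model_base model_coef (row3 0 y z) (row3 0 (cexp (expo j * P) * y) (z + s * y))) /\
  (expo j = -1 -> s != 0).
Proof.
apply: (@holonomy R model_base model_coef (fun x => \sum_(i | i != j) expo i / (x - pole i)) (pole j)).
- exact: model_base_open.
- exact: model_coef_holo.
- exact: rn_pole.
- by move=> x xj; split; [exists j|rewrite /model_coef (bigD1 j)].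
apply: holo_sum => x /= xj i ij; apply: contraTneq xj => ->.
by rewrite -leNgt; exact: pole_dist.
Qed.

Lemma model_moves : exists dl : R, exists sa sb so s : C,
  let E := fun y z y' z' => same_leaf model_base model_coef (row3 0 y z) (row3 0 y' z') in
  [/\ 0 < dl, s != 0, small_move E dl (cexp (Ci R * P)) sa, small_move E dl (cexp (Ci R * toC q * P)) sb &
      small_move E dl (cexp (toC q * P)) so /\ small_move E dl 1 s].
Proof.
have [B0 [so [b0 [H0 _]]]] := model_holonomy (inord 0).
have [B1 [sa [b1 [H1 _]]]] := model_holonomy (inord 1).
have [B2 [sb [b2 [H2 _]]]] := model_holonomy (inord 2).
have [B3 [s [b3 [H3 s0]]]] := model_holonomy (inord 3).
rewrite /expo !inordK //= in H0 H1 H2 H3 s0.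
pose B := B0 + B1 + B2 + B3 + 1; have Bp : 1 < B by rewrite /B; lra.
(* With this radius |y| B < 1/2 and |z| < 1/2, as B > 1, so all four return maps are defined. *)
exists (1 / (2 * B)), sa, sb, so, s => E.
have dl0 : 0 < 1 / (2 * B) by rewrite divr_gt0 //; lra.
have dlB : 1 / (2 * B) * B = 1/2 by field; apply/eqP; lra.
have dl1 : 1 / (2 * B) <= 1/2 by rewrite -dlB ler_peMr; lra.
have fin mu t B' : 0 < B' -> B' <= B -> (forall y z, rn y * B' < 1 -> rn z + rn y * B' < 1 ->
     same_leaf model_base model_coef (row3 0 y z) (row3 0 (mu * y) (z + t * y))) -> small_move E (1 / (2 * B)) mu t.
  move=> B'0 B'B H y z yd zd; apply: H.
    have := ler_wpM2l (rn_ge0 y) B'B; have := ltr_pM2r (lt_trans ltr01 Bp) (rn y) (1 / (2 * B)).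
    by rewrite yd dlB => h; lra.
  have := ler_wpM2l (rn_ge0 y) B'B; have := ltr_pM2r (lt_trans ltr01 Bp) (rn y) (1 / (2 * B)).
  by rewrite yd dlB => h; lra.
split; [exact: dl0|exact: s0|apply: (fin _ _ B1); rewrite /B //; lra|apply: (fin _ _ B2); rewrite /B //; lra|].
split; first by apply: (fin _ _ B0); rewrite /B //; lra.
apply: (fin _ _ B3) => //; first by rewrite /B; lra.
(* For the exponent -1 the multiplier is exp (- 2 i pi) = 1, which leaves a pure translation. *)
by move=> y z h1 h2; have := H3 y z h1 h2; rewrite mulN1r cexpNV -[P]mulr1 -toC1 (cexp_period 1) invr1.
Qed.

End Model.

Section ModelDense.
Context {R : realType}.
Local Notation C := (Cplx R).
Local Notation V := (C3 R).

(** Transport along leaves between the fibre x = 0 and nearby fibres; the bound on exp (- K)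
    controls the transport back. *)
Lemma base_flow : exists (r : R) (K W : C -> C), 0 < r /\
  forall x, rn x < r ->
    [/\ rn (cexp (K x)) <= 2, rn (cexp (- K x)) <= 2, rn (W x) <= 1 &
    forall y z, rn y < 1/4 -> rn z < 1/4 ->
      same_leaf (@model_base R) (@model_coef R) (row3 0 y z) (row3 x (y * cexp (K x)) (z + y * W x))].
Proof.
have D0 : model_base (0 : C) by apply: model_base_ball; rewrite rn0; lra.
have [r [K [W [r0 K0 W0 H]]]] := local_flow (@model_base_open R) (@model_coef_holo R) D0.
have xr0 : rn (0 - 0 : C) < r by rewrite subrr rn0.
have [_ dK _ _ _] := H 0 xr0.
have [d d0 Hd] := differentiable_cont (cder_diff (cder_exp (cderN dK))) ltr01.
exists (Num.min r d), K, W; split; first by rewrite lt_min r0.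
move=> x; rewrite lt_min => /andP[xr xd].
have xr' : rn (x - 0) < r by rewrite subr0.
have [_ _ _ K2 W1] := H x xr'; split => //.
  have := Hd x; rewrite subr0 K0 oppr0 cexp0 => /(_ xd).
  by have := rnBB (cexp (- K x)) 1; rewrite rn1; lra.
move=> y z y4 z4; apply: (@flow_same_leaf R model_base model_coef 0 r K W y z x K0 W0) => //.
  by move=> u /H [].
move=> u /H [_ _ _ Ku Wu]; have y0 := rn_ge0 y.
have h1 := ler_wpM2l y0 Ku; have h2 := ler_wpM2l y0 Wu.
split; first by rewrite rnM; lra.
by apply: le_lt_trans (rnD _ _) _; rewrite rnM; lra.
Qed.

(** Both points are pulled back along their leaves to the fibre x = 0, joined there approximately by
    [orbit_dense], and the result is pushed out to the x-coordinate of the target. *)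
Lemma model_dense : exists d : R, 0 < d /\ forall p p' : V, rn p < d -> rn p' < d -> p 0 o1 != 0 ->
  forall e : R, 0 < e -> exists p'', same_leaf (@model_base R) (@model_coef R) p p'' /\ rn (p'' - p') < e.
Proof.
have [r [K [W [r0 HK]]]] := base_flow.
have [dl [sa [sb [so [s [dl0 s0 Ma Mb [Mo Ms]]]]]]] := @model_moves R.
have [a2 b2] := @multiplier_a R; have [om1 oi] := @multiplier_om R.
have [d1 [d10 Hd]] := orbit_dense (fun y z => @same_leaf_refl R model_base model_coef (row3 0 y z))
  (fun y z y' z' => @same_leaf_sym R model_base model_coef (row3 0 y z) (row3 0 y' z'))
  (fun y1 z1 y z y2 z2 => @same_leaf_trans R model_base model_coef (row3 0 y1 z1) (row3 0 y z) (row3 0 y2 z2))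
  dl0 a2 b2 om1 oi s0 Ma Mb Mo Ms.
pose m := Num.min r (Num.min d1 (1/4)).
have m0 : 0 < m by rewrite !lt_min r0 d10 divr_gt0.
have mr : m <= r by rewrite ge_min lexx.
have md : m <= d1 by rewrite !ge_min lexx !orbT.
have m4 : m <= 1/4 by rewrite !ge_min lexx !orbT.
(* Pulling back gives |y| <= 2 d and |z| <= 3 d, and the approximations add 2 d at most; everything
   stays below 8 d = m. *)
have [d d0 dE] : exists2 d : R, 0 < d & 8 * d = m by exists (m / 8); [rewrite divr_gt0|field].
exists d; split => // p p' pd p'd py e e0.
have pull (v : V) : rn v < d -> exists y z : C, [/\ rn y <= 2 * d, rn z <= 3 * d,
    v = row3 (v 0 o0) (y * cexp (K (v 0 o0))) (z + y * W (v 0 o0)) & v 0 o1 != 0 -> y != 0].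
  move=> vd; have v0 := rn_entry v 0 o0; have v1 := rn_entry v 0 o1; have v2 := rn_entry v 0 o2.
  have [|K1 K2 W1 _] := HK (v 0 o0); first by clear -vd v0 mr dE d0; lra.
  set x := v 0 o0 in v0 K1 K2 W1 *; pose y := v 0 o1 * cexp (- K x).
  have yb : rn y <= 2 * d.
    rewrite /y rnM; have := rn_ge0 (cexp (- K x)); have := rn_ge0 (v 0 o1).
    by clear -v1 vd K2; nra.
  have yW : rn (y * W x) <= 2 * d.
    by rewrite rnM; have := ler_wpM2l (rn_ge0 y) W1; clear -yb; lra.
  exists y, (v 0 o2 - y * W x); split => //.
  - by apply: le_trans (rnB _ _) _; clear -yW v2 vd; lra.
  - rewrite subrK /y -mulrA [cexp (- _) * _]mulrC cexpN mulr1; apply/esym; exact: row3_eta.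
  - by move=> y0; rewrite mulf_neq0 // cexp_neq0.
have [y0 [z0 [y0b z0b pE y0n]]] := pull p pd.
have [y1 [z1 [y1b z1b p'E _]]] := pull p' p'd.
have x0 : rn (p 0 o0) < r by apply: le_lt_trans (rn_entry _ _ _) _; clear -pd dE mr d0; lra.
have x1 : rn (p' 0 o0) < r by apply: le_lt_trans (rn_entry _ _ _) _; clear -p'd dE mr d0; lra.
pose e' := Num.min (e / 4) d.
have e'0 : 0 < e' by rewrite lt_min d0 divr_gt0.
have e'e : e' <= e / 4 by rewrite ge_min lexx.
have e'd : e' <= d by rewrite ge_min lexx orbT.
have [y2 [y2n y2e [j [l Hjl]]]] := multiplier_dense y1 (y0n py) e'0.
have y2b : rn y2 < 4 * d by have := rnBB y2 y1; clear -y2e y1b e'd d0; lra.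
have [|||||z2 [z2e Hz]] := Hd y0 z0 y2 z1 _ _ _ _ y2n _ (cexp_neq0 _) e' e'0.
- by clear -y0b dE md d0; lra.
- by clear -z0b dE md d0; lra.
- by clear -y2b dE md d0; lra.
- by clear -z1b dE md d0; lra.
- by exists j, l.
have z2b : rn z2 < 5 * d by have := rnBB z2 z1; clear -z2e z1b e'd d0; lra.
have [_ _ _ M0] := HK _ x0; have [K1 _ W1 M1] := HK _ x1.
set x' := p' 0 o0 in x1 K1 W1 M1 p'E.
exists (row3 x' (y2 * cexp (K x')) (z2 + y2 * W x')); split.
  rewrite {1}pE; apply: (same_leaf_trans (same_leaf_sym (M0 y0 z0 _ _))).
  - by clear -y0b dE m4 d0; lra.
  - by clear -z0b dE m4 d0; lra.
  apply: (same_leaf_trans Hz); apply: M1.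
  - by clear -y2b dE m4 d0; lra.
  - by clear -z2b dE m4 d0; lra.
have yy := rn_ge0 (y2 - y1).
apply: (@le_lt_trans _ _ (e / 2)); last by clear -e0; lra.
rewrite {1}p'E; apply: rn_mx_le; first by clear -e0; lra.
move=> i; rewrite (ord1 i); apply: ord3P; rewrite !mxE /=.
- by rewrite subrr rn0; clear -e0; lra.
- rewrite -mulrBl rnM; have := ler_wpM2l yy K1; clear -y2e e'e e0; lra.
- have -> : z2 + y2 * W x' - (z1 + y1 * W x') = (z2 - z1) + (y2 - y1) * W x' by ring.
  apply: le_trans (rnD _ _) _; rewrite rnM; have := ler_wpM2l yy W1; clear -z2e y2e e'e e0; lra.
Qed.

End ModelDense.

(** * Continuity and topology of the model domain *)

Section Cont.
Context {R : realType}.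
Local Notation C := (Cplx R).
Local Notation V := (C3 R).

Lemma row_cont (W : normedModType C) (F : W -> V) x (e : R) :
  (forall i, differentiable (fun X => F X 0 i) x) -> 0 < e ->
  exists2 d : R, 0 < d & forall y, rn (y - x) < d -> rn (F y - F x) < e.
Proof.
move=> H e0; have e2 : 0 < e / 2 by rewrite divr_gt0.
have [d0 d00 H0] := differentiable_cont (H o0) e2.
have [d1 d10 H1] := differentiable_cont (H o1) e2.
have [d2 d20 H2] := differentiable_cont (H o2) e2.
exists (Num.min d0 (Num.min d1 d2)); first by rewrite !lt_min d00 d10.
move=> y; rewrite !lt_min => /and3P[/H0 h0 /H1 h1 /H2 h2].
apply: (@le_lt_trans _ _ (e / 2)); last by lra.
apply: rn_mx_le; first exact: ltW.
by move=> i j; rewrite (ord1 i); move: j; apply: ord3P; rewrite !mxE ltW.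
Qed.

Lemma eps_continuous (W W' : normedModType C) (F : W -> W') x :
  (forall e : R, 0 < e -> exists2 d : R, 0 < d & forall y, rn (y - x) < d -> rn (F y - F x) < e) ->
  {for x, continuous F}.
Proof.
move=> H A /rn_nbhs[e [e0 HA]]; have [d d0 Hd] := H e e0.
by apply/rn_nbhs; exists d; split => // y /Hd; exact: HA.
Qed.

Lemma cder_coord (g : C -> C) (m : V) i l : cder g (m 0 i) l ->
  hasD (fun m : V => g (m 0 i)) m (fun v => v 0 i * l).
Proof.
move=> [_ _ D]; split.
- by move=> a u v; rewrite !mxE /GRing.scale /=; ring.
- by exists (rn l) => v; rewrite rnM mulrC; apply: ler_wpM2l; rewrite ?rn_ge0 ?rn_entry.
move=> e e0; have [d d0 Hd] := D e e0; exists d => // h hd.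
have h1 : rn (h 0 i) < d by apply: le_lt_trans hd; exact: rn_entry.
rewrite mxE; apply: le_trans (Hd _ h1) _; apply: ler_wpM2l; [exact: ltW|exact: rn_entry].
Qed.

Lemma cder_curve (phi : C -> V) (g : V -> C) (t : C) L : is_derive t 1 phi L ->
  differentiable g (phi t) -> cder (fun t => g (phi t)) t (dd g (phi t) L).
Proof.
move=> D dg; have H i := (cderE _ _ _).1 (is_derive_row D i).
have [D1 D2] := @dd_chain R C 3 g phi t (fun i => (H i).1) dg.
by apply/cderE; split => //; rewrite D2; congr dd; apply/rowP => i; rewrite mxE; have [] := H i.
Qed.

Lemma model_domain_open (D : set C) : open D -> open (model_domain D).
Proof.
move=> oD; apply/rn_open => m [model_base m1 m2]; have [r [r0 HD]] := open_ball oD model_base.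
exists (Num.min r (Num.min (1 - rn (m 0 o1)) (1 - rn (m 0 o2)))).
split; first by rewrite !lt_min r0 !subr_gt0 m1.
move=> u; rewrite !lt_min => /and3P[h0 h1 h2].
have en i : rn (u 0 i - m 0 i) <= rn (u - m).
  by have := rn_entry (u - m) 0 i; rewrite !mxE.
have b1 := en o1; have b2 := en o2.
have c1 := rnBB (u 0 o1) (m 0 o1); have c2 := rnBB (u 0 o2) (m 0 o2).
split; [|by lra|by lra].
by apply: HD; apply: le_lt_trans h0; exact: en.
Qed.

(** Each punctured disc is the image of a half-plane under w -> pole + exp w, hence connected with
    the bidisc factor; the four pieces share the origin. *)
Lemma model_domain_connected : connected (model_domain (@model_base R)).
Proof.
pose F j (m : V) : V := row3 (pole j + cexp (m 0 o0)) (m 0 o1) (m 0 o2).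
have l0 : 0 < ln (5/4) :> R by rewrite ln_gt0 //; lra.
pose G : set V := [set m | [/\ rRe (m 0 o0) < ln (5/4), rn (m 0 o1) < 1 & rn (m 0 o2) < 1]].
have GF j : connected (F j @` G).
  apply: connected_continuous_connected.
    apply: (@star_connected R V G 0).
      by split; rewrite mxE ?rRe0 ?rn0.
    move=> m [h0 h1 h2] s s01; rewrite subr0 add0r.
    have sm (z : C) : rn z < 1 -> rn (toC s * z) < 1.
      move=> z1; rewrite rnM rn_toC ger0_norm; last by lra.
      by apply: le_lt_trans z1; rewrite ler_piMl ?rn_ge0 //; lra.
    split; rewrite mxE; [|exact: sm|exact: sm].
    rewrite !cE mul0r subr0; have [h|h] := lerP 0 (rRe (m 0 o0)).
      by apply: le_lt_trans h0; rewrite ler_piMl //; lra.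
    apply: le_lt_trans l0; apply: mulr_ge0_le0; [lra|exact: ltW].
  apply: continuous_subspaceT => m; apply: eps_continuous => e e0.
  have e2 : 0 < e / 2 by rewrite divr_gt0.
  have [d d0 Hd] := differentiable_cont (cder_diff (cder_cexp (m 0 o0))) e2.
  exists (Num.min d (e / 2)); first by rewrite lt_min d0.
  move=> u; rewrite lt_min => /andP[h1 h2].
  have en i : rn (u 0 i - m 0 i) <= rn (u - m).
    by have := rn_entry (u - m) 0 i; rewrite !mxE.
  apply: (@le_lt_trans _ _ (e / 2)); last by lra.
  apply: rn_mx_le; first exact: ltW.
  move=> i j'; rewrite (ord1 i); move: j'; apply: ord3P; rewrite !mxE /=.
  - have -> : pole j + cexp (u 0 o0) - (pole j + cexp (m 0 o0)) = cexp (u 0 o0) - cexp (m 0 o0) by ring.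
    by apply: ltW; apply: Hd; apply: le_lt_trans h1; exact: en.
  - by apply: le_trans (ltW h2); exact: en.
  - by apply: le_trans (ltW h2); exact: en.
have -> : model_domain (@model_base R) = \bigcup_(j in setT) (F j @` G).
  apply/seteqP; split => m.
    move=> [[j /andP[x0 x1]] m1 m2]; exists j => //.
    have [|w wE] := cexp_surj (z := m 0 o0 - pole j); first by rewrite -rn_gt0.
    exists (row3 w (m 0 o1) (m 0 o2)); last first.
      by rewrite /F !row3E wE addrC subrK row3_eta.
    split; rewrite !row3E //.
    by rewrite -ltr_expR lnK ?posrE // -rn_cexp wE.
  move=> [j _ [u [u0 u1 u2] <-]]; rewrite /F; apply/model_domain_row3; split => //.
  exists j; rewrite [pole j + _]addrC addrK rn_cexp expR_gt0 /=.
  by rewrite -[X in _ < X]lnK ?posrE // ltr_expR.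
apply: bigcup_connected => //.
exists (0 : V); rewrite /bigcap /= => j _; have /cexp_surj[w wE] : - pole j != 0 :> C by rewrite -rn_gt0 rnN rn_pole.
have w0 : rRe w = 0.
  by apply: expR_inj; rewrite -rn_cexp wE rnN rn_pole expR0.
exists (row3 w 0 0); first by split; rewrite !row3E ?rn0 // w0.
rewrite /F !row3E wE subrr; apply/rowP; apply: ord3P; rewrite row3E mxE //.
Qed.

(** This is where the radius 4 of the contact chart comes from: the chart has to cover the whole
    model domain. *)
Lemma model_domain_bd (m : V) : model_domain (@model_base R) m -> rn m < 4.
Proof.
move=> [/model_base_bd h0 h1 h2]; apply: (@le_lt_trans _ _ (9/4)); last by lra.
apply: rn_mx_le; first by lra.
by move=> i j; rewrite (ord1 i); move: j; apply: ord3P; lra.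
Qed.

Lemma model_domain_small (m : V) : rn m < 1/4 -> model_domain (@model_base R) m.
Proof.
move=> h; have en i := rn_entry m 0 i; have e0 := en o0; have e1 := en o1; have e2 := en o2.
by split; [apply: model_base_ball; lra|lra|lra].
Qed.

End Cont.

(** * Transfer to the original coordinates *)

Section Final.
Context {R : realType}.
Local Notation C := (Cplx R).
Local Notation V := (C3 R).
Local Notation Umod := (model_domain (@model_base R)).
Local Notation Zmod := (model_field (@model_coef R)).
Variables (V0 : set V) (eta : V -> C3dual R) (Th Ps : V -> V) (O : set V).
Hypothesis ch : contact_chart V0 eta 4 Th Ps O.

Let oO : open O. Proof. by have [[]] := ch. Qed.
Let O0 : O 0. Proof. by have [[]] := ch. Qed.
Let OV : O `<=` V0. Proof. by have [[]] := ch. Qed.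
Let Th0 : Th 0 = 0. Proof. by have [[]] := ch. Qed.
Let Ps0 : Ps 0 = 0. Proof. by have [[]] := ch. Qed.
Let dTh X i : O X -> differentiable (fun X => Th X 0 i) X.
Proof. have [_ [h _ _ _ _]] := ch; exact: h. Qed.
Let ThPs m : rn m < 4 -> O (Ps m) /\ Th (Ps m) = m.
Proof. have [_ [_ h _ _ _]] := ch; exact: h. Qed.
Let dPs (m : V) i : rn m < 4 -> differentiable (fun m => Ps m 0 i) m.
Proof. have [_ [_ _ h _ _]] := ch; exact: h. Qed.
Let inj X X' : O X -> O X' -> Th X = Th X' -> X = X'.
Proof. have [_ [_ _ _ h _]] := ch; exact: h. Qed.
Let PsTh X : O X -> rn (Th X) < 4 -> Ps (Th X) = X.
Proof. by move=> OX /ThPs[h1 h2]; apply: inj. Qed.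

Definition chartU : set V := [set X | O X /\ Umod (Th X)].
(** The push-forward of the model field by [Ps]. *)
Definition chartZ (X : V) : V := DV Ps (Th X) (Zmod (Th X)).
Definition chartS : set V := [set X | chartU X /\ Th X 0 o1 = 0].

Let U_Ps m : Umod m -> chartU (Ps m).
Proof. by move=> model_domain; have [h1 h2] := ThPs (model_domain_bd model_domain); split; rewrite ?h2. Qed.
Let Ps_U X : chartU X -> Ps (Th X) = X.
Proof. by move=> [OX /model_domain_bd]; exact: PsTh. Qed.

Let ball4 : open [set m : V | rn m < 4].
Proof. by have := ball_opn (0 : V) 4; under eq_fun => t do rewrite subr0. Qed.

Let dThPs m w n : rn m < 4 -> dd (fun X => Th X 0 n) (Ps m) (DV Ps m w) = w 0 n.
Proof.
move=> m4; have [OP TP] := ThPs m4.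
have [_ E] := @dd_chain R V 3 (fun X => Th X 0 n) Ps m (fun i => dPs i m4) (dTh n OP).
rewrite -E; have [c1 c2] := dd_coord m n.
by have [_ ->] := @dd_local R V (fun m => Th (Ps m) 0 n) (fun m : V => m 0 n) _ m ball4 m4
    (fun y yd => congr1 (fun M : V => M 0 n) (ThPs yd).2) c1.
Qed.

Let chartZ_Th X n : chartU X -> dd (fun X => Th X 0 n) X (chartZ X) = Zmod (Th X) 0 n.
Proof.
move=> UX; have := dThPs (Zmod (Th X)) n (model_domain_bd UX.2).
by rewrite {1}Ps_U.
Qed.

Lemma chartZ_neq0 X : chartU X -> chartZ X != 0.
Proof.
move=> UX; apply/eqP => Z0; have := chartZ_Th o0 UX.
by rewrite Z0 dd0 row3E => /eqP; rewrite eq_sym oner_eq0.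
Qed.

Lemma chartU_open : open chartU.
Proof.
apply/rn_open => X [OX UX]; have [r [r0 HO]] := open_ball oO OX.
have [e [e0 HU]] := open_ball (model_domain_open (@model_base_open R)) UX.
have [d d0 Hd] := row_cont (fun i => dTh i OX) e0.
exists (Num.min r d); split; first by rewrite lt_min r0.
by move=> y; rewrite lt_min => /andP[/HO ? /Hd /HU].
Qed.

Lemma chartU0 : chartU 0.
Proof. by split=> //; rewrite Th0; apply: model_domain_small; rewrite rn0; lra. Qed.

Lemma chartU_connected : connected chartU.
Proof.
have -> : chartU = Ps @` Umod.
  apply/seteqP; split => [X UX|X [m model_domain <-]]; last exact: U_Ps.
  by exists (Th X); [exact: UX.2|exact: Ps_U].
apply: connected_continuous_connected; first exact: model_domain_connected.
apply: continuous_in_subspaceT => m; rewrite inE => model_domain; apply: eps_continuous => e e0.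
exact: row_cont (fun i => dPs i (model_domain_bd model_domain)) e0.
Qed.

Lemma chartU_sub : chartU `<=` V0. Proof. by move=> X [/OV]. Qed.

(** In coordinates the field combines the coefficients of the model with the partial derivatives of
    [Ps], holomorphic by [holo_dd], and is then composed with [Th]. *)
Lemma chartZ_holo : holomorphic_on chartU chartZ.
Proof.
move=> X UX; apply: differentiable_row => i.
pose P j (m : V) := dd (fun m => Ps m 0 i) m (delta_mx 0 j).
pose g (m : V) := P o0 m + m 0 o1 * (model_coef (m 0 o0) * P o1 m) + m 0 o1 * P o2 m.
have E : (fun X => chartZ X 0 i) = (fun X => g (Th X)).
  apply/funext => Y; rewrite mxE /g; set m := Th Y.
  have -> : Zmod m = 1 *: delta_mx 0 o0 + (m 0 o1 * model_coef (m 0 o0)) *: delta_mx 0 o1 + m 0 o1 *: delta_mx 0 o2.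
    by apply/rowP; apply: ord3P; rewrite row3E !mxE /=; ring.
  by rewrite !ddD !ddZ mul1r mulrA.
rewrite E; have Um4 := model_domain_bd UX.2.
have hP j : differentiable (P j) (Th X).
  have hh : holo [set m : V | rn m < 4] (fun m => Ps m 0 i) by move=> m; exact: dPs.
  exact: (holo_dd (delta_mx 0 j) ball4 hh Um4).
have dk : differentiable (fun m : V => model_coef (m 0 o0)) (Th X).
  have [Dx _ _] := UX.2.
  have D : cder (@model_coef R) (Th X 0 o0) (dd (@model_coef R) (Th X 0 o0) 1).
    by apply/cderE; split => //; exact: model_coef_holo.
  by have [] := hasD_dd (cder_coord D).
have [d1 _] := dd_coord (Th X) o1.
have dg : differentiable g (Th X).
  apply: differentiableD; first apply: differentiableD.
  - exact: hP.
  - by apply: differentiableM => //; apply: differentiableM => //; exact: hP.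
  - by apply: differentiableM => //; exact: hP.
by have [] := @dd_chain R V 3 g Th X (fun j => dTh j UX.1) dg.
Qed.

Lemma chart_legendrian : legendrian eta chartU chartZ.
Proof.
move=> X UX; have [_ [_ _ _ _ h]] := ch.
rewrite -{1}(Ps_U UX); apply: h; first exact: model_domain_bd UX.2.
by rewrite !row3E mulr1.
Qed.

(** The same equation and the same connected set [chartU] serve at every point; the image of (0,
    1/8, 0) shows that the equation is not identically zero. *)
Lemma chart_hypersurface : analytic_hypersurface chartU chartS.
Proof.
split; first by move=> X [].
move=> p Up; exists chartU, (fun X => Th X 0 o1); split.
- by split => //; split => //; exact: chartU_open.
- exact: chartU_connected.
- by move=> X UX; apply: dTh; exact: UX.1.
- pose m : V := row3 0 (toC (1/8)) 0.
  have m4 : rn m < 1/4.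
    apply: (@le_lt_trans _ _ (1/8)); last by lra.
    apply: rn_mx_le; first by lra.
    move=> i j; rewrite (ord1 i); move: j; apply: ord3P; rewrite row3E ?rn0 ?rn_toC ?ger0_norm; lra.
  have model_domain := model_domain_small m4; exists (Ps m); split; first exact: U_Ps.
  have [_ ->] := ThPs (model_domain_bd model_domain); rewrite row3E toC_eq0; apply/eqP; lra.
by apply/seteqP; split => X; [move=> [[] //]|move=> [UX T0]].
Qed.

Lemma chartS0 : chartS 0.
Proof. by split; [exact: chartU0|rewrite Th0 mxE]. Qed.

(** Along an integral curve y solves the linear equation y' = k (x) y, so y exp (- K) is locally
    constant, with K a primitive of k (x) in time. The vanishing of y is thus locally constant on a
    connected set of times. *)
Lemma curve_vanish p q : on_integral_curve chartU chartZ p q ->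
  [/\ chartU p, chartU q & (Th p 0 o1 = 0 <-> Th q 0 o1 = 0)].
Proof.
move=> [T [phi [[oT cT H] [s [t [Ts Tt <- <-]]]]]].
have UT u : T u -> chartU (phi u) by case/H => -[].
split; [exact: UT|exact: UT|].
pose x u := Th (phi u) 0 o0; pose y u := Th (phi u) 0 o1.
have Dx u : T u -> cder x u 1.
  move=> Tu; have [_ D] := H u Tu; have := cder_curve D (dTh o0 (UT u Tu).1).
  by rewrite (chartZ_Th _ (UT u Tu)) row3E.
have Dy u : T u -> cder y u (y u * model_coef (x u)).
  move=> Tu; have [_ D] := H u Tu; have := cder_curve D (dTh o1 (UT u Tu).1).
  by rewrite (chartZ_Th _ (UT u Tu)) row3E.
have loc u : T u -> exists2 r : R, 0 < r & forall v, T v -> rn (v - u) < r -> (y u = 0 <-> y v = 0).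
  move=> Tu; have [r [r0 HT]] := open_ball oT Tu.
  have hk : holo [set v | rn (v - u) < r] (fun v => model_coef (x v)).
    move=> v /HT Tv; have [Dv _ _] := (UT v Tv).2.
    have Dk : cder (@model_coef R) (x v) (dd (@model_coef R) (x v) 1).
      by apply/cderE; split => //; exact: model_coef_holo.
    exact: cder_diff (cder_comp (Dx v Tv) Dk).
  have [K K0 DK] := ball_primitive r0 hk.
  exists r => // v _ vr.
  have E : y v * cexp (- K v) = y u * cexp (- K u).
    apply: (@cder_ball_cst R (fun v => y v * cexp (- K v)) u r) => // w wr.
    have := cderM (Dy w (HT w wr)) (cder_exp (cderN (DK w wr))).
    by rewrite [X in cder _ _ X -> _](_ : _ = 0) //; ring.
  split => h; move: E; rewrite h mul0r => /eqP.
    by rewrite mulf_eq0 (negbTE (cexp_neq0 _)) orbF => /eqP.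
  by rewrite eq_sym mulf_eq0 (negbTE (cexp_neq0 _)) orbF => /eqP.
have Q := @clopen_all R C T (fun u => y u = 0) cT loc.
by split => h; [exact: (Q s t)|exact: (Q t s)].
Qed.

Lemma chain_vanish p q : clos_refl_trans V (on_integral_curve chartU chartZ) p q -> chartU p ->
  chartU q /\ (Th p 0 o1 = 0 <-> Th q 0 o1 = 0).
Proof.
elim=> [a b /curve_vanish[? ? ?] //|a //|a b c _ IH1 _ IH2 Ua].
by have [Ub e1] := IH1 Ua; have [Uc e2] := IH2 Ub; split => //; rewrite e1.
Qed.

Lemma chart_invariant : invariant chartU chartZ chartS.
Proof.
move=> L [p [[Up _] ->]] [q0 [/= pq0 [_ q00]]] q /= pq.
have [_ e0] := chain_vanish pq0 Up; have [Uq e1] := chain_vanish pq Up.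
by split => //; apply/e1/e0.
Qed.

Lemma chart_curve a b : on_integral_curve Umod Zmod a b ->
  on_integral_curve chartU chartZ (Ps a) (Ps b).
Proof.
move=> [T [phi [[oT cT H] [s [t [Ts Tt fs ft]]]]]].
exists T, (fun u => Ps (phi u)); split; last by exists s, t; rewrite fs ft.
split => // u Tu; have [[Uu _] D] := H u Tu; have U4 := model_domain_bd Uu.
have UP := U_Ps Uu; split; first by split => //; exact: chartZ_neq0.
apply: row_is_derive => i; have := cder_curve D (dPs i U4).
by rewrite /chartZ (ThPs U4).2 mxE.
Qed.

Lemma chart_chain a b : same_leaf (@model_base R) (@model_coef R) a b ->
  clos_refl_trans V (on_integral_curve chartU chartZ) (Ps a) (Ps b).
Proof.
by elim=> [x y /chart_curve h|x|x y z _ h1 _ h2]; [exact: rt_step|exact: rt_refl|exact: rt_trans h1 h2].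
Qed.

(** The set [Ds] is a small ball in the chart. The chains joining [p] to points near [X] may turn
    around the poles and leave it, but they stay in [chartU], hence on the same leaf; only their
    endpoints need lie in [Ds]. *)
Lemma chart_dense (Delta : set V) : nbhs (0 : V) Delta -> exists Deltas : set V,
  [/\ open_nbhs (0 : V) Deltas, Deltas `<=` Delta &
   forall L, leaf chartU chartZ L -> L `&` (Deltas `\` chartS) !=set0 -> dense_leaf_in L Deltas].
Proof.
move=> /rn_nbhs [r [r0 HD]]; have [d [d0 Hd]] := @model_dense R.
have m04 : rn (0 : V) < 4 by rewrite rn0.
have [d1 d10 Hd1] := row_cont (fun i => dPs i m04) r0.
pose dl := Num.min d (Num.min d1 (1/4)).
have dl0 : 0 < dl by rewrite !lt_min d0 d10 divr_gt0.
have dld : dl <= d by rewrite ge_min lexx.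
have dld1 : dl <= d1 by rewrite !ge_min lexx !orbT.
have dl4 : dl <= 1/4 by rewrite !ge_min lexx !orbT.
pose Ds : set V := [set X | O X /\ rn (Th X) < dl].
have DsU X : Ds X -> chartU X.
  by move=> [OX h]; split => //; apply: model_domain_small; exact: lt_le_trans dl4.
exists Ds; split.
- split; last by split; rewrite ?Th0 ?rn0.
  apply/rn_open => X [OX h]; have [r1 [r10 HO]] := open_ball oO OX.
  have e0 : 0 < dl - rn (Th X) by rewrite subr_gt0.
  have [d2 d20 Hd2] := row_cont (fun i => dTh i OX) e0.
  exists (Num.min r1 d2); split; first by rewrite lt_min r10.
  move=> Y; rewrite lt_min => /andP[/HO OY /Hd2 h2]; split => //.
  by have := rnBB (Th Y) (Th X); lra.
- move=> X DX; apply: HD; rewrite -(Ps_U (DsU X DX)) -Ps0; apply: Hd1.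
  by rewrite subr0; apply: lt_le_trans dld1; exact: DX.2.
move=> L [p0 [[Up0 _] ->]] [p [/= p0p [Dp nSp]]] X DX B /rn_nbhs [e [e0 HB]].
have Up := DsU p Dp; have UX := DsU X DX.
have yp : Th p 0 o1 != 0 by apply/eqP => h; apply: nSp.
have [e1 e10 He1] := row_cont (fun i => dPs i (model_domain_bd UX.2)) e0.
(* The second bound keeps the approximating point in [Ds], since density is required of the trace of
   the leaf on [Ds]. *)
have g0 : 0 < Num.min e1 (dl - rn (Th X)) by rewrite lt_min e10 subr_gt0; exact: DX.2.
have [m [pm]] := Hd (Th p) (Th X) (lt_le_trans Dp.2 dld) (lt_le_trans DX.2 dld) yp _ g0.
rewrite lt_min => /andP[/He1 mX1 mX2].
have mdl : rn m < dl by have := rnBB m (Th X); lra.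
have m4 : rn m < 4 by lra.
have [OPm TPm] := ThPs m4.
exists (Ps m); split; last by apply: HB; rewrite -(Ps_U UX).
split => /=; last by split; rewrite ?TPm.
apply: rt_trans p0p _; rewrite -(Ps_U Up); exact: chart_chain.
Qed.

End Final.

Theorem corollary1 (R : realType) (V : set (C3 R)) (eta : C3 R -> C3dual R) :
  open_nbhs (0 : C3 R) V ->
  holomorphic_on V eta ->
  contact_at eta (0 : C3 R) ->
  exists (U : set (C3 R)) (Z : C3 R -> C3 R) (S : set (C3 R)),
    [/\ open_nbhs (0 : C3 R) U, connected U & U `<=` V] /\
    [/\ holomorphic_on U Z, exists x, U x /\ Z x != 0 & legendrian eta U Z] /\
    [/\ analytic_hypersurface U S, invariant U Z S & S 0] /\
    (forall Delta : set (C3 R), nbhs (0 : C3 R) Delta ->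
      exists Deltas : set (C3 R),
        [/\ open_nbhs (0 : C3 R) Deltas, Deltas `<=` Delta
          & forall L, leaf U Z L -> L `&` (Deltas `\` S) !=set0 ->
              dense_leaf_in L Deltas]).
Proof.
move=> [oV V0] heta ct; have K0 : 0 < 4 :> R by [].
have [Th [Ps [ O ch]]] := darboux K0 oV V0 heta ct.
exists (chartU Th O), (chartZ Th Ps), (chartS Th O).
have U0 := chartU0 ch.
split; first by split; [split => //; exact: chartU_open ch|exact: chartU_connected ch|exact: chartU_sub ch].
split; first by split; [exact: chartZ_holo ch|exists 0; split => //; exact: (chartZ_neq0 ch U0)|exact: chart_legendrian ch].
split; first by split; [exact: chart_hypersurface ch|exact: chart_invariant ch|exact: chartS0 ch].
exact: chart_dense ch.
Qed.
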